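(* Let $u_0\in L^\infty(\mathbb{R})$ and let $u$ be the entropy solution of Burgers' equation $\partial_t u+\partial_x\big(\tfrac12u^2\big)=0$, $u(0)=u_0$. For $c\in\mathbb{R}$ let $a_c(x,t)=A(u(x,t),c)$ with $A$ corresponding to $f(u)=\tfrac12u^2$, i.e. $a_c(x,t)=\tfrac12\big(u(x,t)+c\big)$. Then the ODE $$\dot x_t=a_c(x_t,t)\ \text{ for } t>s,\qquad x_s=x,$$ is well-posed in the Filippov sense for all $x\in\mathbb{R}$, all $s\geq0$ and all $c\in\mathbb{R}$.
   Context: $\mathbb{R}_+=[0,\infty)$, $f(u)=\tfrac12u^2$, and in general $A(v,c)=\frac{f(v)-f(c)}{v-c}$ for $v\neq c$, $A(c,c)=f'(c)$. Weak solution of $\partial_t u+\partial_x f(u)=0$, $u(0)=u_0$: $u\in L^\infty(\mathbb{R}\times\mathbb{R}_+)$ with $\int_{\mathbb{R}_+}\int_{\mathbb{R}} u\,\partial_t\varphi+f(u)\,\partial_x\varphi\,dx\,dt+\int_{\mathbb{R}} u_0(x)\varphi(x,0)\,dx=0$ for all $\varphi\in C_c^\infty(\mathbb{R}\times\mathbb{R}_+)$. Entropy pair: $(\eta,q)$ with $\eta:\mathbb{R}\to\mathbb{R}$ convex and $q'=\eta' f'$ (a.e., $q$ locally Lipschitz). Entropy solution: a weak solution $u$ such that $\int_{\mathbb{R}_+}\int_{\mathbb{R}}\eta(u)\partial_t\varphi+q(u)\partial_x\varphi\,dx\,dt+\int_{\mathbb{R}}\eta(u_0(x))\varphi(x,0)\,dx\geq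 0$ for all $0\leq\varphi\in C_c^\infty(\mathbb{R}\times\mathbb{R}_+)$ and all entropy pairs $(\eta,q)$. By Kruzkhov, it exists and is unique for $u_0\in L^\infty(\mathbb{R})$. Filippov solution: for measurable $a=a(x,t)$, put $\underline a(x,t)=\lim_{\delta\downarrow0}\operatorname{ess\,inf}_{y\in(x-\delta,x+\delta)}a(y,t)$ and $\overline a(x,t)=\lim_{\delta\downarrow0}\operatorname{ess\,sup}_{y\in(x-\delta,x+\delta)}a(y,t)$. A Filippov solution of $\dot x_t=a(x_t,t)$, $t>s$, $x_s=x$, is an absolutely continuous $t\mapsto x_t$ on $[s,\infty)$ with $x_s=x$ and $\underline a(x_t,t)\leq\dot x_t\leq\overline a(x_t,t)$ for a.e. $t>s$. Well-posed in the Filippov sense for given $(x,s)$: there is exactly one Filippov solution starting from $(x,s)$. *)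

(* Defs.v *)
From HB Require Import structures.
From mathcomp Require Import all_boot all_order all_algebra.
From mathcomp Require Import all_classical all_reals all_analysis.
From mathcomp Require Import ess_sup_inf.
From mathcomp Require Import ring.

Set Implicit Arguments.
Unset Strict Implicit.
Unset Printing Implicit Defensive.

Import Order.TTheory GRing.Theory Num.Theory.
Import numFieldNormedType.Exports.

Local Open Scope classical_set_scope.
Local Open Scope ring_scope.

Section flux.
Context {R : realType}.
Implicit Types (f : R -> R) (u v c : R).

Definition burgers_flux u : R := 2^-1 * u ^+ 2.

(* A(v, c): the slope of the chord of f between c and v, f'(c) on the diagonal. *)
Definition chord_speed f v c : R :=
  if v == c then derive1 f c else (f v - f c) / (v - c).

Lemma derive1_burgers_flux c : derive1 burgers_flux c = c.
Proof.
rewrite derive1E /burgers_flux deriveZ//= exp_derive expr1 scaler1.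
by rewrite /GRing.scale/= mulKf ?pnatr_eq0.
Qed.

Lemma chord_speed_burgersE v c : chord_speed burgers_flux v c = 2^-1 * (v + c).
Proof.
rewrite /chord_speed; case: eqVneq => [->|vc].
  by rewrite derive1_burgers_flux; field.
have vc0 : v - c != 0 by rewrite subr_eq0.
by rewrite /burgers_flux; field.
Qed.

End flux.

(* Points of space-time are pairs (x, t), position first. *)
Section spacetime.
Context {R : realType}.
Local Notation mu := (@lebesgue_measure R).
Implicit Types (phi : R * R -> R).

Definition Rplus : set R := `[0, +oo[.
Definition half_plane : set (R * R) := [set: R] `*` Rplus.

(* A class in L^oo is given by a Borel representative; u is unconstrained, and
   never used, at negative times. *)
Definition Linfty_half_plane (u : R * R -> R) : Prop :=
  (u \_ half_plane) \in Lfun (mu \x mu)%E +oo%E.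

Definition partial_x phi : R * R -> R := 'D_((1, 0) : R * R) phi.
Definition partial_t phi : R * R -> R := 'D_((0, 1) : R * R) phi.

Fixpoint differentiability_class (k : nat) phi : Prop :=
  if k is k'.+1 then
    [/\ forall p, derivable phi p (1, 0), forall p, derivable phi p (0, 1),
        differentiability_class k' (partial_x phi)
      & differentiability_class k' (partial_t phi)]
  else continuous phi.

Definition smooth phi : Prop := forall k, differentiability_class k phi.

(* C_c^oo(R x R_+): the elements are restrictions to the closed half-plane of
   functions in C_c^oo(R^2), so they need not vanish at time 0. Only the values
   on the half-plane are ever used. *)
Definition test_function phi : Prop :=
  smooth phi /\ compact (closure [set p | phi p != 0]).

End spacetime.

Section conservation_law.
Context {R : realType}.
Local Notation mu := (@lebesgue_measure R).
Implicit Types (f eta q : R -> R) (u : R * R -> R) (phi : R * R -> R).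

Local Open Scope ereal_scope.

(* Common left-hand side of the weak formulation (eta = id, q = f) and of the
   entropy inequality. *)
Definition weak_form eta q (u0 : R -> R) u phi : \bar R :=
  \int[mu]_(t in Rplus) \int[mu]_x
    (eta (u (x, t)) * partial_t phi (x, t)
     + q (u (x, t)) * partial_x phi (x, t))%R%:E
  + \int[mu]_x (eta (u0 x) * phi (x, 0%R))%R%:E.

Definition weak_solution f (u0 : R -> R) u : Prop :=
  Linfty_half_plane u /\
  forall phi, test_function phi -> weak_form id f u0 u phi = 0.

(* A convex eta is differentiable off a countable set, and a locally Lipschitz q
   almost everywhere, so the two derivability conditions below cost nothing: they
   only ensure that derive1 denotes a genuine derivative. *)
Definition entropy_pair f eta q : Prop :=
  [/\ convex_function [set: R] eta,
      [locally [lipschitz q x | x in [set: R]]]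
    & {ae mu, forall v, [/\ derivable eta v 1, derivable q v 1
        & derive1 q v = (derive1 eta v * derive1 f v)%R]}].

Definition entropy_solution f (u0 : R -> R) u : Prop :=
  weak_solution f u0 u /\
  forall eta q, entropy_pair f eta q ->
  forall phi, test_function phi ->
    {in half_plane, forall p, (0 <= phi p)%R} ->
    0 <= weak_form eta q u0 u phi.

End conservation_law.

Section filippov.
Context {R : realType}.
Local Notation mu := (@lebesgue_measure R).
Implicit Types (a : R * R -> R) (x t s : R) (gamma : R -> R).

Local Open Scope ereal_scope.

Definition ess_inf_on (i : interval R) (g : R -> R) : \bar R :=
  ess_inf (mrestr mu (measurable_itv i)) (EFin \o g).
Definition ess_sup_on (i : interval R) (g : R -> R) : \bar R :=
  ess_sup (mrestr mu (measurable_itv i)) (EFin \o g).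

(* Both limits exist in \bar R, by monotonicity in delta. *)
Definition lower_envelope a x t : \bar R :=
  lim (ess_inf_on `](x - delta)%R, (x + delta)%R[ (fun y => a (y, t))
       @[delta --> 0%R^'+]).
Definition upper_envelope a x t : \bar R :=
  lim (ess_sup_on `](x - delta)%R, (x + delta)%R[ (fun y => a (y, t))
       @[delta --> 0%R^'+]).

Local Open Scope ring_scope.

Definition absolutely_continuous (I : set R) gamma : Prop :=
  forall eps, 0 < eps -> exists2 delta, 0 < delta &
    forall (n : nat) (l r : 'I_n -> R),
      (forall i, [/\ I (l i), I (r i) & l i <= r i]) ->
      trivIset [set: 'I_n] (fun i => `]l i, r i[%classic) ->
      \sum_(i < n) (r i - l i) < delta ->
      \sum_(i < n) `|gamma (r i) - gamma (l i)| < eps.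

(* On the half-line, absolute continuity is required on compact subintervals.
   Only the restriction of gamma to [s, +oo[ matters. *)
Definition filippov_solution a x s gamma : Prop :=
  [/\ forall T, s <= T -> absolutely_continuous `[s, T] gamma,
      gamma s = x
    & {ae mu, forall t, s < t ->
        [/\ derivable gamma t 1,
            (lower_envelope a (gamma t) t <= (derive1 gamma t)%:E)%E
          & ((derive1 gamma t)%:E <= upper_envelope a (gamma t) t)%E]}].

Definition filippov_well_posed a x s : Prop :=
  exists2 gamma, filippov_solution a x s gamma &
    forall gamma', filippov_solution a x s gamma' ->
      {in `[s, +oo[, gamma' =1 gamma}.

End filippov.

(* Main.v *)
(** The entropy solution [v] has a Lipschitz potential [U] with [U_x = v] and
    [U_t = - v ^ 2 / 2]. Testing the conservation law and the single entropy pair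
    [(v ^ 2 / 2, v ^ 3 / 3)] against powers of the gap between [U] and a parabola
    gives the two Hopf-Lax bounds, hence the semiconcavity of [U(., t)] with
    constant [1 / t], that is Oleinik's estimate
    [v(x, t) - v(y, t) <= (x - y) / t] for [y < x].

    Uniqueness: the difference [d] of two Filippov solutions satisfies
    [d' <= d / (2 t)] where it is positive, so if [d] vanishes at [t0] then a bound
    [d(t) <= C (t - t0)] improves to [d(t) <= (C / 2) (t - t0)], and so on.

    Existence: Euler polygons driven by difference quotients of [U] converge along
    an ultrafilter. Semiconcavity bounds their slopes by difference quotients of
    [U] taken slightly to the left and to the right, which confines the derivative
    of the limit between the two envelopes. *)

Require Import Defs.
From mathcomp Require Import all_boot all_order all_algebra.
From mathcomp Require Import all_classical all_reals all_analysis.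
From mathcomp Require Import ring lra measurable_realfun ess_sup_inf.

Set Implicit Arguments.
Unset Strict Implicit.
Unset Printing Implicit Defensive.

Import Order.TTheory GRing.Theory Num.Theory.
Import numFieldNormedType.Exports.

Local Open Scope classical_set_scope.
Local Open Scope ring_scope.

(** * Integrals of bounded functions with compact support *)

(** The start time [s = 0] is allowed, and [1 / (2 * t)] is not integrable there, so Gronwall's
    lemma gives nothing. Averaging [v] with the constant [c] halves Oleinik's constant, and this
    factor 1/2 is what makes the iteration contract: under [d' <= d / t] a difference growing
    linearly from time 0 could not be excluded.

    A single entropy suffices because of a cancellation. Let [Z] be the gap and [w] the slope of the
    parabola, itself a solution of Burgers' equation. The entropy inequality against [Z ^ 2 / 2]
    minus the conservation law against [w * Z ^ 2 / 2] is, up to exact derivatives, a relative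
    entropy inequality in [y = v - w]. The derivatives of [Z] contain [v] again, and the quartic
    part becomes minus the determinant [y * (y ^ 3 / 3) - (y ^ 2 / 2) ^ 2 = y ^ 4 / 12], which has
    the right sign.

    These test functions are only Lipschitz, while smoothness is checked only for products of a
    function of [x] and a function of [t]. Integrating the weak form at product kernels against a
    Lipschitz weight in the centre, and shrinking the kernels, moves the derivatives onto the
    weight. *)

Section bcs.
Context {R : realType}.
Local Notation mu := (@lebesgue_measure R).
Implicit Types (f g h : R -> R) (F G : R -> R -> R).

Lemma aeS (P Q : R -> Prop) : (forall x, P x -> Q x) ->
  {ae mu, forall x, P x} -> {ae mu, forall x, Q x}.
Proof.
by move=> PQ; apply: filterS => //; exact: (ae_filter_ringOfSetsType mu).
Qed.

Lemma aeI (P Q : R -> Prop) : {ae mu, forall x, P x} ->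
  {ae mu, forall x, Q x} -> {ae mu, forall x, P x /\ Q x}.
Proof.
by move=> aP aQ; apply: filterI => //; exact: (ae_filter_ringOfSetsType mu).
Qed.

Lemma ae_nat (P : nat -> R -> Prop) : (forall n, {ae mu, forall x, P n x}) ->
  {ae mu, forall x, forall n, P n x}.
Proof. by move=> aP; apply/ae_foralln. Qed.

(** One constant serves for the values and for the support, so that closure properties produce a
    single witness. *)
Definition bounded_support f := exists C : R,
  (forall x, `|f x| <= C) /\ (forall x, C < `|x| -> f x = 0).

Definition bcs f := measurable_fun setT f /\ bounded_support f.

Definition I f : R := Rintegral mu setT f.

Lemma mu_itv_fin (a b : R) : (mu `[a, b] < +oo)%E.
Proof. by rewrite lebesgue_measure_itv/=; case: ifP => _; rewrite ?ltry// -EFinB ltry. Qed.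

Lemma mu_itv (a b : R) : a <= b -> mu `[a, b] = (b - a)%:E.
Proof.
move=> ab; rewrite lebesgue_measure_itv/= lte_fin; case: ltP => //= ba.
by apply/esym/eqP; rewrite eqe subr_eq0 eq_le ab ba.
Qed.

Lemma bounded_supportP f : bounded_support f -> exists C : R,
  [/\ 0 < C, forall x, `|f x| <= C & forall x, C < `|x| -> f x = 0].
Proof.
move=> [C [h1 h2]]; exists (`|C| + 1); split.
- by rewrite ltr_pwDr.
- by move=> x; rewrite (le_trans (h1 x))// (le_trans (ler_norm C))// lerDl.
- move=> x hx; apply: h2; apply: le_lt_trans hx.
  by rewrite (le_trans (ler_norm C))// lerDl.
Qed.

Lemma bcs_integrable f : bcs f -> mu.-integrable setT (EFin \o f).
Proof.
move=> [mf /bounded_supportP [C [C0 h1 h2]]].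
apply/integrableP; split; first exact/measurable_EFinP.
apply: (@le_lt_trans _ _ (\int[mu]_x (C%:E * (\1_`[- C, C] x)%:E))%E).
  apply: ge0_le_integral => //.
  - apply: measurableT_comp => //; exact/measurable_EFinP.
  - by apply/measurable_EFinP; apply: measurable_funM => //; exact: measurable_indic.
  - move=> x _; rewrite /= lee_fin indicE.
    case: (leP `|x| C) => hx.
      rewrite mem_set ?mulr1//= in_itv/=; by rewrite -ler_norml.
    by rewrite h2// normr0 mulr_ge0// ltW.
rewrite ge0_integralZl//=; last 2 first.
- by apply/measurable_EFinP; exact: measurable_indic.
- by rewrite lee_fin ltW.
rewrite integral_indic//= setIT.
by rewrite lte_mul_pinfty// ?lee_fin ?ltW// mu_itv_fin.
Qed.

Lemma EFin_I f : bcs f -> (\int[mu]_x (f x)%:E)%E = (I f)%:E.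
Proof.
move=> bf; rewrite /I /Rintegral fineK//.
apply: integrable_fin_num => //; exact: bcs_integrable.
Qed.

Lemma bcsM f g : bcs f -> measurable_fun setT g ->
  (exists C : R, forall x, `|g x| <= C) -> bcs (fun x => f x * g x).
Proof.
move=> [mf /bounded_supportP [C [C0 h1 h2]]] mg [C' hg]; split.
  exact: measurable_funM.
exists (C * (1 + `|C'|)); split=> [x|x hx].
  rewrite normrM ler_pM// (le_trans (hg x))// (le_trans (ler_norm C'))//.
  by rewrite lerDr.
rewrite h2 ?mul0r//; apply: le_lt_trans hx.
by rewrite ler_peMr ?(ltW C0)// lerDl normr_ge0.
Qed.

Lemma bcsD f g : bcs f -> bcs g -> bcs (fun x => f x + g x).
Proof.
move=> [mf /bounded_supportP [C [C0 h1 h2]]] [mg /bounded_supportP [C' [C'0 h1' h2']]].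
split; first exact: measurable_funD.
exists (C + C'); split=> [x|x hx].
  by rewrite (le_trans (ler_normD _ _))// lerD.
by rewrite h2 ?h2' ?addr0//; apply: le_lt_trans hx; rewrite ?lerDl ?lerDr ltW.
Qed.

Lemma bcsZ (c : R) f : bcs f -> bcs (fun x => c * f x).
Proof.
move=> bf; rewrite (_ : (fun x => _) = (fun x => f x * c)).
  by apply: bcsM => //; exists `|c|.
by apply/funext => x; rewrite mulrC.
Qed.

Lemma bcsN f : bcs f -> bcs (fun x => - f x).
Proof.
move=> /(bcsZ (-1)); rewrite (_ : (fun x => -1 * _) = (fun x => - f x))//.
by apply/funext => x; rewrite mulN1r.
Qed.

Lemma bcsB f g : bcs f -> bcs g -> bcs (fun x => f x - g x).
Proof. by move=> bf /bcsN; exact: bcsD. Qed.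

Lemma bcs_norm f : bcs f -> bcs (fun x => `|f x|).
Proof.
move=> [mf [C [h1 h2]]]; split; first exact: measurableT_comp.
by exists C; split=> x; rewrite ?normr_id// => /h2 ->; rewrite normr0.
Qed.

Lemma bcs_cond (P : R -> bool) f : measurable [set x | P x] -> bcs f ->
  bcs (fun x => if P x then f x else 0).
Proof.
move=> mP [mf [C [h1 h2]]]; split.
  apply: measurable_fun_ifT => //.
  apply: (measurable_fun_bool true).
  by rewrite setTI (_ : _ @^-1` _ = [set x | P x]).
exists C; split=> x; last by move=> /h2 ->; case: ifP.
by case: ifP => _//; rewrite normr0 (le_trans _ (h1 0)).
Qed.

Lemma I_D f g : bcs f -> bcs g -> I (fun x => f x + g x) = I f + I g.
Proof. by move=> bf bg; rewrite /I RintegralD//; exact: bcs_integrable. Qed.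

Lemma I_B f g : bcs f -> bcs g -> I (fun x => f x - g x) = I f - I g.
Proof. by move=> bf bg; rewrite /I RintegralB//; exact: bcs_integrable. Qed.

Lemma I_Z (c : R) f : bcs f -> I (fun x => c * f x) = c * I f.
Proof. by move=> bf; rewrite /I RintegralZl//; exact: bcs_integrable. Qed.

Lemma I_N f : bcs f -> I (fun x => - f x) = - I f.
Proof.
by move=> bf; rewrite -mulN1r -I_Z//; congr I; apply/funext => x; rewrite mulN1r.
Qed.

Lemma I_0 : I (fun=> 0) = 0.
Proof. by rewrite /I /Rintegral integral0. Qed.

Lemma I_ge0 f : (forall x, 0 <= f x) -> 0 <= I f.
Proof. by move=> f0; apply: Rintegral_ge0. Qed.

Lemma I_le f g : bcs f -> bcs g -> (forall x, f x <= g x) -> I f <= I g.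
Proof.
move=> bf bg fg; rewrite -subr_ge0 -I_B//; apply: I_ge0 => x.
by rewrite subr_ge0.
Qed.

Lemma I_norm f : bcs f -> `|I f| <= I (fun x => `|f x|).
Proof. by move=> bf; apply: le_normr_Rintegral => //; exact: bcs_integrable. Qed.

Lemma indic_itv_bcs (c a b : R) : bcs (fun x => c * \1_`[a, b] x).
Proof.
apply: bcsZ; split; first exact: measurable_indic.
exists (1 + `|a| + `|b|); split=> x.
  rewrite indicE ger0_norm//; case: (x \in _) => //=.
  - by rewrite (le_trans (y := 1))// -addrA lerDl addr_ge0.
  - by rewrite !addr_ge0.
move=> hx; rewrite indicE memNset//= in_itv/= => /andP[ax xb].
move: hx; rewrite ltNge => /negP; apply.
rewrite ler_norml -!addrA; apply/andP; split.
  have := ler_norm (- a); rewrite normrN => h1; have := normr_ge0 b; lra.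
have := ler_norm b; have := normr_ge0 a; lra.
Qed.

Lemma I_itv (c a b : R) : a <= b -> I (fun x => c * \1_`[a, b] x) = c * (b - a).
Proof.
move=> ab; have h := indic_itv_bcs 1 a b.
rewrite I_Z; last by move: h; under eq_fun do rewrite mul1r.
congr (_ * _); rewrite /I /Rintegral integral_indic// setIT.
exact: (congr1 fine (mu_itv ab)).
Qed.

Lemma bcs_le_bound f (C a b : R) : bcs f -> a <= b ->
  (forall x, `|f x| <= C) -> (forall x, ~~ (a <= x <= b) -> f x = 0) ->
  `|I f| <= C * (b - a).
Proof.
move=> bf ab fC f0; rewrite (le_trans (I_norm bf))// -I_itv//.
apply: I_le; [exact: bcs_norm|exact: indic_itv_bcs|move=> x].
rewrite indicE; have [xab|xab] := boolP (a <= x <= b).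
  by rewrite mem_set ?mulr1//= in_itv.
by rewrite f0// normr0 memNset ?mulr0//= in_itv/=; exact/negP.
Qed.

(** The dominating function is [C] times the indicator of [[- C, C]]. Other limits are reached by
    subtracting the limit first. *)
Lemma I_dct (f_ : nat -> R -> R) (C : R) :
  (forall n, measurable_fun setT (f_ n)) ->
  (forall n x, `|f_ n x| <= C) ->
  (forall n x, C < `|x| -> f_ n x = 0) ->
  {ae mu, forall x, f_ n x @[n --> \oo] --> 0} ->
  I (f_ n) @[n --> \oo] --> 0.
Proof.
move=> mf h1 h2 cf.
have C0 : 0 <= C by exact: le_trans (normr_ge0 _) (h1 0%N 0).
have mEf n : measurable_fun setT (EFin \o f_ n) by exact/measurable_EFinP.
have bf n : bcs (f_ n) by split=> //; exists C; split; [exact: h1|exact: h2].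
have hc : {ae mu, forall x, setT x -> (EFin \o f_ n) x @[n --> \oo] --> (cst 0%E x : \bar R)}.
  by apply: aeS cf => x cx _; apply: cvg_EFin; [exact: nearW|exact: cx].
have hb : {ae mu, forall x, forall n : nat, setT x ->
    (`|(EFin \o f_ n) x| <= (C * \1_`[- C, C] x)%R%:E)%E}.
  apply/aeW => x n _ /=; rewrite lee_fin indicE.
  case: (leP `|x| C) => hx.
    by rewrite mem_set ?mulr1//= in_itv/=; rewrite -ler_norml.
  by rewrite h2// normr0 mulr_ge0.
have [_ _] := @dominated_convergence _ (measurableTypeR R) R mu setT measurableT
  (fun n => EFin \o f_ n) (cst 0%E) (EFin \o (fun x => C * \1_`[- C, C] x)) mEf
  (measurable_cst _) hc (bcs_integrable (indic_itv_bcs _ _ _)) hb.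
rewrite integral0 => H.
have := fine_cvg H; exact.
Qed.

End bcs.

(** * Functions of two variables and iterated integrals *)

Section bcs2.
Context {R : realType}.
Local Notation mu := (@lebesgue_measure R).
Implicit Types (F G : R -> R -> R).

(** Tonelli's theorem covers nonnegative integrands; the general case is the difference of the
    positive and negative parts. *)
Lemma measurable_I d (T : measurableType d) (H : T -> R -> R) :
  measurable_fun setT (fun p : T * R => H p.1 p.2) ->
  (forall p, bcs (H p)) -> measurable_fun setT (fun p => I (H p)).
Proof.
move=> mH bH.
have pos (K : T -> R -> R) : measurable_fun setT (fun p : T * R => K p.1 p.2) ->
    (forall p, bcs (K p)) -> (forall p z, 0 <= K p z) ->
    measurable_fun setT (fun p => I (K p)).
  move=> mK bK K0.
  have := @measurable_fun_fubini_tonelli_F _ _ T (measurableTypeR R) R mu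
    (fun p => (K p.1 p.2)%:E) _ (fun p => K0 p.1 p.2).
  move=> h.
  have h' : measurable_fun setT (fun p => (I (K p))%:E).
    have -> : (fun p => (I (K p))%:E) =
       fubini_F mu (fun p : T * measurableTypeR R => (K p.1 p.2)%:E).
      by apply/funext => p; rewrite /fubini_F/= EFin_I.
    by apply: h; exact/measurable_EFinP.
  by move/measurable_EFinP : h'.
have bmax (h : R -> R) : bcs h -> bcs (fun z => Num.max (h z) 0).
  move=> [mh [C [h1 h2]]]; split.
    by apply: measurable_maxr => //.
  exists C; split=> z; last by move=> /h2 ->; rewrite maxxx.
  rewrite (le_trans _ (h1 z))//; case: (leP (h z) 0) => // _.
  by rewrite normr0.
rewrite (_ : (fun p => _) = (fun p => I (fun z => Num.max (H p z) 0) -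
    I (fun z => Num.max (- H p z) 0))).
  apply: measurable_funB; apply: pos.
  - by apply: measurable_maxr => //.
  - by move=> p; exact: bmax.
  - by move=> p z; rewrite le_max lexx orbT.
  - by apply: measurable_maxr => //; exact: measurableT_comp.
  - by move=> p; apply: (bmax (fun z => - H p z)); exact: bcsN.
  - by move=> p z; rewrite le_max lexx orbT.
apply/funext => p; rewrite -I_B; last 2 first.
- exact: bmax.
- by apply: (bmax (fun z => - H p z)); exact: bcsN.
congr I; apply/funext => z.
have [h|h] := leP (H p z) 0.
  by rewrite max_l ?oppr_ge0// opprK add0r.
by rewrite max_r ?subr0// oppr_le0 ltW.
Qed.

Definition mf2 F := measurable_fun setT (fun p : R * R => F p.1 p.2).

Definition bcs2 F := mf2 F /\ exists C : R,
  (forall x t, `|F x t| <= C) /\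
  (forall x t, C < `|x| \/ C < `|t| -> F x t = 0).

Definition I2 F : R := I (fun x => I (fun t => F x t)).

Lemma bcs2P F : bcs2 F -> exists C : R, [/\ 0 < C, (forall x t, `|F x t| <= C) &
  (forall x t, C < `|x| \/ C < `|t| -> F x t = 0)].
Proof.
move=> [_ [C [h1 h2]]]; exists (`|C| + 1); split.
- by rewrite ltr_pwDr.
- by move=> x t; rewrite (le_trans (h1 x t))// (le_trans (ler_norm C))// lerDl.
- have CC : C <= `|C| + 1 by rewrite (le_trans (ler_norm C))// lerDl.
  by move=> x t hx; apply: h2; case: hx => h; [left|right]; exact: le_lt_trans h.
Qed.

Lemma mf2_swap F : mf2 F -> mf2 (fun t x => F x t).
Proof.
by move=> mF; exact: (measurableT_comp mF (@measurable_swap _ _ _ _)).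
Qed.

Lemma bcs2_swap F : bcs2 F -> bcs2 (fun t x => F x t).
Proof.
move=> [mF [C [h1 h2]]]; split; first exact: mf2_swap.
by exists C; split=> // x t h; apply: h2; case: h; [right|left].
Qed.

Lemma mf2_x F x : mf2 F -> measurable_fun setT (F x).
Proof.
by move=> mF; exact: (measurableT_comp mF (@measurable_pair1 _ _ _ _ x)).
Qed.

Lemma bcs2_x F x : bcs2 F -> bcs (F x).
Proof.
move=> bF; split; first by apply: mf2_x; case: bF.
have [_ [C [h1 h2]]] := bF; exists C; split=> // t Ct.
by apply: h2; right.
Qed.

Lemma bcs2_t F t : bcs2 F -> bcs (fun x => F x t).
Proof. by move=> /bcs2_swap /(bcs2_x t). Qed.

Lemma bcs2_I F : bcs2 F -> bcs (fun x => I (F x)).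
Proof.
move=> bF; split.
  by apply: measurable_I; [case: bF|move=> x; exact: bcs2_x].
have [C [C0 h1 h2]] := bcs2P bF.
exists (C + C * (C - - C)); split=> [x|x hx].
  rewrite (le_trans (y := C * (C - - C)))//; last by rewrite lerDr ltW.
  apply: bcs_le_bound => //.
  - exact: bcs2_x.
  - by rewrite -subr_ge0 opprK addr_ge0 ?ltW.
  - by move=> t; rewrite -ler_norml -ltNge => ht; apply: h2; right.
rewrite (_ : F x = fun=> 0) ?I_0//; apply/funext => t; apply: h2; left.
by apply: le_lt_trans hx; rewrite lerDl mulr_ge0 ?opprK ?addr_ge0 ?ltW.
Qed.

Lemma bcs2_I' F : bcs2 F -> bcs (fun t => I (fun x => F x t)).
Proof. by move=> /bcs2_swap; exact: bcs2_I. Qed.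

Lemma bcs2M F G : bcs2 F -> mf2 G -> (exists C, forall x t, `|G x t| <= C) ->
  bcs2 (fun x t => F x t * G x t).
Proof.
move=> bF mG [C' hC']; have [C [C0 h1 h2]] := bcs2P bF.
split; first by apply: measurable_funM => //; case: bF.
exists (C * (1 + `|C'|)); split=> [x t|x t h].
  rewrite normrM ler_pM// (le_trans (hC' x t))// (le_trans (ler_norm _))//.
  by rewrite lerDr.
have CC : C <= C * (1 + `|C'|) by rewrite ler_peMr ?(ltW C0)// lerDl normr_ge0.
rewrite h2 ?mul0r//; case: h => h; [left|right]; exact: le_lt_trans h.
Qed.

Lemma bcs2D F G : bcs2 F -> bcs2 G -> bcs2 (fun x t => F x t + G x t).
Proof.
move=> bF bG; have [C [C0 h1 h2]] := bcs2P bF; have [D [D0 k1 k2]] := bcs2P bG.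
split; first by apply: measurable_funD => //; [case: bF|case: bG].
exists (C + D); split=> [x t|x t h].
  by rewrite (le_trans (ler_normD _ _))// lerD.
rewrite h2 ?k2 ?addr0//; case: h => h; [left|right|left|right];
  by apply: le_lt_trans h; rewrite ?lerDl ?lerDr ltW.
Qed.

Lemma bcs2Z (c : R) F : bcs2 F -> bcs2 (fun x t => c * F x t).
Proof.
move=> bF; rewrite (_ : (fun x t => _) = (fun x t => F x t * c)).
  by apply: bcs2M => //; [exact: measurable_cst|exists `|c|].
by apply/funext => x; apply/funext => t; rewrite mulrC.
Qed.

Lemma bcs2N F : bcs2 F -> bcs2 (fun x t => - F x t).
Proof.
move=> /(bcs2Z (-1)); rewrite (_ : (fun x t => -1 * _) = (fun x t => - F x t))//.
by apply/funext => x; apply/funext => t; rewrite mulN1r.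
Qed.

Lemma bcs2B F G : bcs2 F -> bcs2 G -> bcs2 (fun x t => F x t - G x t).
Proof. by move=> bF /bcs2N; exact: bcs2D. Qed.

Lemma bcs2_norm F : bcs2 F -> bcs2 (fun x t => `|F x t|).
Proof.
move=> [mF [C [h1 h2]]]; split; first exact: measurableT_comp.
by exists C; split=> x t; rewrite ?normr_id// => /h2 ->; rewrite normr0.
Qed.

Lemma I2_D F G : bcs2 F -> bcs2 G ->
  I2 (fun x t => F x t + G x t) = I2 F + I2 G.
Proof.
move=> bF bG; rewrite /I2 -I_D; [|exact: bcs2_I|exact: bcs2_I].
by congr I; apply/funext => x; rewrite I_D//; exact: bcs2_x.
Qed.

Lemma I2_Z (c : R) F : bcs2 F -> I2 (fun x t => c * F x t) = c * I2 F.
Proof.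
move=> bF; rewrite /I2 -I_Z; last exact: bcs2_I.
by congr I; apply/funext => x; rewrite I_Z//; exact: bcs2_x.
Qed.

Lemma I2_N F : bcs2 F -> I2 (fun x t => - F x t) = - I2 F.
Proof.
move=> bF; rewrite /I2 -I_N; last exact: bcs2_I.
by congr I; apply/funext => x; rewrite I_N//; exact: bcs2_x.
Qed.

Lemma I2_B F G : bcs2 F -> bcs2 G ->
  I2 (fun x t => F x t - G x t) = I2 F - I2 G.
Proof. by move=> bF bG; rewrite I2_D ?I2_N//; exact: bcs2N. Qed.

Lemma I2_ge0 F : (forall x t, 0 <= F x t) -> 0 <= I2 F.
Proof. by move=> F0; do 2 apply: I_ge0 => ?. Qed.

Lemma I2_le F G : bcs2 F -> bcs2 G -> (forall x t, F x t <= G x t) ->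
  I2 F <= I2 G.
Proof.
move=> bF bG FG; apply: I_le => [||x]; [exact: bcs2_I|exact: bcs2_I|].
by apply: I_le => [||t//]; exact: bcs2_x.
Qed.

Lemma I2_swap F : bcs2 F -> I2 F = I (fun t => I (fun x => F x t)).
Proof.
move=> bF.
have mF : measurable_fun setT (fun p : measurableTypeR R * measurableTypeR R => (F p.1 p.2)%:E).
  by apply/measurable_EFinP; case: bF.
have iF : (mu \x mu)%E.-integrable setT
    (fun p : measurableTypeR R * measurableTypeR R => (F p.1 p.2)%:E).
  apply/integrable12ltyP => //=.
  rewrite (_ : (\int[mu]_x _)%E = (I (fun x => I (fun t => `|F x t|)))%:E) ?ltry//.
  rewrite -EFin_I; last by apply: bcs2_I; exact: bcs2_norm.
  apply: eq_integral => x _; rewrite -EFin_I//.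
  by apply: bcs_norm; exact: bcs2_x.
have /(congr1 fine) := Fubini iF => /=.
rewrite (_ : (\int[mu]_x _)%E = (I2 F)%:E); last first.
  rewrite -EFin_I; last exact: bcs2_I.
  by apply: eq_integral => x _; rewrite -EFin_I//; exact: bcs2_x.
rewrite (_ : (\int[mu]_y _)%E = (I (fun t => I (fun x => F x t)))%:E)//.
rewrite -EFin_I; last exact: bcs2_I'.
by apply: eq_integral => x _; rewrite -EFin_I//; exact: bcs2_t.
Qed.

End bcs2.

(** * Smooth kernels *)

Section derive_eps.
Context {R : realType}.
Implicit Types (f g : R -> R).

(** The increment form has neither quotient nor punctured neighbourhood, so error terms can be added
    and rescaled directly. *)
Lemma is_deriveP f (x l : R) : is_derive x 1 f l <->
  forall e, 0 < e -> exists2 d, 0 < d &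
    forall h, `|h| < d -> `|f (x + h) - f x - l * h| <= e * `|h|.
Proof.
split=> [[df vf] e e0|H].
  have : h^-1 *: (f (h *: 1 + x) - f x) @[h --> 0^'] --> l.
    by rewrite -vf; exact: df.
  move=> /cvgrPdist_le /(_ _ e0) /nbhs_ballP[d /= d0 Hd]; exists d => // h hd.
  have [->|h0] := eqVneq h 0; first by rewrite addr0 subrr sub0r mulr0 normrN normr0 mulr0.
  have := Hd h; rewrite /ball/= sub0r normrN => /(_ hd h0).
  rewrite /GRing.scale/= mulr1 (addrC h).
  move=> H; have : `|l - h^-1 * (f (x + h) - f x)| * `|h| <= e * `|h|.
    by rewrite ler_wpM2r.
  by rewrite -normrM mulrBl mulrAC mulVf// mul1r -normrN opprB.
have : h^-1 *: (f (h *: 1 + x) - f x) @[h --> 0^'] --> l.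
  apply/cvgrPdist_le => e e0; have [d d0 Hd] := H _ e0.
  apply/nbhs_ballP; exists d => //= h; rewrite /ball/= sub0r normrN => hd h0.
  have := Hd _ hd; rewrite /GRing.scale/= mulr1 (addrC x).
  rewrite -(ler_pM2r (x := `|h|^-1)) ?invr_gt0 ?normr_gt0// -mulrA.
  rewrite mulfV ?normr_eq0// mulr1 -normfV -normrM mulrBl mulfK// (mulrC _ h^-1).
  by rewrite -normrN opprB.
move=> c; split; first by apply/cvg_ex; exists l.
exact: cvg_lim c.
Qed.

Lemma is_derive_near f g (x l d : R) : 0 < d ->
  (forall y, `|y - x| < d -> f y = g y) -> is_derive x 1 g l -> is_derive x 1 f l.
Proof.
move=> d0 fg /is_deriveP H; apply/is_deriveP => e /H[d' d'0 {}H].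
exists (Num.min d d') => [|h]; first by rewrite lt_min d0.
rewrite lt_min => /andP[hd hd']; rewrite !fg ?subrr ?normr0//; first exact: H.
by rewrite (addrC x) addrK.
Qed.

Lemma is_derive_cast f g (x l m : R) : is_derive x 1 f l -> (forall y, g y = f y) ->
  m = l -> is_derive x 1 g m.
Proof. by move=> h /funext -> ->. Qed.

Lemma is_derive_chain f g (x a b : R) : is_derive (g x) 1 f a ->
  is_derive x 1 g b -> is_derive x 1 (fun z => f (g z)) (a * b).
Proof. by move=> df dg; exact: (@is_derive1_comp _ f g x a b df dg). Qed.

(** Serves the points where a function is glued to zero: [gexp] at 0, and the squared gap wherever
    the gap vanishes. *)
Lemma is_derive_quad f (x C : R) : (forall y, `|f y| <= C * (y - x) ^+ 2) ->
  is_derive x 1 f 0.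
Proof.
move=> H; apply/is_deriveP => e e0.
have C0 : 0 <= C.
  have := H (x + 1); rewrite (addrC x) addrK expr1n mulr1; exact: le_trans.
exists (e / (C + 1)); first by rewrite divr_gt0// ltr_pwDr.
move=> h hd; rewrite mul0r subr0.
have -> : f x = 0.
  by apply/eqP; rewrite -normr_le0 (le_trans (H x))// subrr expr0n mulr0.
rewrite subr0 (le_trans (H _))// (addrC x) addrK -normr_id.
rewrite -[h ^+ 2]ger0_norm ?sqr_ge0// normrX normr_id expr2 mulrA ler_wpM2r//.
rewrite ltr_pdivlMr ?ltr_pwDr// in hd.
by rewrite (le_trans _ (ltW hd))// mulrC ler_wpM2l// lerDl.
Qed.

Lemma is_derive_cont f (x l : R) : is_derive x 1 f l -> {for x, continuous f}.
Proof. by move=> h; apply: differentiable_continuous; apply/derivable1_diffP. Qed.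

End derive_eps.

(** * A smooth bump with support in the unit interval *)

Section bump.
Context {R : realType}.

(** The whole family [y ^ (- k) * exp (- 1 / y)], extended by 0, is needed: unlike its member
    [k = 0] alone, its linear span is stable under differentiation. *)
Definition gexp (k : nat) (y : R) : R :=
  if 0 < y then y^-1 ^+ k * expR (- y^-1) else 0.

Lemma gexp_ge0 k y : 0 <= gexp k y.
Proof.
rewrite /gexp; case: ifP => // y0.
by rewrite mulr_ge0 ?expR_ge0// exprn_ge0// invr_ge0 ltW.
Qed.

(** With [m = k + 2] and [z = 1 / y], [exp z = (exp (z / m)) ^ m >= (z / m) ^ m], so that
    [exp (- 1 / y) <= (m * y) ^ m], and two powers of [y] survive the division by [y ^ k]. *)
Lemma gexp_quad k y : `|gexp k y| <= (k.+2%:R ^+ k.+2) * (y - 0) ^+ 2.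
Proof.
rewrite subr0 ger0_norm ?gexp_ge0// /gexp; case: ltP => y0; last first.
  by rewrite mulr_ge0 ?sqr_ge0// exprn_ge0.
have m0 : 0 < k.+2%:R :> R by rewrite ltr0n.
have h : (y * k.+2%:R)^-1 ^+ k.+2 <= expR (y^-1).
  rewrite [y^-1](_ : _ = (y * k.+2%:R)^-1 * k.+2%:R); last first.
    by rewrite invfM -mulrA mulVf ?mulr1// lt0r_neq0.
  rewrite expRM_natr; apply: lerXn2r; rewrite ?nnegrE ?expR_ge0//.
    by rewrite invr_ge0 mulr_ge0// ltW.
  by rewrite (le_trans _ (expR_ge1Dx _))// lerDr.
have h2 : expR (- y^-1) <= (y * k.+2%:R) ^+ k.+2.
  rewrite expRN -[leRHS]invrK lef_pV2 ?posrE ?expR_gt0//.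
    by rewrite -exprVn.
  by rewrite invr_gt0 exprn_gt0// mulr_gt0.
rewrite (le_trans (ler_wpM2l _ h2))//; first by rewrite exprn_ge0// invr_ge0 ltW.
rewrite exprMn mulrA exprVn -addn2 exprD mulrA mulVf ?mul1r; last first.
  by rewrite expf_neq0// lt0r_neq0.
by rewrite mulrC.
Qed.

Lemma is_derive_gexp k (y : R) :
  is_derive y 1 (gexp k) (gexp k.+2 y - k%:R * gexp k.+1 y).
Proof.
have [y0|y0|<-] := ltgtP 0 y.
- apply: (@is_derive_near _ _ (fun y => y^-1 ^+ k * expR (- y^-1)) _ _ y) => //.
    move=> z zy; rewrite /gexp ifT//.
    by move: zy; rewrite ltr_norml => /andP[]; lra.
  have yn0 : y != 0 by rewrite gt_eqF.
  have dV : is_derive y 1 (fun z : R => z^-1) (- (y ^- 2)).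
    have := is_deriveV yn0 (is_derive_id y (1 : R)).
    by rewrite /GRing.scale/= mulr1.
  have dN : is_derive y 1 (fun z : R => - z^-1) (- - (y ^- 2)) := is_deriveN dV.
  have dE : is_derive y 1 (fun z : R => expR (- z^-1)) (expR (- y^-1) * - - y ^- 2).
    exact: (@is_derive_chain _ expR (fun z => - z^-1) y _ _ (is_derive_expR _) dN).
  apply: (is_derive_cast (is_deriveM (is_deriveX k dV) dE)) => //.
    by move=> z; rewrite !fctE.
  rewrite exprfctE /gexp y0 /GRing.scale/=; case: k => [|k].
    by rewrite !expr0 !mul0r; field.
  by rewrite !exprS /GRing.scale/= -natr1; field.
- rewrite /gexp [X in X - _]ifF; last by apply/negbTE; rewrite -leNgt ltW.
  rewrite ifF ?mulr0 ?subr0; last by apply/negbTE; rewrite -leNgt ltW.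
  apply: (@is_derive_near _ _ (fun _ => 0) _ _ (- y)); first by rewrite oppr_gt0.
  move=> z zy; rewrite ifF//; apply/negbTE; rewrite -leNgt.
  by move: zy; rewrite ltr_norml => /andP[]; lra.
- rewrite /gexp ltxx mulr0 subr0; exact: (is_derive_quad (gexp_quad k)).
Qed.

(* [F k] is the [k]-th derivative of the smooth function [F 0]. *)
Definition smooth1 (F : nat -> R -> R) := forall k (x : R), is_derive x 1 (F k) (F k.+1 x).

(** A class generated by what the chain and product rules produce from [gexp k (1 - z ^ 2)]. It is
    stable under differentiation and all its members share one support, so derivatives of every
    order exist without a closed formula. *)
Inductive bumpy : (R -> R) -> Prop :=
| bumpy_g k : bumpy (fun z => gexp k (1 - z ^+ 2))
| bumpyD f g : bumpy f -> bumpy g -> bumpy (fun z => f z + g z)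
| bumpyX f : bumpy f -> bumpy (fun z => z * f z)
| bumpyZ c f : bumpy f -> bumpy (fun z => c * f z).

Lemma bumpy_derive f : bumpy f ->
  exists g, bumpy g /\ forall x : R, is_derive x 1 f (g x).
Proof.
elim=> {f} [k|f g _ [f' [bf' df]] _ [g' [bg' dg]]|f bf [f' [bf' df]]|c f _ [f' [bf' df]]].
- exists (fun z => -2 * (z * (gexp k.+2 (1 - z ^+ 2) + - k%:R * gexp k.+1 (1 - z ^+ 2)))); split.
    by apply/bumpyZ/bumpyX/bumpyD; [exact: bumpy_g|apply/bumpyZ/bumpy_g].
  move=> x.
  have d1 : is_derive x 1 (fun z : R => 1 - z ^+ 2) (- (2 * x)).
    apply: (is_derive_cast (is_deriveB (is_derive_cst (1 : R) x (1 : R))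
      (is_deriveX 2 (is_derive_id x (1 : R))))) => [y|].
      by rewrite !fctE.
    by rewrite /GRing.scale/= mulr1 sub0r expr1.
  have d2 := is_derive_gexp k (1 - x ^+ 2).
  by apply: (is_derive_cast (@is_derive_chain _ (gexp k) (fun z => 1 - z ^+ 2) _ _ _ d2 d1)) => //; ring.
- by exists (fun z => f' z + g' z); split; [exact: bumpyD|move=> x; exact: is_deriveD].
- exists (fun z => f z + z * f' z); split; first by apply: bumpyD => //; exact: bumpyX.
  move=> x; apply: (is_derive_cast (is_deriveM (is_derive_id x (1 : R)) (df x))) => //.
  by rewrite /GRing.scale/= mulr1 addrC.
- exists (fun z => c * f' z); split; first exact: bumpyZ.
  by move=> x; exact: is_deriveZ.
Qed.

Lemma bumpy_support f : bumpy f -> forall z, 1 <= `|z| -> f z = 0.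
Proof.
elim=> {f} [k z z1|f g _ hf _ hg z z1|f _ hf z z1|c f _ hf z z1].
- rewrite /gexp ifF//; apply/negbTE; rewrite -leNgt subr_le0.
  by rewrite -[z ^+ 2]ger0_norm ?sqr_ge0// normrX exprn_ege1.
- by rewrite hf// hg// addr0.
- by rewrite hf// mulr0.
- by rewrite hf// mulr0.
Qed.

Definition mollifier (z : R) : R := gexp 0 (1 - z ^+ 2).

(** A derivation is chosen on the class [bumpy] and iterated; every iterate stays in the class and
    hence keeps the support. *)
Lemma mollifier_seq : exists F : nat -> R -> R, F 0%N = mollifier /\ smooth1 F /\
  forall k z, 1 <= `|z| -> F k z = 0.
Proof.
have : forall f : {f | bumpy f}, exists g : {g | bumpy g},
    forall x : R, is_derive x 1 (sval f) (sval g x).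
  by move=> [f bf]; have [g [bg dg]] := bumpy_derive bf; exists (exist _ g bg).
move=> /choice[N HN].
pose b0 : {f | bumpy f} := exist _ mollifier (bumpy_g 0).
exists (fun k => sval (iter k N b0)); split=> //; split=> [k x|k z].
  exact: HN.
exact: (bumpy_support (svalP (iter k N b0))).
Qed.

End bump.

(** * The fundamental theorem of calculus for compactly supported derivatives *)

Section ftc.
Context {R : realType}.
Local Notation mu := (@lebesgue_measure R).
Implicit Types (f g : R -> R).

Lemma cont_bounded_itv f (a b : R) : continuous f -> exists C, forall x, a <= x <= b -> `|f x| <= C.
Proof.
move=> cf; have [ab|ba] := leP a b; last first.
  by exists 0 => x /andP[ax xb]; have := lt_le_trans ba (le_trans ax xb); rewrite ltxx.
have [c _ hc] := EVT_max ab (f := fun x => `|f x|) (continuous_subspaceT (fun x => continuous_comp (cf x) (@norm_continuous _ _ _))).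
by exists `|f c| => x xab; apply: hc; rewrite in_itv.
Qed.

Lemma cont_bcs f (a b : R) : continuous f -> (forall x, ~~ (a <= x <= b) -> f x = 0) -> bcs f.
Proof.
move=> cf f0; split; first exact: continuous_measurable_fun.
have [C hC] := cont_bounded_itv a b cf.
exists (`|C| + `|a| + `|b|); split=> x.
  have [xab|/f0 ->] := boolP (a <= x <= b).
    rewrite (le_trans (hC _ xab))// (le_trans (ler_norm C))// -addrA lerDl.
    by rewrite addr_ge0.
  by rewrite normr0 !addr_ge0.
move=> hx; apply: f0; apply/negP => /andP[ax xb].
move: hx; rewrite ltNge => /negP; apply; rewrite ler_norml.
have := ler_norm (- a); have := ler_norm b; rewrite normrN.
have := normr_ge0 b; have := normr_ge0 a; have := normr_ge0 C.
by move=> *; apply/andP; split; lra.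
Qed.

Lemma I_itv_restrict f (a b : R) : (forall x, ~~ (a <= x <= b) -> f x = 0) ->
  I f = Rintegral mu `[a, b] f.
Proof.
move=> f0; rewrite /I [RHS]Rintegral_mkcond; congr Rintegral.
apply/funext => x; rewrite patchE; case: ifPn => // /negP; rewrite inE/= in_itv/= => h.
by rewrite f0//; exact/negP.
Qed.

Lemma I_FTC2 f g (a b : R) : a < b -> (forall x : R, is_derive x 1 f (g x)) ->
  continuous g -> (forall x, ~~ (a <= x <= b) -> g x = 0) -> I g = f b - f a.
Proof.
move=> ab df cg g0; rewrite (I_itv_restrict g0) /Rintegral.
have cf x : {for x, continuous f} by exact: is_derive_cont (df x).
rewrite (@continuous_FTC2 _ g f a b)//.
- exact: continuous_subspaceT.
- split.
  + by move=> x _; exact: ex_derive.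
  + exact: (cvg_at_right_filter (cf a)).
  + exact: (cvg_at_left_filter (cf b)).
- by move=> x _; rewrite derive1E; exact: derive_val.
Qed.

Lemma smooth1_cont (F : nat -> R -> R) k : smooth1 F -> continuous (F k).
Proof. by move=> sF x; exact: is_derive_cont (sF k x). Qed.

End ftc.

(** * Rescaled mollifiers with their primitives and bounds *)

Section kernel.
Context {R : realType}.
Local Notation mu := (@lebesgue_measure R).

Lemma mollifier_even (z : R) : mollifier (- z) = mollifier z.
Proof. by rewrite /mollifier sqrrN. Qed.

Lemma cons_smooth (F : nat -> R -> R) (B : R -> R) : smooth1 F ->
  (forall x : R, is_derive x 1 B (F 0%N x)) ->
  smooth1 (fun k => if k is k'.+1 then F k' else B).
Proof. by move=> sF dB [|k] x; [exact: dB|exact: sF]. Qed.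

Lemma scale_smooth (F : nat -> R -> R) (c d m : R) : smooth1 F ->
  smooth1 (fun k z => c ^+ k / m * F k (c * z + d)).
Proof.
move=> sF k x.
have d1 : is_derive x 1 (fun z => c * z + d) c.
  apply: (is_derive_cast (is_deriveD (is_deriveZ c (is_derive_id x (1 : R)))
    (is_derive_cst d x (1 : R)))) => [y|].
    by rewrite ?fctE.
  by rewrite /GRing.scale/= mulr1 addr0.
have d2 := @is_derive_chain _ (F k) (fun z => c * z + d) x _ _ (sF k _) d1.
apply: (is_derive_cast (is_deriveZ (c ^+ k / m) d2)) => [y|].
  by rewrite ?fctE.
by rewrite /GRing.scale/= exprS; ring.
Qed.

(** The family is [N ^ k / m * G k (N * z)], where [G 0] is the primitive of the bump, [G 1] the
    bump and [m] its mass. The factor [N ^ k] is the chain rule; it explains the growth like [N] and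
    [N ^ 2] of the two bounds. *)
Lemma kernel_exists : exists K : nat -> nat -> R -> R, exists C : R, 0 < C /\
  forall n, let N : R := n.+1%:R in
  [/\ smooth1 (K n),
      forall z, (z <= - N^-1 -> K n 0%N z = 0) /\ (N^-1 <= z -> K n 0%N z = 1),
      forall j z, N^-1 <= `|z| -> K n j.+1 z = 0,
      forall z, [/\ 0 <= K n 1%N z, K n 1%N z <= C * N & K n 1%N (- z) = K n 1%N z] &
      forall z, `|K n 2%N z| <= C * N ^+ 2].
Proof.
have [F [F0 [sF Fs]]] := @mollifier_seq R.
have cF k : continuous (F k) by exact: smooth1_cont.
have Fout k z : ~~ (-1 <= z <= 1) -> F k z = 0.
  move=> h; apply: Fs; rewrite leNgt; apply/negP => h1; move/negP : h; apply.
  by rewrite -ler_norml ltW.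
have bF k : bcs (F k) by exact: (cont_bcs (cF k) (Fout k)).
pose B z := Rintegral mu `]-oo, z] (F 0%N).
have dB (x : R) : is_derive x 1 B (F 0%N x).
  have hint : mu.-integrable `]-oo, (x + 1)] (EFin \o F 0%N).
    by apply: (integrableS measurableT) => //; exact: bcs_integrable.
  have [h1 h2] := @continuous_FTC1 R (F 0%N) -oo%O x (x + 1) (ltr_pwDr ltr01 (lexx _)) hint (ltNyr x) (cF 0%N x).
  by move: h2; rewrite derive1E => h2; exact: (DeriveDef h1 h2).
have B0 z : z <= -1 -> B z = 0.
  move=> z1; rewrite /B Rintegral_mkcond (_ : _ \_ _ = fun=> 0); first exact: I_0.
  apply/funext => y; rewrite patchE; case: ifP => //; rewrite inE/= in_itv/= => yz.
  by apply: Fs; rewrite ler_normr lerNr (le_trans yz z1) orbT.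
pose m := I (F 0%N).
have B1 z : 1 <= z -> B z = m.
  move=> z1; rewrite /B Rintegral_mkcond; congr Rintegral.
  apply/funext => y; rewrite patchE; case: ifPn => // /negP; rewrite inE/= in_itv/= => /negP yz.
  by apply/esym/Fs; rewrite ler_normr (le_trans z1)// ltW// ltNge.
have F00 z : 0 <= F 0%N z by rewrite F0 gexp_ge0.
(* On [[- 1/2, 1/2]] one has [1 - x ^ 2 >= 3/4], so the bump is at least [expR (-2)] there. *)
have m0 : 0 < m.
  apply: (@lt_le_trans _ _ (I (fun x => expR (-2) * \1_`[- 2^-1, 2^-1] x))).
    by rewrite I_itv ?mulr_gt0 ?expR_gt0//; lra.
  apply: I_le => // [|x]; first exact: indic_itv_bcs.
  rewrite indicE; case: (boolP (x \in _)); last by rewrite mulr0.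
  rewrite inE/= in_itv/= -ler_norml mulr1 F0 /mollifier /gexp => hx.
  have hx2 : x ^+ 2 <= 4^-1.
    rewrite -[x ^+ 2]ger0_norm ?sqr_ge0// normrX.
    by rewrite (_ : 4^-1 = 2^-1 ^+ 2 :> R); [apply: lerXn2r; rewrite ?nnegrE ?invr_ge0|field].
  rewrite ifT; last by rewrite subr_gt0; lra.
  rewrite expr0 mul1r ler_expR lerN2 -[leRHS]invrK lef_pV2 ?posrE//; lra.
have [C1 hC1] : exists C, forall z, `|F 0%N z| <= C.
  by have [_ [C [h _]]] := bF 0%N; exists C.
have [C2 hC2] : exists C, forall z, `|F 1%N z| <= C.
  by have [_ [C [h _]]] := bF 1%N; exists C.
have C10 : 0 <= C1 by exact: le_trans (normr_ge0 _) (hC1 0).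
have C20 : 0 <= C2 by exact: le_trans (normr_ge0 _) (hC2 0).
pose G k := if k is k'.+1 then F k' else B.
have sG : smooth1 G by exact: cons_smooth.
exists (fun n k z => n.+1%:R ^+ k / m * G k (n.+1%:R * z + 0)).
exists (C1 / m + C2 / m + 1); split.
  by rewrite ltr_pwDr// addr_ge0// divr_ge0// ltW.
move=> n N; have N0 : 0 < N by rewrite ltr0n.
split.
- exact: scale_smooth.
- move=> z; split=> hz.
    rewrite /G B0 ?mulr0// addr0 -(@ler_pM2l _ N^-1) ?invr_gt0//.
    by rewrite mulrA mulVf ?gt_eqF// mul1r mulrN1.
  rewrite /G B1 ?expr0 ?mul1r ?mulVf ?gt_eqF// addr0 -(@ler_pM2l _ N^-1) ?invr_gt0//.
  by rewrite mulrA mulVf ?gt_eqF// mul1r mulr1.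
- move=> j z hz; rewrite /G Fs ?mulr0// addr0 normrM (gtr0_norm N0).
  by rewrite -(@ler_pM2l _ N^-1) ?invr_gt0// mulrA mulVf ?gt_eqF// mul1r mulr1.
- move=> z; rewrite /G expr1; split.
  + by rewrite mulr_ge0// divr_ge0 ?ltW.
  + rewrite -mulrA mulrC ler_pM2r//.
    rewrite (le_trans (y := C1 / m))//.
      by rewrite mulrC ler_pM2r ?invr_gt0// (le_trans (ler_norm _)).
    by rewrite -addrA lerDl addr_ge0// divr_ge0// ltW.
  + by rewrite !addr0 mulrN F0 mollifier_even.
- move=> z; rewrite /G 2!normrM normfV (gtr0_norm m0) normrX (gtr0_norm N0).
  rewrite -mulrA mulrC ler_pM2r ?exprn_gt0//.
  rewrite (le_trans (y := C2 / m))//.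
    by rewrite mulrC ler_pM2r ?invr_gt0.
  by rewrite addrAC lerDr addr_ge0// divr_ge0// ltW.
Qed.

(* [kern n 1] is an even mollifier of width [n.+1%:R^-1], [kern n 0] its primitive
   rising from 0 to 1, and [kern n j.+1] the derivative of [kern n j]. *)
Definition kern : nat -> nat -> R -> R := sval (cid kernel_exists).
Definition kernC : R := sval (cid (svalP (cid kernel_exists))).

Lemma kernP : 0 < kernC /\
  forall n, let N : R := n.+1%:R in
  [/\ smooth1 (kern n),
      forall z, (z <= - N^-1 -> kern n 0%N z = 0) /\ (N^-1 <= z -> kern n 0%N z = 1),
      forall j z, N^-1 <= `|z| -> kern n j.+1 z = 0,
      forall z, [/\ 0 <= kern n 1%N z, kern n 1%N z <= kernC * N & kern n 1%N (- z) = kern n 1%N z] &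
      forall z, `|kern n 2%N z| <= kernC * N ^+ 2].
Proof. exact: (svalP (cid (svalP (cid kernel_exists)))). Qed.

Lemma kernC_gt0 : 0 < kernC. Proof. by case: kernP. Qed.

Lemma kern_smooth n : smooth1 (kern n).
Proof. by have [_ /(_ n)[]] := kernP. Qed.

Lemma kern_derive n j (x : R) : is_derive x 1 (kern n j) (kern n j.+1 x).
Proof. exact: kern_smooth. Qed.

Lemma kern_cont n j : continuous (kern n j).
Proof. exact: smooth1_cont (@kern_smooth n). Qed.

Lemma kern_out n j z : n.+1%:R^-1 <= `|z| -> kern n j.+1 z = 0.
Proof. by have [_ /(_ n)[]] := kernP; move=> _ _ h _ _; exact: h. Qed.

Lemma kern0 n z : z <= - n.+1%:R^-1 -> kern n 0 z = 0.
Proof. by have [_ /(_ n)[]] := kernP; move=> _ h _ _ _; apply: (h z).1. Qed.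

Lemma kern1 n z : n.+1%:R^-1 <= z -> kern n 0 z = 1.
Proof. by have [_ /(_ n)[]] := kernP; move=> _ h _ _ _; apply: (h z).2. Qed.

Lemma kern_ge0 n z : 0 <= kern n 1 z.
Proof. by have [_ /(_ n)[]] := kernP; move=> _ _ _ h _; case: (h z). Qed.

Lemma kern_le n z : kern n 1 z <= kernC * n.+1%:R.
Proof. by have [_ /(_ n)[]] := kernP; move=> _ _ _ h _; case: (h z). Qed.

Lemma kern_even n z : kern n 1 (- z) = kern n 1 z.
Proof. by have [_ /(_ n)[]] := kernP; move=> _ _ _ h _; case: (h z). Qed.

Lemma kern2_le n z : `|kern n 2 z| <= kernC * n.+1%:R ^+ 2.
Proof. by have [_ /(_ n)[]] := kernP; move=> _ _ _ _ h; exact: h. Qed.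

End kernel.

(** * Moments of the kernels and convergence of mollifications *)

Section kernel_convergence.
Context {R : realType}.
Local Notation mu := (@lebesgue_measure R).
Implicit Types (f g p : R -> R).

Lemma is_derive_affine (c d t : R) : is_derive t 1 (fun z => c * z + d) c.
Proof.
apply/is_deriveP => e e0; exists 1 => // h _.
have -> : c * (t + h) + d - (c * t + d) - c * h = 0 by ring.
by rewrite normr0 mulr_ge0// ltW.
Qed.

Lemma is_derive_aff f (c d t l : R) : is_derive (c * t + d) 1 f l ->
  is_derive t 1 (fun z => f (c * z + d)) (l * c).
Proof.
by move=> df; apply: (@is_derive_chain _ f (fun z => c * z + d)) => //; exact: is_derive_affine.
Qed.

Lemma kern_derive_l n j (x y : R) : is_derive y 1 (fun y => kern n j (y - x)) (kern n j.+1 (y - x)).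
Proof.
have := is_derive_aff (@kern_derive R n j (1 * y + - x)).
by move=> h; apply: (is_derive_cast h) => [z|]; rewrite ?mul1r ?mulr1.
Qed.

Lemma kern_derive_r n j (r t : R) : is_derive t 1 (fun t => kern n j (r - t)) (- kern n j.+1 (r - t)).
Proof.
have := is_derive_aff (@kern_derive R n j (-1 * t + r)).
by move=> h; apply: (is_derive_cast h) => [z|]; rewrite ?mulN1r ?mulrN1 1?addrC.
Qed.

Lemma contB (x : R) : continuous (fun y : R => y - x).
Proof. by move=> y; apply: cvgB; [exact: cvg_id|exact: cvg_cst]. Qed.

Lemma kern_cont_l n j (x : R) : continuous (fun y => kern n j (y - x)).
Proof. move=> y; exact: is_derive_cont (kern_derive_l n j x y). Qed.

Lemma kern_cont_r n j (x : R) : continuous (fun y => kern n j (x - y)).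
Proof. move=> y; exact: is_derive_cont (kern_derive_r n j x y). Qed.

Lemma kern_l0 n j (x y : R) : ~~ (x - n.+1%:R^-1 <= y <= x + n.+1%:R^-1) -> kern n j.+1 (y - x) = 0.
Proof.
move=> h; apply: kern_out; rewrite leNgt; apply/negP => h1; move/negP : h; apply.
by rewrite -ler_distl ltW.
Qed.

Lemma kern_r0 n j (x y : R) : ~~ (x - n.+1%:R^-1 <= y <= x + n.+1%:R^-1) -> kern n j.+1 (x - y) = 0.
Proof.
move=> h; apply: kern_out; rewrite leNgt; apply/negP => h1; move/negP : h; apply.
by rewrite -ler_distl distrC ltW.
Qed.

Lemma kern_bcs_l n j (x : R) : bcs (fun y => kern n j.+1 (y - x)).
Proof. exact: (cont_bcs (@kern_cont_l n j.+1 x) (@kern_l0 n j x)). Qed.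

Lemma kern_bcs_r n j (x : R) : bcs (fun y => kern n j.+1 (x - y)).
Proof. exact: (cont_bcs (@kern_cont_r n j.+1 x) (@kern_r0 n j x)). Qed.

Lemma Ninv_gt0 n : 0 < n.+1%:R^-1 :> R. Proof. by rewrite invr_gt0 ltr0n. Qed.

Lemma itv_sym_lt (x e : R) : 0 < e -> x - e < x + e.
Proof. by move=> e0; lra. Qed.

Lemma kern_edge0 n (x : R) : kern n 0 (x + n.+1%:R^-1 - x) = 1 /\ kern n 0 (x - n.+1%:R^-1 - x) = 0.
Proof.
by split; rewrite addrAC subrr; [rewrite add0r kern1|rewrite sub0r kern0].
Qed.

Lemma kern_mass n (x : R) : I (fun y => kern n 1 (y - x)) = 1.
Proof.
have N0 := Ninv_gt0 n.
have ab : x - n.+1%:R^-1 < x + n.+1%:R^-1 by exact: itv_sym_lt.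
rewrite (I_FTC2 ab (kern_derive_l n 0 x) (@kern_cont_l n 1 x) (@kern_l0 n 0 x)).
by have [-> ->] := kern_edge0 n x; rewrite subr0.
Qed.

Lemma kern_edge n j (r : R) : kern n j.+1 (r - (r + n.+1%:R^-1)) = 0 /\
  kern n j.+1 (r - (r - n.+1%:R^-1)) = 0.
Proof.
have N0 := Ninv_gt0 n; split; apply: kern_out.
  by rewrite opprD addrA subrr sub0r normrN ger0_norm// ltW.
by rewrite opprB addrC subrK ger0_norm// ltW.
Qed.

Lemma kern_moment0 n (r : R) : I (fun t => kern n 2 (r - t)) = 0.
Proof.
have N0 := Ninv_gt0 n.
have ab : r - n.+1%:R^-1 < r + n.+1%:R^-1 by exact: itv_sym_lt.
have d (y : R) : is_derive y 1 (fun y => - kern n 1 (r - y)) (kern n 2 (r - y)).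
  apply: (is_derive_cast (is_deriveN (kern_derive_r n 1 r y))) => //.
  by rewrite opprK.
rewrite (I_FTC2 ab d (@kern_cont_r n 2 r) (@kern_r0 n 1 r)).
by have [-> ->] := kern_edge n 0 r; rewrite subrr.
Qed.

(** Together with the vanishing of the moment of order 0: integrating an affine function against
    this kernel returns its slope. *)
Lemma kern_moment1 n (r : R) : I (fun t => (t - r) * kern n 2 (r - t)) = 1.
Proof.
have N0 := Ninv_gt0 n.
have ab : r - n.+1%:R^-1 < r + n.+1%:R^-1 by exact: itv_sym_lt.
(* The primitive comes from integration by parts; evenness of [kern n 1] lets the remaining integral
   be written as [kern n 0 (y - r)]. *)
have d (y : R) : is_derive y 1 (fun y => - ((y - r) * kern n 1 (r - y)) + kern n 0 (y - r))
    ((y - r) * kern n 2 (r - y)).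
  have dr : is_derive y 1 (fun y => y - r) 1.
    by apply: (is_derive_cast (is_derive_affine 1 (- r) y)) => // z; rewrite mul1r.
  apply: (is_derive_cast (is_deriveD (is_deriveN (is_deriveM dr (kern_derive_r n 1 r y))) (kern_derive_l n 0 r y))) => //.
  have -> : kern n 1 (y - r) = kern n 1 (r - y) by rewrite -kern_even opprB.
  by rewrite /GRing.scale/=; ring.
have c : continuous (fun y => (y - r) * kern n 2 (r - y)).
  by move=> y; apply: cvgM; [exact: contB|exact: kern_cont_r].
have o y : ~~ (r - n.+1%:R^-1 <= y <= r + n.+1%:R^-1) -> (y - r) * kern n 2 (r - y) = 0.
  by move=> hy; rewrite kern_r0// mulr0.
rewrite (I_FTC2 ab d c o).
have [-> ->] := kern_edge n 0 r.
have [-> ->] := kern_edge0 n r.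
by rewrite !mulr0 oppr0 add0r addr0 subr0.
Qed.

Definition moll n g (x : R) := I (fun y => g y * kern n 1 (y - x)).

Lemma moll_bcs n j g (x M : R) : measurable_fun setT g -> (forall y, `|g y| <= M) ->
  bcs (fun y => g y * kern n j.+1 (y - x)).
Proof.
move=> mg gM; rewrite (_ : (fun y => _) = (fun y => kern n j.+1 (y - x) * g y)).
  by apply: bcsM => //; [exact: kern_bcs_l|exists M].
by apply/funext => y; rewrite mulrC.
Qed.

Lemma dkern_bcs n j g (x M : R) : measurable_fun setT g -> (forall y, `|g y| <= M) ->
  bcs (fun y => g y * kern n j.+1 (x - y)).
Proof.
move=> mg gM; rewrite (_ : (fun y => _) = (fun y => kern n j.+1 (x - y) * g y)).
  by apply: bcsM => //; [exact: kern_bcs_r|exists M].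
by apply/funext => y; rewrite mulrC.
Qed.

Lemma moll_bound n g (x M : R) : measurable_fun setT g -> (forall y, `|g y| <= M) ->
  `|moll n g x| <= M.
Proof.
move=> mg gM; rewrite (le_trans (I_norm (moll_bcs _ _ _ mg gM)))//.
rewrite -[M]mulr1 -(kern_mass n x) -I_Z; last exact: kern_bcs_l.
apply: I_le.
- by apply: bcs_norm; exact: moll_bcs mg gM.
- by apply: bcsZ; exact: kern_bcs_l.
- by move=> y; rewrite normrM (ger0_norm (kern_ge0 _ _)) ler_wpM2r// kern_ge0.
Qed.

Lemma bounded_locally_integrable g (M : R) : measurable_fun setT g ->
  (forall y, `|g y| <= M) -> locally_integrable setT g.
Proof.
move=> mg gM; split; [by []|exact: openT|move=> K _ cK].
have mK : measurable K by exact: compact_measurable.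
have M0 : 0 <= M by exact: le_trans (normr_ge0 _) (gM 0).
have Kfin : (mu K < +oo)%E by exact: compact_finite_measure.
apply: (@le_lt_trans _ _ (\int[mu]_(x in K) (cst M%:E x))%E).
  apply: ge0_le_integral => //.
  - by apply/measurable_EFinP; apply: measurableT_comp => //; exact: measurable_funS mg.
  - by move=> x _; rewrite lee_fin.
by rewrite integral_cst// lte_mul_pinfty.
Qed.

(** The kernel is at most [kernC * N] on an interval of length [2 / N], with [N = n + 1]. The error
    is therefore at most [2 * kernC] times the mean of [|g - g x|] over that interval, which tends
    to 0 at a Lebesgue point. *)
Lemma moll_cvg_pt g (M x : R) : measurable_fun setT g -> (forall y, `|g y| <= M) ->
  lebesgue_pt g x -> moll n g x @[n --> \oo] --> g x.
Proof.
move=> mg gM gx.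
have Nc : (fun n => n.+1%:R^-1 : R) n @[n --> \oo] --> (0 : R) by exact: cvg_harmonic.
have h := (@cvge_at_rightP R (davg g x) 0 0).1 gx (fun n => n.+1%:R^-1) (conj (fun n => Ninv_gt0 n) Nc).
have h2 : (fine \o (fun n => davg g x n.+1%:R^-1)) n @[n --> \oo] --> (0 : R).
  exact: (fine_cvg h).
apply/cvgrPdist_le => e e0.
have C0 := @kernC_gt0 R.
have e1 : 0 < e / (2 * kernC) :> R by rewrite divr_gt0// mulr_gt0.
move/cvgrPdist_le : h2 => /(_ _ e1); apply: filterS => n /=.
rewrite sub0r normrN => hn.
have N0 : 0 < n.+1%:R :> R by rewrite ltr0n.
pose B : set R := ball x (n.+1%:R^-1 : R).
have bB : bcs (fun y => `|g y - g x| * \1_B y).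
  rewrite (_ : (fun y => _) = (fun y => (1 * \1_`[x - n.+1%:R^-1, x + n.+1%:R^-1] y) * (`|g y - g x| * \1_B y))).
    apply: bcsM.
    - exact: indic_itv_bcs.
    - apply: measurable_funM; last by apply: measurable_indic; exact: measurable_ball.
      by apply: measurableT_comp => //; apply: measurable_funB.
    - exists (M + M) => y; rewrite normrM normr_id -[leRHS]mulr1 ler_pM//.
        by rewrite (le_trans (ler_normB _ _))// lerD.
      by rewrite indicE; case: (_ \in _); rewrite ?normr0 ?normr1.
  apply/funext => y; rewrite !indicE; case: (boolP (y \in B)); last by rewrite !mulr0.
  rewrite inE /B/= ball_itv/= in_itv/= => /andP[h3 h4].
  by rewrite mem_set ?mul1r//= in_itv/= !ltW.
have Ib : I (fun y => `|g y - g x| * \1_B y) = (2 * n.+1%:R^-1) * fine (davg g x n.+1%:R^-1).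
  rewrite /davg /iavg lebesgue_measure_ball ?ltW ?Ninv_gt0//.
  rewrite inver gt_eqF; last by rewrite pmulrn_lgt0// Ninv_gt0.
  have -> : (\int[mu]_(y in ball x (n.+1%:R^-1 : R)) `|((center (g x) \o g) y)%:E|)%E = (I (fun y => `|g y - g x| * \1_B y))%:E.
    rewrite -EFin_I// integral_mkcond; apply: eq_integral => y _.
    by rewrite patchE indicE /B; case: ifPn => hy; rewrite ?mulr1 ?mulr0//= ?(negbTE hy) ?mulr0 ?mulr1//.
  rewrite -EFinM/= -mulr_natl; field; rewrite ?gt_eqF//.
have -> : g x - moll n g x = - I (fun y => (g y - g x) * kern n 1 (y - x)).
  rewrite -[X in X - _]mulr1 -(kern_mass n x) -I_Z; last exact: kern_bcs_l.
  rewrite /moll -I_B; [|by apply: bcsZ; exact: kern_bcs_l|exact: moll_bcs mg gM].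
  rewrite -I_N; last first.
    apply: (@moll_bcs _ _ _ _ (M + M)); first exact: measurable_funB.
    by move=> y; rewrite (le_trans (ler_normB _ _))// lerD.
  by congr I; apply/funext => y; ring.
have b1 : bcs (fun y => (g y - g x) * kern n 1 (y - x)).
  apply: (@moll_bcs _ _ _ _ (M + M)); first exact: measurable_funB.
  by move=> y; rewrite (le_trans (ler_normB _ _))// lerD.
rewrite normrN (le_trans (I_norm b1))//.
apply: (@le_trans _ _ (I (fun y => (kernC * n.+1%:R) * (`|g y - g x| * \1_B y)))).
  apply: I_le; [exact: bcs_norm|exact: bcsZ|move=> y].
  rewrite normrM (ger0_norm (kern_ge0 _ _)).
  have [yB|yB] := boolP (y \in B).
    by rewrite indicE yB mulr1 mulrC ler_wpM2r// kern_le.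
  rewrite kern_out ?mulr0//; last first.
    rewrite leNgt; apply/negP => h3; move/negP : yB; apply.
    by rewrite inE /B /ball/= distrC.
  by rewrite !mulr_ge0 ?indicE// ltW.
rewrite I_Z// Ib.
move: hn; rewrite ger0_norm; last by rewrite fine_ge0// davg_ge0.
rewrite ler_pdivlMr ?mulr_gt0// => hn.
rewrite (_ : _ * _ = fine (davg g x n.+1%:R^-1) * (2 * kernC))//.
by field; rewrite gt_eqF.
Qed.

Lemma moll_cvg g (M : R) : measurable_fun setT g -> (forall y, `|g y| <= M) ->
  {ae mu, forall x, moll n g x @[n --> \oo] --> g x}.
Proof.
move=> mg gM; have := lebesgue_differentiation (bounded_locally_integrable mg gM).
by apply: aeS => x; exact: moll_cvg_pt gM.
Qed.

End kernel_convergence.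

(** * Product test functions *)

Section product_tests.
Context {R : realType}.
Local Notation mu := (@lebesgue_measure R).

Lemma partial_xP (f : R * R -> R) (p : R * R) (l : R) :
  is_derive p.1 1 (fun x => f (x, p.2)) l ->
  derivable f p (1, 0) /\ partial_x f p = l.
Proof.
move=> [d v].
have E : (fun h : R => h^-1 *: ((f \o shift p) (h *: ((1, 0) : R * R)) - f p)) =
  (fun h : R => h^-1 *: (((fun x => f (x, p.2)) \o shift p.1) (h *: (1 : R)) - f (p.1, p.2))).
  apply/funext => h; rewrite /shift/=; congr (_ *: (f _ - f _)); last by case: p {d v}.
  case: p {d v} => a b /=.
  transitivity (h *: (1 : R) + a, h *: (0 : R) + b) => //.
  by rewrite scaler0 add0r.
split; first by rewrite /derivable E.
by rewrite /partial_x /derive E.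
Qed.

Lemma partial_tP (f : R * R -> R) (p : R * R) (l : R) :
  is_derive p.2 1 (fun x => f (p.1, x)) l ->
  derivable f p (0, 1) /\ partial_t f p = l.
Proof.
move=> [d v].
have E : (fun h : R => h^-1 *: ((f \o shift p) (h *: ((0, 1) : R * R)) - f p)) =
  (fun h : R => h^-1 *: (((fun x => f (p.1, x)) \o shift p.2) (h *: (1 : R)) - f (p.1, p.2))).
  apply/funext => h; rewrite /shift/=; congr (_ *: (f _ - f _)); last by case: p {d v}.
  case: p {d v} => a b /=.
  transitivity (h *: (0 : R) + a, h *: (1 : R) + b) => //.
  by rewrite scaler0 add0r.
split; first by rewrite /derivable E.
by rewrite /partial_t /derive E.
Qed.

Definition tensor (A B : R -> R) (p : R * R) : R := A p.1 * B p.2.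

Lemma tensor_x (A B : R -> R) (a : R) (p : R * R) : is_derive p.1 1 A a ->
  derivable (tensor A B) p (1, 0) /\ partial_x (tensor A B) p = a * B p.2.
Proof.
move=> dA; apply: partial_xP.
apply: (is_derive_cast (is_deriveM dA (is_derive_cst (B p.2) p.1 (1 : R)))) => //.
by rewrite /GRing.scale/= mulr0 add0r mulrC.
Qed.

Lemma tensor_t (A B : R -> R) (b : R) (p : R * R) : is_derive p.2 1 B b ->
  derivable (tensor A B) p (0, 1) /\ partial_t (tensor A B) p = A p.1 * b.
Proof.
move=> dB; apply: partial_tP.
apply: (is_derive_cast (is_deriveM (is_derive_cst (A p.1) p.2 (1 : R)) dB)) => //.
by rewrite /GRing.scale/= mulr0 addr0.
Qed.

Lemma tensor_smooth (A B : nat -> R -> R) : smooth1 A -> smooth1 B ->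
  smooth (tensor (A 0%N) (B 0%N)).
Proof.
move=> sA sB k; suff : forall i j, differentiability_class k (tensor (A i) (B j)) by exact.
elim: k => [|k IH] i j /=.
  move=> p.
  have h1 : {for p, continuous (A i \o fst)}.
    by apply: continuous_comp; [exact: cvg_fst|exact: (smooth1_cont sA)].
  have h2 : {for p, continuous (B j \o snd)}.
    by apply: continuous_comp; [exact: cvg_snd|exact: (smooth1_cont sB)].
  exact: (cvgM h1 h2).
split.
- by move=> p; have [] := @tensor_x (A i) (B j) _ p (sA i _).
- by move=> p; have [] := @tensor_t (A i) (B j) _ p (sB j _).
- rewrite (_ : partial_x _ = tensor (A i.+1) (B j))//.
  by apply/funext => p; have [_ ->] := @tensor_x (A i) (B j) _ p (sA i _).
- rewrite (_ : partial_t _ = tensor (A i) (B j.+1))//.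
  by apply/funext => p; have [_ ->] := @tensor_t (A i) (B j) _ p (sB j _).
Qed.

Lemma tensor_test (A B : nat -> R -> R) (a b c d : R) : smooth1 A -> smooth1 B ->
  (forall x, ~~ (a <= x <= b) -> A 0%N x = 0) ->
  (forall x, ~~ (c <= x <= d) -> B 0%N x = 0) ->
  test_function (tensor (A 0%N) (B 0%N)).
Proof.
move=> sA sB A0 B0; split; first exact: tensor_smooth.
have cK : compact (`[a, b] `*` `[c, d] : set (R * R)).
  by apply: compact_setX; exact: segment_compact.
apply: (subclosed_compact _ cK); first exact: closed_closure.
have hK : closed (`[a, b] `*` `[c, d] : set (R * R)).
  by apply: compact_closed cK; apply: (@norm_hausdorff R (R * R)%type).
rewrite [X in _ `<=` X]((closure_id _).1 hK).
apply: closure_subset => -[x t] /=; rewrite /tensor mulf_eq0 negb_or /= => /andP[h1 h2].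
split; rewrite /= in_itv/=.
  by apply/negPn/negP => /A0 h; rewrite h eqxx in h1.
by apply/negPn/negP => /B0 h; rewrite h eqxx in h2.
Qed.

End product_tests.

(** * From an essentially bounded class to a bounded Borel function *)

Section representative.
Context {R : realType}.
Local Notation mu := (@lebesgue_measure R).
Local Notation RR := (measurableTypeR R * measurableTypeR R)%type.

(** Tonelli for the indicator of [N]: a nonnegative function with zero integral vanishes almost
    everywhere, first in [t], then in [x]. *)
Lemma ae_sections (N : set RR) : measurable N -> (mu \x mu)%E N = 0%E ->
  {ae mu, forall t, {ae mu, forall x, ~ N (x, t)}}.
Proof.
move=> mN N0.
pose f (p : RR) : \bar R := (\1_N p)%:E.
have mf : measurable_fun setT f by apply/measurable_EFinP; exact: measurable_indic.
have f0 p : (0 <= f p)%E by rewrite lee_fin.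
have : (\int[mu]_t fubini_G mu f t = 0)%E.
  rewrite -(@fubini_tonelli2 _ _ _ _ R mu mu f mf f0).
  by rewrite /f integral_indic// setIT; exact: N0.
have mG : measurable_fun setT (fubini_G mu f).
  exact: measurable_fun_fubini_tonelli_G.
have G0 t : (0 <= fubini_G mu f t)%E by apply: integral_ge0.
rewrite (eq_integral (fun t => `|fubini_G mu f t|)%E); last first.
  by move=> t _; rewrite gee0_abs.
move/(ae_eq_integral_abs mu measurableT mG).1.
apply: aeS => t /(_ Logic.I) /= Gt.
have mNt : measurable_fun setT (fun x : measurableTypeR R => f (x, t)).
  by exact: (measurableT_comp mf (@measurable_pair2 _ _ _ _ t)).
have : (\int[mu]_x `|f (x, t)| = 0)%E.
  by rewrite -Gt; apply: eq_integral => x _; rewrite gee0_abs.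
move/(ae_eq_integral_abs mu measurableT mNt).1.
apply: aeS => x /(_ Logic.I) /= h Nxt; move: h.
by rewrite /f indicE mem_set//= => /eqP; rewrite eqe oner_eq0.
Qed.

Definition truncate (M z : R) := Num.max (- M) (Num.min M z).

Lemma truncate_le M z : 0 <= M -> `|truncate M z| <= M.
Proof.
move=> M0; rewrite ler_norml /truncate le_max lexx/= ge_max.
by rewrite ge_min lexx/= andbT; lra.
Qed.

Lemma truncate_id M z : `|z| <= M -> truncate M z = z.
Proof.
rewrite ler_norml => /andP[h1 h2]; rewrite /truncate.
by rewrite (min_idPr _)// (max_idPr _).
Qed.

(** Truncating at the essential bound makes the bound hold at every point and changes [u] only on a
    null set. The agreement is recorded slice by slice in time, the form in which the weak
    formulation and the envelopes see [u]. *)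
Lemma bounded_representative (u : R * R -> R) : Linfty_half_plane u ->
  exists (M : R) (v : R -> R -> R), [/\ 0 < M, mf2 v,
    forall x t, `|v x t| <= M &
    {ae mu, forall t, 0 <= t -> {ae mu, forall x, u (x, t) = v x t}}].
Proof.
rewrite /Linfty_half_plane => hu.
pose w := u \_ half_plane.
have [mw fw] : measurable_fun setT w /\ finite_norm (mu \x mu)%E +oo%E w.
  by move: hu; rewrite !inE/= => /andP[]; rewrite !inE/=.
have [M M0 hM] : exists2 M : R, 0 < M & {ae (mu \x mu)%E, forall p, `|w p| <= M}.
  move: fw; rewrite /finite_norm unlock.
  case: ifPn => [_ fin|h _].
    pose y := ess_sup (mu \x mu)%E (abse \o (EFin \o w)).
    exists (`|fine y| + 1); first by rewrite ltr_pwDr.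
    have := ess_sup_ge (mu \x mu)%E (abse \o (EFin \o w)).
    apply: (@filterS _ _ (ae_filter_ringOfSetsType (mu \x mu)%E)).
    move=> p /= hp.
    have yfin : y \is a fin_num.
      rewrite fin_numE; apply/andP; split; last by rewrite lt_eqF.
      by rewrite gt_eqF// (lt_le_trans _ hp)// ltNyr.
    rewrite -lee_fin; apply: (le_trans hp).
    by rewrite -/y -(fineK yfin) lee_fin/= (le_trans (ler_norm _))// lerDl.
  (* Degenerate branch in the definition of the norm: the whole space would be null, and any bound
     would hold almost everywhere. *)
  exists 1 => //; exists setT; split => //.
  by apply/eqP; rewrite eq_le measure_ge0 andbT leNgt.
pose v x t := truncate M (w (x, t)).
exists M, v; split=> //.
- rewrite /mf2 /v /truncate.
  apply: measurable_maxr; first exact: measurable_cst.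
  apply: measurable_minr; first exact: measurable_cst.
  by rewrite (_ : (fun _ => _) = w)//; apply/funext => -[].
- by move=> x t; apply: truncate_le; exact: ltW.
- have [N [mN N0 hN]] := hM.
  have := ae_sections mN N0; apply: aeS => t h t0; move: h; apply: aeS => x Nxt.
  have wM : `|w (x, t)| <= M.
    by apply: contrapT => hw; apply: Nxt; apply: hN.
  rewrite /v truncate_id// /w patchE mem_set//; split=> //=.
  by rewrite /Rplus/= in_itv/= t0.
Qed.

(** The integrand built from [u] itself may be unbounded on a null set, so its inner integrals are
    handled in the extended reals, through positive and negative parts. *)
Lemma measurable_ext_int (G : R -> R -> \bar R) :
  measurable_fun setT (fun p : R * R => G p.1 p.2) ->
  measurable_fun setT (fun t : R => (\int[mu]_x G x t)%E).
Proof.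
move=> mG.
pose G1 (p : RR) := G p.1 p.2.
have h1 := @measurable_fun_fubini_tonelli_G _ _ _ _ R mu (G1^\+)%E
  (measurable_funepos mG) (fun=> funepos_ge0 _ _).
have h2 := @measurable_fun_fubini_tonelli_G _ _ _ _ R mu (G1^\-)%E
  (measurable_funeneg mG) (fun=> funeneg_ge0 _ _).
have := emeasurable_funB h1 h2.
rewrite (_ : (fun t => (\int[mu]_x G x t)%E) = (fubini_G mu (G1^\+) \- fubini_G mu (G1^\-))%E)//.
apply/funext => t; rewrite integralE /fubini_G; congr (_ - _)%E; apply: eq_integral => x _.
  by rewrite !funeposE.
by rewrite !funenegE.
Qed.

(* Supporting [B] in ]0, +oo[ removes the initial datum. *)
Lemma weak_form_tensor (eta q : R -> R) (u0 : R -> R) (u : R * R -> R)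
    (v : R -> R -> R) (M : R) (A B : nat -> R -> R) (a b c d : R) :
  (u \_ half_plane) \in Lfun (mu \x mu)%E +oo%E ->
  measurable_fun setT eta -> measurable_fun setT q ->
  mf2 v -> (forall x t, `|v x t| <= M) ->
  (exists C, forall z, `|z| <= M -> `|eta z| <= C /\ `|q z| <= C) ->
  {ae mu, forall t, 0 <= t -> {ae mu, forall x, u (x, t) = v x t}} ->
  smooth1 A -> smooth1 B ->
  (forall j x, ~~ (a <= x <= b) -> A j x = 0) ->
  (forall j x, ~~ (c <= x <= d) -> B j x = 0) -> 0 < c ->
  let G := fun x t => eta (v x t) * (A 0%N x * B 1%N t) + q (v x t) * (A 1%N x * B 0%N t) in
  bcs2 G /\ weak_form eta q u0 u (tensor (A 0%N) (B 0%N)) = (I2 G)%:E.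
Proof.
move=> hu meta mq mv vM [C hC] uv sA sB A0 B0 c0 G.
have mw : measurable_fun setT (u \_ half_plane) by move: hu; rewrite !inE/= => /andP[]; rewrite !inE/=.
have mT i j : mf2 (fun x t => A i x * B j t).
  apply: measurable_funM.
    by apply: measurableT_comp; [exact: (continuous_measurable_fun (smooth1_cont (k := i) sA))|exact: measurable_fst].
  by apply: measurableT_comp; [exact: (continuous_measurable_fun (smooth1_cont (k := j) sB))|exact: measurable_snd].
have bT i j : bcs2 (fun x t => A i x * B j t).
  split; first exact: mT.
  have [_ [C1 [h1 h2]]] := cont_bcs (smooth1_cont (k := i) sA) (A0 i).
  have [_ [C2 [k1 k2]]] := cont_bcs (smooth1_cont (k := j) sB) (B0 j).
  exists (`|C1| * `|C2| + `|C1| + `|C2|); split=> x t.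
    rewrite normrM (le_trans (y := `|C1| * `|C2|))//.
      by apply: ler_pM => //; [exact: le_trans (h1 _) (ler_norm _)|exact: le_trans (k1 _) (ler_norm _)].
    by rewrite -addrA lerDl addr_ge0.
  case=> h; [rewrite h2 ?mul0r//|rewrite k2 ?mulr0//]; apply: le_lt_trans h.
    by rewrite (le_trans (ler_norm C1))// addrAC lerDr addr_ge0// mulr_ge0.
  by rewrite (le_trans (ler_norm C2))// lerDr addr_ge0// mulr_ge0.
have bG : bcs2 G.
  rewrite /G; apply: bcs2D.
    rewrite (_ : (fun _ _ => _) = (fun x t => A 0%N x * B 1%N t * eta (v x t))).
      apply: bcs2M => //; first exact: measurableT_comp.
      by exists C => x t; have [] := hC _ (vM x t).
    by apply/funext => x; apply/funext => t; rewrite mulrC.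
  rewrite (_ : (fun _ _ => _) = (fun x t => A 1%N x * B 0%N t * q (v x t))).
    apply: bcs2M => //; first exact: measurableT_comp.
    by exists C => x t; have [] := hC _ (vM x t).
  by apply/funext => x; apply/funext => t; rewrite mulrC.
split=> //.
rewrite /weak_form.
have -> : (\int[mu]_x (eta (u0 x) * tensor (A 0%N) (B 0%N) (x, 0))%R%:E = 0)%E.
  apply: integral0_eq => x _; rewrite /tensor/= B0 ?mulr0//.
  by rewrite negb_and -ltNge c0.
rewrite adde0.
have pt x t : partial_t (tensor (A 0%N) (B 0%N)) (x, t) = A 0%N x * B 1%N t.
  by have [_ ->] := @tensor_t _ (A 0%N) (B 0%N) _ (x, t) (sB 0%N t).
have px x t : partial_x (tensor (A 0%N) (B 0%N)) (x, t) = A 1%N x * B 0%N t.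
  by have [_ ->] := @tensor_x _ (A 0%N) (B 0%N) _ (x, t) (sA 0%N x).
(* The patched [w] is measurable, whereas [u] is arbitrary at negative times; on the domain of
   integration they agree. *)
pose w := u \_ half_plane.
pose Gw x t := eta (w (x, t)) * (A 0%N x * B 1%N t) + q (w (x, t)) * (A 1%N x * B 0%N t).
have mGw : mf2 Gw.
  apply: measurable_funD; apply: measurable_funM => //.
  - apply: measurableT_comp => //.
    by rewrite (_ : (fun _ => _) = w)//; apply/funext => -[].
  - exact: mT.
  - apply: measurableT_comp => //.
    by rewrite (_ : (fun _ => _) = w)//; apply/funext => -[].
  - exact: mT.
have mR : measurable (@Rplus R) by exact: measurable_itv.
transitivity (\int[mu]_(t in @Rplus R) \int[mu]_x (Gw x t)%:E)%E.
  apply: eq_integral => t; rewrite inE => tR; apply: eq_integral => x _.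
  by rewrite pt px /Gw /w patchE mem_set.
transitivity (\int[mu]_(t in @Rplus R) \int[mu]_x (G x t)%:E)%E.
  apply: ae_eq_integral => //.
  - apply: measurable_funTS; apply: measurable_ext_int.
    exact/measurable_EFinP.
  - apply: measurable_funTS; apply: measurable_ext_int.
    by apply/measurable_EFinP; case: bG.
  - apply: aeS uv => t ht tR.
    have t0 : 0 <= t by move: tR; rewrite /Rplus/= in_itv/= andbT.
    apply: ae_eq_integral => //.
    + by apply/measurable_EFinP; exact: (mf2_x t (mf2_swap mGw)).
    + by apply/measurable_EFinP; have [] := bcs2_t t bG.
    + apply: aeS (ht t0) => x hx _; congr EFin.
      by rewrite /Gw /w patchE mem_set// hx.
rewrite integral_mkcond I2_swap// -EFin_I; last exact: bcs2_I'.
apply: eq_integral => t _; rewrite patchE; case: ifPn => tR.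
  by rewrite EFin_I//; exact: bcs2_t.
rewrite (_ : (fun x => G x t) = fun=> 0) ?I_0//.
apply/funext => x; rewrite /G !B0 ?mulr0 ?addr0//; rewrite negb_and -ltNge.
  by move: tR; rewrite notin_setE /Rplus/= in_itv/= andbT => /negP; rewrite -ltNge => t0; rewrite (lt_trans t0).
by move: tR; rewrite notin_setE /Rplus/= in_itv/= andbT => /negP; rewrite -ltNge => t0; rewrite (lt_trans t0).
Qed.

End representative.

(** * Lipschitz test functions *)

Section test_extension.
Context {R : realType}.
Local Notation mu := (@lebesgue_measure R).

Lemma I2_dct (F : nat -> R -> R -> R) (C : R) : (forall n, mf2 (F n)) ->
  (forall n x t, `|F n x t| <= C) ->
  (forall n x t, C < `|x| \/ C < `|t| -> F n x t = 0) ->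
  {ae mu, forall x, {ae mu, forall t, F n x t @[n --> \oo] --> 0}} ->
  I2 (F n) @[n --> \oo] --> 0.
Proof.
move=> mF h1 h2 cF.
have C0 : 0 <= C by exact: le_trans (normr_ge0 _) (h1 0%N 0 0).
have bF n : bcs2 (F n) by split=> //; exists C; split; [exact: h1|exact: h2].
have CC : 0 <= C * (C - - C) by rewrite mulr_ge0// opprK addr_ge0.
apply: (@I_dct _ (fun n x => I (F n x)) (C + C * (C - - C))).
- by move=> n; have [] := bcs2_I (bF n).
- move=> n x; rewrite (le_trans (y := C * (C - - C)))//; last by rewrite lerDr.
  apply: bcs_le_bound => //.
  + exact: bcs2_x.
  + by rewrite -subr_ge0 opprK addr_ge0.
  + by move=> t; rewrite -ler_norml -ltNge => ht; apply: h2; right.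
- move=> n x hx; rewrite (_ : F n x = fun=> 0) ?I_0//; apply/funext => t.
  by apply: h2; left; apply: le_lt_trans hx; rewrite lerDl.
- apply: aeS cF => x hx; apply: (@I_dct _ (fun n t => F n x t) C) => //.
  + by move=> n; exact: mf2_x.
  + by move=> n t ht; apply: h2; right.
Qed.

Lemma kern_supp2 n (r t : R) : kern n 2 (r - t) != 0 -> `|t - r| <= n.+1%:R^-1.
Proof.
move=> h; rewrite leNgt; apply/negP => h1; move/negP : h; apply; apply/eqP.
by apply: kern_out; rewrite distrC ltW.
Qed.

(* The kernel [kern n 2] has support of length 2 / n and height O(n ^ 2), so it
   turns a function of size [e / n] on its support into a number O(e). *)
Lemma kern2_small (p : R -> R) (n : nat) (r e C : R) : measurable_fun setT p ->
  0 <= e -> (forall t, `|p t| <= C) ->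
  (forall t, `|t - r| <= n.+1%:R^-1 -> `|p t| <= e * n.+1%:R^-1) ->
  `|I (fun t => p t * kern n 2 (r - t))| <= 2 * kernC * e.
Proof.
move=> mp e0 pC hp; have N0 : 0 < n.+1%:R :> R by rewrite ltr0n.
have bp : bcs (fun t => p t * kern n 2 (r - t)) by exact: dkern_bcs mp pC.
have := @bcs_le_bound _ _ (e * n.+1%:R^-1 * (kernC * n.+1%:R ^+ 2)) (r - n.+1%:R^-1) (r + n.+1%:R^-1) bp.
have -> : e * n.+1%:R^-1 * (kernC * n.+1%:R ^+ 2) * (r + n.+1%:R^-1 - (r - n.+1%:R^-1)) = 2 * kernC * e.
  by move: (n.+1%:R : R) N0 => N N0; field; rewrite gt_eqF.
apply.
- by rewrite ltW// itv_sym_lt// Ninv_gt0.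
- move=> t; have [->|h] := eqVneq (kern n 2 (r - t)) 0.
    by rewrite mulr0 normr0 !mulr_ge0 ?exprn_ge0 ?(ltW N0) ?(ltW (Ninv_gt0 _)) ?(ltW kernC_gt0).
  rewrite normrM ler_pM// ?kern2_le//; apply: hp; exact: kern_supp2 h.
- by move=> t ht; rewrite kern_r0// mulr0.
Qed.

(** The kernel annihilates constants, so [p] may be replaced by [p - p r], which has size at most
    [L / (n + 1)] on the support. *)
Lemma kern2_deriv_bound (p : R -> R) (n : nat) (r L C : R) : measurable_fun setT p ->
  (forall t, `|p t| <= C) -> 0 <= L -> (forall s t, `|p s - p t| <= L * `|s - t|) ->
  `|I (fun t => p t * kern n 2 (r - t))| <= 2 * kernC * L.
Proof.
move=> mp pC L0 pL.
have E : I (fun t => p t * kern n 2 (r - t)) = I (fun t => (p t - p r) * kern n 2 (r - t)).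
  rewrite -[LHS]subr0 -(mulr0 (p r)) -(kern_moment0 n r) -I_Z; last exact: kern_bcs_r.
  rewrite -I_B; [|exact: dkern_bcs mp pC|by apply: bcsZ; exact: kern_bcs_r].
  by congr I; apply/funext => t; rewrite mulrBl.
rewrite E; apply: (@kern2_small _ _ _ _ (C + C)) => //.
- exact: measurable_funB.
- by move=> t; rewrite (le_trans (ler_normB _ _))// lerD.
- by move=> t ht; rewrite (le_trans (pL _ _))// ler_wpM2l.
Qed.

(** The two moments evaluate the affine part of [p] at [r] exactly to [l]; the remainder is
    [o(1 / n)] on the support, hence negligible by [kern2_small]. *)
Lemma kern2_deriv_cvg (p : R -> R) (r l C : R) : measurable_fun setT p ->
  (forall t, `|p t| <= C) -> is_derive r 1 p l ->
  I (fun t => p t * kern n 2 (r - t)) @[n --> \oo] --> l.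
Proof.
move=> mp pC /is_deriveP dp; apply/cvgrPdist_le => e e0.
have C0 := @kernC_gt0 R.
have e1 : 0 < e / (2 * kernC) :> R by rewrite divr_gt0// mulr_gt0.
have [d d0 hd] := dp _ e1.
have hn : \forall n \near \oo, n.+1%:R^-1 < d :> R.
  exact: (near_infty_natSinv_lt (PosNum d0)).
apply: filterS hn => n nd.
have N0 := @Ninv_gt0 R n.
pose q t := p t - p r - l * (t - r).
have mq : measurable_fun setT q.
  apply: measurable_funB; first exact: measurable_funB.
  by apply: measurable_funM => //; exact: measurable_funB.
(* The remainder contains a linear term and is unbounded on the line; cutting it to the support of
   the kernel leaves the integral unchanged and gives the global bound that [kern2_small] asks
   for. *)
pose cut t := q t * \1_`[r - n.+1%:R^-1, r + n.+1%:R^-1] t.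
have E : l - I (fun t => p t * kern n 2 (r - t)) = - I (fun t => cut t * kern n 2 (r - t)).
  have b1 : bcs (fun t => p t * kern n 2 (r - t)) by exact: dkern_bcs mp pC.
  have b2 : bcs (fun t => p r * kern n 2 (r - t)) by apply: bcsZ; exact: kern_bcs_r.
  have b3 : bcs (fun t => (t - r) * kern n 2 (r - t)).
    apply: (@cont_bcs _ _ (r - n.+1%:R^-1) (r + n.+1%:R^-1)).
      by move=> t; apply: cvgM; [exact: contB|exact: kern_cont_r].
    by move=> t ht; rewrite kern_r0// mulr0.
  rewrite (_ : I (fun t => cut t * _) = I (fun t => p t * kern n 2 (r - t) - p r * kern n 2 (r - t)
     - l * ((t - r) * kern n 2 (r - t)))).
    rewrite I_B; [|exact: bcsB|exact: bcsZ].
    rewrite I_B// I_Z; last exact: kern_bcs_r.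
    by rewrite I_Z// kern_moment0 kern_moment1; ring.
  congr I; apply/funext => t; rewrite /cut indicE.
  case: (boolP (t \in _)) => ht; first by rewrite /q mulr1; ring.
  rewrite kern_r0 ?mulr0 ?subrr//.
  by move: ht; rewrite notin_setE/= in_itv/= => /negP.
have hq t : `|t - r| <= n.+1%:R^-1 -> `|q t| <= e / (2 * kernC) * n.+1%:R^-1.
  move=> ht; have := hd (t - r) (le_lt_trans ht nd); rewrite [r + _]addrC subrK => h.
  by rewrite (le_trans h)// ler_wpM2l// ltW.
have hcut t : `|t - r| <= n.+1%:R^-1 -> `|cut t| <= e / (2 * kernC) * n.+1%:R^-1.
  move=> ht; rewrite /cut indicE; case: (t \in _); first by rewrite mulr1 hq.
  by rewrite mulr0 normr0 mulr_ge0// ltW.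
rewrite E normrN.
rewrite (_ : e = 2 * kernC * (e / (2 * kernC))); last first.
  by field; rewrite gt_eqF.
apply: (@kern2_small _ _ _ _ (e / (2 * kernC) * n.+1%:R^-1)) => //.
- by apply: measurable_funM => //; exact: measurable_indic.
- exact: ltW.
- move=> t; rewrite /cut indicE; case: (boolP (t \in _)) => ht.
    rewrite mulr1 hq//; move: ht; rewrite inE/= in_itv/= -ler_distl.
    by rewrite distrC.
  by rewrite mulr0 normr0 mulr_ge0// ltW.
Qed.

End test_extension.

(** * Weak time derivatives averaged with a Lipschitz weight *)

Section lemma_E.
Context {R : realType}.
Local Notation mu := (@lebesgue_measure R).

Lemma mf2_moll n (e : R -> R -> R) (M : R) : mf2 e -> (forall x t, `|e x t| <= M) ->
  mf2 (fun x r => moll n (fun y => e y r) x).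
Proof.
move=> me eM; apply: (@measurable_I _ _ _ (fun (p : R * R) y => e y p.2 * kern n 1 (y - p.1))).
  apply: measurable_funM.
    have h : measurable_fun setT (fun q : R * R * R => (q.2, q.1.2)).
      apply: measurable_fun_pair; first exact: measurable_snd.
      by apply: (measurableT_comp measurable_snd); exact: measurable_fst.
    exact: (measurableT_comp me h).
  apply: (measurableT_comp (continuous_measurable_fun (@kern_cont R n 1))).
  apply: measurable_funB; first exact: measurable_snd.
  by apply: (measurableT_comp measurable_fst); exact: measurable_fst.
move=> p; apply: (@moll_bcs _ _ _ (fun y => e y p.2) _ M) => //.
exact: (mf2_x p.2 (mf2_swap me)).
Qed.

Lemma mf2_dkern n (P : R -> R -> R) (C : R) : mf2 P -> (forall x t, `|P x t| <= C) ->
  mf2 (fun x r => I (fun t => P x t * kern n 2 (r - t))).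
Proof.
move=> mP PC; apply: (@measurable_I _ _ _ (fun (p : R * R) t => P p.1 t * kern n 2 (p.2 - t))).
  apply: measurable_funM.
    have h : measurable_fun setT (fun q : R * R * R => (q.1.1, q.2)).
      apply: measurable_fun_pair; last exact: measurable_snd.
      by apply: (measurableT_comp measurable_fst); exact: measurable_fst.
    exact: (measurableT_comp mP h).
  apply: (measurableT_comp (continuous_measurable_fun (@kern_cont R n 2))).
  apply: measurable_funB; last exact: measurable_snd.
  by apply: (measurableT_comp measurable_snd); exact: measurable_fst.
move=> p; apply: (@dkern_bcs _ _ _ (P p.1) _ C) => //.
exact: (mf2_x p.1 mP).
Qed.

(** Equals minus the time derivative, at [(x, t)], of [e] mollified in both variables:
    differentiating [kern n 1 (r - t)] in [t] gives [- kern n 2 (r - t)]. *)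
Definition tensor_test_e n (e : R -> R -> R) (x t : R) : R :=
  I2 (fun y r => e y r * (kern n 1 (y - x) * kern n 2 (r - t))).

Lemma mf2_kk n i j (x t : R) : mf2 (fun y r => kern n i (y - x) * kern n j (r - t)).
Proof.
apply: measurable_funM.
  apply: (measurableT_comp (continuous_measurable_fun (@kern_cont R n i))).
  by apply: measurable_funB => //; exact: measurable_fst.
apply: (measurableT_comp (continuous_measurable_fun (@kern_cont R n j))).
by apply: measurable_funB => //; exact: measurable_snd.
Qed.

Lemma bcs2_kk n i j (x t : R) : bcs2 (fun y r => kern n i.+1 (y - x) * kern n j.+1 (r - t)).
Proof.
split; first exact: mf2_kk.
have [_ [C1 [h1 h2]]] := kern_bcs_l n i x.
have [_ [C2 [k1 k2]]] := kern_bcs_l n j t.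
exists (`|C1| * `|C2| + `|C1| + `|C2|); split=> y r.
  rewrite normrM (le_trans (y := `|C1| * `|C2|))//.
    by apply: ler_pM => //; [exact: le_trans (h1 _) (ler_norm _)|exact: le_trans (k1 _) (ler_norm _)].
  by rewrite -addrA lerDl addr_ge0.
case=> h; [rewrite h2 ?mul0r//|rewrite k2 ?mulr0//]; apply: le_lt_trans h.
  by rewrite (le_trans (ler_norm C1))// addrAC lerDr addr_ge0// mulr_ge0.
by rewrite (le_trans (ler_norm C2))// lerDr addr_ge0// mulr_ge0.
Qed.

Lemma bcs2_ekk n i j (e : R -> R -> R) (M x t : R) : mf2 e -> (forall x t, `|e x t| <= M) ->
  bcs2 (fun y r => e y r * (kern n i.+1 (y - x) * kern n j.+1 (r - t))).
Proof.
move=> me eM.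
rewrite (_ : (fun _ _ => _) = (fun y r => kern n i.+1 (y - x) * kern n j.+1 (r - t) * e y r)).
  by apply: bcs2M => //; [exact: bcs2_kk|exists M].
by apply/funext => y; apply/funext => r; rewrite mulrC.
Qed.

Lemma tensor_test_eE n (e : R -> R -> R) (M x t : R) : mf2 e -> (forall x t, `|e x t| <= M) ->
  tensor_test_e n e x t = I (fun r => moll n (fun y => e y r) x * kern n 2 (r - t)).
Proof.
move=> me eM; rewrite /tensor_test_e I2_swap; last exact: bcs2_ekk eM.
congr I; apply/funext => r; rewrite mulrC /moll -I_Z.
  by congr I; apply/funext => y; ring.
by apply: (@moll_bcs _ _ _ (fun y => e y r) _ M) => //; exact: (mf2_x r (mf2_swap me)).
Qed.

Section convergence.
Variables (e Psi P : R -> R -> R) (M C L : R).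
Hypotheses (me : mf2 e) (eM : forall x t, `|e x t| <= M).
Hypotheses (mPsi : mf2 Psi) (PsiC : forall x t, `|Psi x t| <= C).
Hypothesis (Psi0 : forall x t, C < `|x| \/ C < `|t| -> Psi x t = 0).
Hypothesis (L0 : 0 <= L).
Hypothesis (PsiL : forall x s t, `|Psi x s - Psi x t| <= L * `|s - t|).
Hypothesis (bP : bcs2 P).
Hypothesis (dPsi : {ae mu, forall x, {ae mu, forall t : R, is_derive t 1 (Psi x) (P x t)}}).

Let A n x r := moll n (fun y => e y r) x.
Let D n x r := I (fun t => Psi x t * kern n 2 (r - t)).

Let bPsi : bcs2 Psi. Proof. by split=> //; exists C; split. Qed.

Let mA n : mf2 (A n). Proof. exact: mf2_moll eM. Qed.

Let A_le n x r : `|A n x r| <= M.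
Proof. by apply: moll_bound => //; exact: (mf2_x r (mf2_swap me)). Qed.

Let mD n : mf2 (D n). Proof. exact: mf2_dkern PsiC. Qed.

Let D_le n x r : `|D n x r| <= 2 * kernC * L.
Proof. by apply: kern2_deriv_bound => //; exact: mf2_x. Qed.

Let C0 : 0 <= C. Proof. exact: le_trans (normr_ge0 _) (PsiC 0 0). Qed.

Let K0 : 0 <= 2 * kernC * L.
Proof. by rewrite !mulr_ge0// ltW// kernC_gt0. Qed.

Let D0 n x r : C + 1 + 2 * kernC * L < `|x| \/ C + 1 + 2 * kernC * L < `|r| -> D n x r = 0.
Proof.
move=> h; rewrite /D (_ : (fun t => _) = fun=> 0) ?I_0//; apply/funext => t.
case: h => h.
  by rewrite Psi0 ?mul0r//; left; apply: le_lt_trans h; rewrite -addrA lerDl addr_ge0.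
have [->|/kern_supp2 h2] := eqVneq (kern n 2 (r - t)) 0; first by rewrite mulr0.
rewrite Psi0 ?mul0r//; right.
have n1 : n.+1%:R^-1 <= 1 :> R by rewrite invf_le1// ?ler1n// ltr0n.
have := ler_distD t r 0; rewrite !subr0 distrC => h3.
have h4 := le_trans h2 n1; have h5 := K0; lra.
Qed.

Let bD n : bcs2 (D n).
Proof.
split; first exact: mD.
exists (C + 1 + 2 * kernC * L); split=> x t; last exact: D0.
by rewrite (le_trans (D_le _ _ _))// lerDr addr_ge0.
Qed.

Let stepE n : I2 (fun x t => Psi x t * tensor_test_e n e x t) = I2 (fun x r => A n x r * D n x r).
Proof.
rewrite /I2; apply: (congr1 I); apply/funext => x.
pose H t r := Psi x t * (A n x r * kern n 2 (r - t)).
have bx := bcs2_x x bPsi.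
have bH : bcs2 H.
  split.
    apply: measurable_funM.
      by apply: (measurableT_comp (mf2_x x mPsi)); exact: measurable_fst.
    apply: measurable_funM.
      by apply: (measurableT_comp (mf2_x x (mA n))); exact: measurable_snd.
    apply: (measurableT_comp (continuous_measurable_fun (@kern_cont R n 2))).
    by apply: measurable_funB; [exact: measurable_snd|exact: measurable_fst].
  have M0 : 0 <= M by exact: le_trans (normr_ge0 _) (eM 0 0).
  have Q0 : 0 <= kernC * n.+1%:R ^+ 2 :> R by rewrite mulr_ge0 ?exprn_ge0// ltW// kernC_gt0.
  exists (C * (M * (kernC * n.+1%:R ^+ 2)) + C + 1); split=> t r.
    rewrite !normrM (le_trans (y := C * (M * (kernC * n.+1%:R ^+ 2))))//.
      by rewrite ler_pM ?mulr_ge0// ler_pM// kern2_le.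
    by rewrite -addrA lerDl addr_ge0.
  have Q1 : 0 <= C * (M * (kernC * n.+1%:R ^+ 2)) by rewrite !mulr_ge0 // ltW// kernC_gt0.
  case=> h.
    rewrite /H Psi0 ?mul0r//; right; apply: le_lt_trans h.
    by rewrite addrAC lerDr addr_ge0.
  have [Ht|/kern_supp2 h2] := eqVneq (kern n 2 (r - t)) 0; first by rewrite /H Ht !mulr0.
  rewrite /H Psi0 ?mul0r//; right.
  have n1 : n.+1%:R^-1 <= 1 :> R by rewrite invf_le1// ?ler1n// ltr0n.
  have := ler_distD t r 0; rewrite !subr0 distrC => h3.
  have h4 := le_trans h2 n1.
  by move: Q1 h; set k := C * _ => Q1 h; lra.
have -> : (fun t => Psi x t * tensor_test_e n e x t) = (fun t => I (H t)).
  apply/funext => t; rewrite (tensor_test_eE _ _ _ me eM) -I_Z//.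
  apply: (@moll_bcs _ _ _ (A n x) _ M) => //.
  exact: mf2_x.
rewrite -[LHS]/(I2 H) I2_swap//; congr I; apply/funext => r.
rewrite /D -I_Z; last by apply: (dkern_bcs _ _ _ (mf2_x x mPsi) (PsiC x)).
by congr I; apply/funext => t; rewrite /H; ring.
Qed.

(** By Fubini the differentiated kernel passes from [e] to [Psi]: the left-hand side is the integral
    of [A n * D n], with [A n] the mollification of [e] in [x] and [D n] the average of [Psi] that
    tends to its time derivative. [A n] is bounded by [M] and [D n] by a multiple of the Lipschitz
    constant, so both errors fall under dominated convergence. *)
Lemma tensor_test_cvg :
  I2 (fun x t => Psi x t * tensor_test_e n e x t) @[n --> \oo] --> I2 (fun x t => e x t * P x t).
Proof.
have bAD n : bcs2 (fun x r => A n x r * D n x r).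
  rewrite (_ : (fun _ _ => _) = (fun x r => D n x r * A n x r)).
    by apply: bcs2M; [exact: bD|exact: mA|exists M => x t; exact: A_le].
  by apply/funext => x; apply/funext => r; rewrite mulrC.
have [CP [CP0 hP1 hP2]] := bcs2P bP.
have bMP (G : R -> R -> R) : mf2 G -> (forall x t, `|G x t| <= M) -> bcs2 (fun x t => G x t * P x t).
  move=> mG GM; rewrite (_ : (fun _ _ => _) = (fun x r => P x r * G x r)).
    by apply: bcs2M => //; exists M.
  by apply/funext => x; apply/funext => r; rewrite mulrC.
have M0 : 0 <= M by exact: le_trans (normr_ge0 _) (eM 0 0).
have c1 : I2 (fun x t => (A n x t - e x t) * P x t) @[n --> \oo] --> 0.
  (* Mollification in [x] converges, at fixed [t], for almost every [x]; hence [t] has to be the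
     outer variable here. *)
  have E n : I2 (fun x t => (A n x t - e x t) * P x t) = I2 (fun t x => (A n x t - e x t) * P x t).
    rewrite I2_swap//.
    have : bcs2 (fun x t => A n x t * P x t - e x t * P x t).
      by apply: bcs2B; [exact: bMP (mA n) (A_le n)|exact: bMP me eM].
    rewrite (_ : (fun x t => A n x t * P x t - e x t * P x t) = (fun x t => (A n x t - e x t) * P x t))//.
    by apply/funext => x; apply/funext => t; rewrite mulrBl.
  under eq_fun do rewrite E.
  apply: (@I2_dct _ (fun n t x => (A n x t - e x t) * P x t) ((M + M) * CP + CP)).
  - move=> n; apply: (@mf2_swap _ (fun x t => (A n x t - e x t) * P x t)).
    by apply: measurable_funM; [exact: (measurable_funB (mA n) me)|case: bP].
  - move=> n t x; rewrite normrM (le_trans (y := (M + M) * CP))//.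
      by rewrite ler_pM// (le_trans (ler_normB _ _))// lerD.
    by rewrite lerDl ltW.
  - move=> n t x h; rewrite hP2 ?mulr0//.
    have h3 : CP <= (M + M) * CP + CP by rewrite lerDr mulr_ge0 ?addr_ge0// ltW.
    by case: h => h; [right|left]; exact: le_lt_trans h.
  - apply/aeW => t.
    apply: aeS (moll_cvg (mf2_x t (mf2_swap me)) (fun x => eM x t)) => x hx.
    rewrite -(mul0r (P x t)); apply: cvgM; last exact: cvg_cst.
    by rewrite -(subrr (e x t)); apply: cvgB; [exact: hx|exact: cvg_cst].
have c2 : I2 (fun x t => A n x t * (D n x t - P x t)) @[n --> \oo] --> 0.
  set K := 2 * kernC * L; pose B := M * (K + CP) + (C + 1 + K) + CP.
  apply: (@I2_dct _ (fun n x t => A n x t * (D n x t - P x t)) B).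
  - move=> n; apply: measurable_funM; first exact: mA.
    by apply: measurable_funB; [exact: mD|case: bP].
  - move=> n x t; rewrite normrM (le_trans (y := M * (K + CP)))//.
      by rewrite ler_pM// (le_trans (ler_normB _ _))// lerD// D_le.
    by rewrite /B -addrA lerDl addr_ge0// ?(ltW CP0)// addr_ge0 ?addr_ge0.
  - move=> n x t h.
    have hK0 : 0 <= M * (K + CP) by rewrite mulr_ge0// addr_ge0// ltW.
    rewrite D0 ?hP2 ?subr0 ?mulr0//.
      have h3 : CP <= B by rewrite /B; have := K0; rewrite -/K; have := C0; lra.
      by case: h => h; [left|right]; exact: le_lt_trans h.
    have h3 : C + 1 + K <= B by rewrite /B; have := C0; lra.
    by case: h => h; [left|right]; exact: le_lt_trans h.
  - apply: aeS dPsi => x hx; apply: aeS hx => t hxt.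
    have hD : D n x t - P x t @[n --> \oo] --> 0.
      rewrite -(subrr (P x t)); apply: cvgB; last exact: cvg_cst.
      exact: (kern2_deriv_cvg (mf2_x x mPsi) (PsiC x) hxt).
    apply/cvgrPdist_le => eps eps0; have e1 : 0 < eps / (M + 1) by rewrite divr_gt0// ltr_pwDr.
    move/cvgrPdist_le : hD => /(_ _ e1); apply: filterS => n.
    rewrite !sub0r !normrN normrM => h.
    rewrite (le_trans (y := (M + 1) * (eps / (M + 1))))//.
      by apply: ler_pM => //; rewrite (le_trans (A_le _ _ _))// lerDl.
    by rewrite mulrC divfK// gt_eqF// ltr_pwDr.
have E n : I2 (fun x t => A n x t * D n x t) = I2 (fun x t => e x t * P x t) +
  I2 (fun x t => (A n x t - e x t) * P x t) + I2 (fun x t => A n x t * (D n x t - P x t)).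
  have b0 := bMP _ me eM.
  have b1 := bMP _ (mA n) (A_le n).
  have -> : (fun x t => (A n x t - e x t) * P x t) = (fun x t => A n x t * P x t - e x t * P x t).
    by apply/funext => x; apply/funext => t; rewrite mulrBl.
  have -> : (fun x t => A n x t * (D n x t - P x t)) = (fun x t => A n x t * D n x t - A n x t * P x t).
    by apply/funext => x; apply/funext => t; rewrite mulrBr.
  rewrite !I2_B//.
  have G (p q r : R) : r = p + (q - p) + (r - q) by ring.
  exact: G.
rewrite (_ : (fun n => _) = (fun n => I2 (fun x t => e x t * P x t) +
  I2 (fun x t => (A n x t - e x t) * P x t) + I2 (fun x t => A n x t * (D n x t - P x t)))).
  rewrite -[X in _ --> X]addr0 -[X in _ --> X + _]addr0.
  by apply: cvgD c2; apply: cvgD c1; exact: cvg_cst.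
by apply/funext => n; rewrite stepE E.
Qed.

Lemma bcs2_tensor_test n : bcs2 (fun x t => Psi x t * tensor_test_e n e x t).
Proof.
apply: bcs2M => //.
- rewrite (_ : tensor_test_e n e = (fun x t => I (fun r => A n x r * kern n 2 (r - t)))).
    apply: (@measurable_I _ _ _ (fun (p : R * R) r => A n p.1 r * kern n 2 (r - p.2))).
      apply: measurable_funM.
        have h : measurable_fun setT (fun q : R * R * R => (q.1.1, q.2)).
          apply: measurable_fun_pair; last exact: measurable_snd.
          by apply: (measurableT_comp measurable_fst); exact: measurable_fst.
        exact: (measurableT_comp (mA n) h).
      apply: (measurableT_comp (continuous_measurable_fun (@kern_cont R n 2))).
      apply: measurable_funB; first exact: measurable_snd.
      by apply: (measurableT_comp measurable_snd); exact: measurable_fst.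
    move=> p; apply: (@moll_bcs _ _ _ (A n p.1) _ M) => //.
    exact: mf2_x.
  by apply/funext => x; apply/funext => t; rewrite (tensor_test_eE _ _ _ me eM).
- exists ((M * (kernC * n.+1%:R ^+ 2)) * (n.+1%:R^-1 - - n.+1%:R^-1)) => x t.
  rewrite (tensor_test_eE _ _ _ me eM).
  have -> : n.+1%:R^-1 - - n.+1%:R^-1 = (t + n.+1%:R^-1) - (t - n.+1%:R^-1) :> R by ring.
  apply: bcs_le_bound.
  + by apply: (@moll_bcs _ _ _ (A n x) _ M) => //; exact: mf2_x.
  + by rewrite ltW// itv_sym_lt// Ninv_gt0.
  + move=> r; rewrite normrM ler_pM//; first exact: A_le.
    exact: kern2_le.
  + by move=> r hr; rewrite kern_l0// mulr0.
Qed.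

End convergence.

End lemma_E.

(** * Weak forms of [e_t + j_x] against Lipschitz functions *)

Section pair_tests.
Context {R : realType}.
Local Notation mu := (@lebesgue_measure R).

(* The weak form of [e_t + j_x] tested against the product kernel centred at
   [(x, t)]; [tensor_test_e] is the part in [e_t]. *)
Definition pair_test n (e j : R -> R -> R) (x t : R) : R :=
  tensor_test_e n e x t + tensor_test_e n (fun r y => j y r) t x.

Definition box (X c1 c2 x t : R) : bool := (`|x| < X) && (c1 < t < c2).

(** The partial derivatives are supplied as data and required on almost every line parallel to the
    corresponding axis, which is what iterated integrals use. Positivity of [c1] keeps small kernels
    centred in the support away from time 0. *)
Record lip_test (X c1 c2 L : R) (Psi Pt Px : R -> R -> R) : Prop := LipTest {
  lt_c1 : 0 < c1;
  lt_m : mf2 Psi;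
  lt_mt : mf2 Pt;
  lt_mx : mf2 Px;
  lt_0 : forall x t, ~~ box X c1 c2 x t -> [/\ Psi x t = 0, Pt x t = 0 & Px x t = 0];
  lt_L : forall x t, [/\ `|Psi x t| <= L, `|Pt x t| <= L & `|Px x t| <= L];
  lt_Lt : forall x s t, `|Psi x s - Psi x t| <= L * `|s - t|;
  lt_Lx : forall x y t, `|Psi x t - Psi y t| <= L * `|x - y|;
  lt_dt : {ae mu, forall x, {ae mu, forall t : R, is_derive t 1 (Psi x) (Pt x t)}};
  lt_dx : {ae mu, forall t, {ae mu, forall x : R, is_derive x 1 (fun x => Psi x t) (Px x t)}} }.

Lemma box_bcs2 (X c1 c2 L : R) (F : R -> R -> R) : mf2 F -> (forall x t, `|F x t| <= L) ->
  (forall x t, ~~ box X c1 c2 x t -> F x t = 0) -> bcs2 F.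
Proof.
move=> mF FL F0; split=> //; exists (`|L| + `|X| + (`|c1| + `|c2|)); split=> x t.
  by rewrite (le_trans (FL _ _))// (le_trans (ler_norm L))// -addrA lerDl !addr_ge0.
move=> h; apply: F0; apply/negP => /andP[h1 /andP[h2 h3]].
have := ler_norm X; have := ler_norm c2; have := ler_norm (- c1); rewrite normrN.
have := normr_ge0 L; have := normr_ge0 X; have := normr_ge0 c1; have := normr_ge0 c2.
move=> *; case: h => h; first lra.
move: h; rewrite ltNge => /negP; apply; rewrite ler_norml; apply/andP; split; lra.
Qed.

Section lemma_E.
Variables (X c1 c2 L : R) (Psi Pt Px : R -> R -> R).
Hypothesis hPsi : lip_test X c1 c2 L Psi Pt Px.
Variables (e j : R -> R -> R) (M : R).
Hypotheses (me : mf2 e) (eM : forall x t, `|e x t| <= M).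
Hypotheses (mj : mf2 j) (jM : forall x t, `|j x t| <= M).

Let L0 : 0 <= L.
Proof. by have [h _ _] := lt_L hPsi 0 0; exact: le_trans (normr_ge0 _) h. Qed.

Let bPsi : bcs2 Psi.
Proof.
apply: (@box_bcs2 X c1 c2 L); first exact: lt_m hPsi.
  by move=> x t; have [] := lt_L hPsi x t.
by move=> x t /(lt_0 hPsi)[].
Qed.

Let bPt : bcs2 Pt.
Proof.
apply: (@box_bcs2 X c1 c2 L); first exact: lt_mt hPsi.
  by move=> x t; have [] := lt_L hPsi x t.
by move=> x t /(lt_0 hPsi)[].
Qed.

Let bPx : bcs2 Px.
Proof.
apply: (@box_bcs2 X c1 c2 L); first exact: lt_mx hPsi.
  by move=> x t; have [] := lt_L hPsi x t.
by move=> x t /(lt_0 hPsi)[].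
Qed.

Lemma lip_bcs2e : bcs2 (fun x t => e x t * Pt x t + j x t * Px x t).
Proof.
apply: bcs2D.
  rewrite (_ : (fun _ _ => _) = (fun x t => Pt x t * e x t)).
    by apply: bcs2M => //; exists M.
  by apply/funext => x; apply/funext => t; rewrite mulrC.
rewrite (_ : (fun _ _ => _) = (fun x t => Px x t * j x t)).
  by apply: bcs2M => //; exists M.
by apply/funext => x; apply/funext => t; rewrite mulrC.
Qed.

Lemma pair_test_cvg :
  bcs2 (fun x t => e x t * Pt x t) /\ bcs2 (fun x t => j x t * Px x t) /\
  I2 (fun x t => Psi x t * pair_test n e j x t) @[n --> \oo] -->
  I2 (fun x t => e x t * Pt x t + j x t * Px x t).
Proof.
have [C [C0 h1 h2]] := bcs2P bPsi.
have b1 : bcs2 (fun x t => e x t * Pt x t).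
  rewrite (_ : (fun _ _ => _) = (fun x t => Pt x t * e x t)).
    by apply: bcs2M => //; exists M.
  by apply/funext => x; apply/funext => t; rewrite mulrC.
have b2 : bcs2 (fun x t => j x t * Px x t).
  rewrite (_ : (fun _ _ => _) = (fun x t => Px x t * j x t)).
    by apply: bcs2M => //; exists M.
  by apply/funext => x; apply/funext => t; rewrite mulrC.
split => //; split => //; rewrite I2_D//.
have t1 n : bcs2 (fun x t => Psi x t * tensor_test_e n e x t).
  by apply: (@bcs2_tensor_test _ _ _ M C); case: bPsi.
have t2 n : bcs2 (fun t x => Psi x t * tensor_test_e n (fun r y => j y r) t x).
  apply: (@bcs2_tensor_test _ (fun r y => j y r) (fun t x => Psi x t) M C).
  - exact: mf2_swap.
  - by move=> x t; exact: jM.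
  - by apply: mf2_swap; case: bPsi.
  - by move=> x t; exact: h1.
  - by move=> x t [] h; apply: h2; [right|left].
have E n : I2 (fun x t => Psi x t * pair_test n e j x t) =
  I2 (fun x t => Psi x t * tensor_test_e n e x t) +
  I2 (fun t x => Psi x t * tensor_test_e n (fun r y => j y r) t x).
  have sw : I2 (fun x t => Psi x t * tensor_test_e n (fun r y => j y r) t x) =
      I2 (fun t x => Psi x t * tensor_test_e n (fun r y => j y r) t x).
    exact: (I2_swap (bcs2_swap (t2 n))).
  apply: etrans (congr1 (+%R _) sw); apply: etrans (I2_D (t1 n) (bcs2_swap (t2 n))).
  by apply: (congr1 I2); apply/funext => x; apply/funext => t; rewrite /pair_test mulrDr.
rewrite (_ : (fun n => _) = (fun n => I2 (fun x t => Psi x t * tensor_test_e n e x t) +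
  I2 (fun t x => Psi x t * tensor_test_e n (fun r y => j y r) t x))); last first.
  by apply/funext.
apply: cvgD.
  apply: (@tensor_test_cvg _ _ _ _ M C L) => //.
  - by case: bPsi.
  - exact: lt_Lt hPsi.
  - exact: lt_dt hPsi.
rewrite I2_swap//.
apply: (@tensor_test_cvg _ (fun t x => j x t) (fun t x => Psi x t) (fun t x => Px x t) M C L) => //.
- exact: mf2_swap.
- by apply: mf2_swap; case: bPsi.
- by move=> t x [] h; apply: h2; [right|left].
- by move=> t x y; exact: (lt_Lx hPsi).
- exact: bcs2_swap.
- exact: lt_dx hPsi.
Qed.

Let bPT n : bcs2 (fun x t => Psi x t * pair_test n e j x t).
Proof.
have [C [C0 h1 h2]] := bcs2P bPsi.
have t1 : bcs2 (fun x t => Psi x t * tensor_test_e n e x t).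
  by apply: (@bcs2_tensor_test _ _ _ M C); case: bPsi.
have t2 : bcs2 (fun t x => Psi x t * tensor_test_e n (fun r y => j y r) t x).
  apply: (@bcs2_tensor_test _ (fun r y => j y r) (fun t x => Psi x t) M C).
  - exact: mf2_swap.
  - by move=> x t; exact: jM.
  - by apply: mf2_swap; case: bPsi.
  - by move=> x t; exact: h1.
  - by move=> x t [] h; apply: h2; [right|left].
have := bcs2D t1 (bcs2_swap t2).
rewrite (_ : (fun x t => _ + _) = (fun x t => Psi x t * pair_test n e j x t))//.
by apply/funext => x; apply/funext => t; rewrite /pair_test mulrDr.
Qed.

(** A limit of averages of nonnegative numbers with nonnegative weight. Once [1 / (n + 1) < c1], the
    weight vanishes at all centres whose kernels could reach the initial time. *)
Lemma lip_test_ge0 : (forall n x t, n.+1%:R^-1 < t -> 0 <= pair_test n e j x t) ->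
  (forall x t, 0 <= Psi x t) -> 0 <= I2 (fun x t => e x t * Pt x t + j x t * Px x t).
Proof.
move=> hp Psi0; have [_ [_ c]] := pair_test_cvg.
rewrite -(cvg_lim (@Rhausdorff R) c); apply: limr_ge.
  by apply/cvg_ex; eexists; exact: c.
have := near_infty_natSinv_lt (PosNum (lt_c1 hPsi)); apply: filterS => n /= nc.
apply: I2_ge0 => x t; have [b|/(lt_0 hPsi)[-> _ _]] := boolP (box X c1 c2 x t); last by rewrite mul0r.
rewrite mulr_ge0//; apply: hp; apply: lt_trans nc _.
by case/and3P: b.
Qed.

Lemma lip_test_eq0 : (forall n x t, n.+1%:R^-1 < t -> pair_test n e j x t = 0) ->
  I2 (fun x t => e x t * Pt x t + j x t * Px x t) = 0.
Proof.
move=> hp; have [_ [_ c]] := pair_test_cvg.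
rewrite -(cvg_lim (@Rhausdorff R) c); apply: cvg_lim; first exact: Rhausdorff.
apply: cvg_near_cst.
have := near_infty_natSinv_lt (PosNum (lt_c1 hPsi)); apply: filterS => n /= nc.
rewrite (_ : (fun _ _ => _) = (fun _ _ => 0)); first by rewrite /I2 I_0 I_0.
apply/funext => x; apply/funext => t.
have [b|/(lt_0 hPsi)[-> _ _]] := boolP (box X c1 c2 x t); last by rewrite mul0r.
rewrite hp ?mulr0//; apply: lt_trans nc _.
by case/and3P: b.
Qed.

End lemma_E.

(** The constant pairs [(1, 0)] and [(0, 1)] satisfy the weak equation. Through [lip_test_eq0] they
    express that a partial derivative of a compactly supported Lipschitz function has integral 0. *)
Lemma pair_test10 n (x t : R) : pair_test n (fun _ _ => 1) (fun _ _ => 0) x t = 0.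
Proof.
have h : forall x t : R, `|1 : R| <= 1 by move=> *; rewrite normr1.
have m1 : @mf2 R (fun _ _ => 1) by exact: measurable_cst.
rewrite /pair_test (tensor_test_eE _ _ _ m1 h).
rewrite [X in _ + X](_ : _ = 0) ?addr0; last first.
  rewrite /tensor_test_e (_ : (fun _ _ => _) = (fun _ _ => 0)); first by rewrite /I2 I_0 I_0.
  by apply/funext => y; apply/funext => r; rewrite mul0r.
rewrite (_ : (fun r => _) = (fun r => kern n 2 (r - t))).
  rewrite (I_FTC2 (itv_sym_lt t (Ninv_gt0 n)) (kern_derive_l n 1 t) (@kern_cont_l _ n 2 t) (@kern_l0 _ n 1 t)).
  rewrite -(kern_even _ (t - _ - t)) opprB; have [_ ->] := kern_edge n 0 t.
  by rewrite -(kern_even _ (t + _ - t)) opprB; have [-> _] := kern_edge n 0 t; rewrite subrr.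
apply/funext => r; rewrite /moll (_ : (fun y => _) = (fun y => kern n 1 (y - x))).
  by rewrite kern_mass mul1r.
by apply/funext => y; rewrite mul1r.
Qed.

Lemma pair_test01 n (x t : R) : pair_test n (fun _ _ => 0) (fun _ _ => 1) x t = 0.
Proof. by apply: etrans (pair_test10 n t x); exact: addrC. Qed.

End pair_tests.

(** * Multiplication of Lipschitz test functions by factors controlled on the box *)

Section lip_test_mul.
Context {R : realType}.
Local Notation mu := (@lebesgue_measure R).

Section localized_product.
Variables (b : pred R) (p a : R -> R) (H L : R).
Hypotheses (pH : forall s, b s -> `|p s| <= H) (aL : forall s, `|a s| <= L).
Hypothesis a0 : forall s, ~~ b s -> a s = 0.

Lemma localized_product_bound s : `|p s * a s| <= `|H| * L.
Proof.
have L0 : 0 <= L by exact: le_trans (normr_ge0 _) (aL 0).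
have [bs|/a0 ->] := boolP (b s); last by rewrite mulr0 normr0 mulr_ge0.
by rewrite normrM ler_pM// (le_trans (pH bs))// ler_norm.
Qed.

Lemma localized_product_lip :
  (forall s t, b s -> b t -> `|p s - p t| <= H * `|s - t|) ->
  (forall s t, `|a s - a t| <= L * `|s - t|) ->
  forall s t, `|p s * a s - p t * a t| <= (`|H| * L + `|H| * L) * `|s - t|.
Proof.
move=> hp ha s t.
have L0 : 0 <= L by exact: le_trans (normr_ge0 _) (aL 0).
have one s' t' : b s' -> a t' = 0 -> `|p s' * a s'| <= (`|H| * L + `|H| * L) * `|s' - t'|.
  move=> bs at0; have := ha s' t'; rewrite at0 subr0 => h.
  rewrite normrM mulrDl (le_trans (y := `|H| * (L * `|s' - t'|)))//.
    by rewrite ler_pM// (le_trans (pH bs))// ler_norm.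
  by rewrite mulrA lerDl !mulr_ge0.
have [bs|nbs] := boolP (b s); have [bt|nbt] := boolP (b t).
- have -> : p s * a s - p t * a t = p s * (a s - a t) + (p s - p t) * a t by ring.
  rewrite (le_trans (ler_normD _ _))// !normrM mulrDl lerD//.
    by rewrite -mulrA ler_pM// (le_trans (pH bs))// ler_norm.
  rewrite [leRHS](_ : _ = (`|H| * `|s - t|) * L); last by ring.
  by rewrite ler_pM// (le_trans (hp _ _ bs bt))// ler_wpM2r// ler_norm.
- by rewrite (a0 nbt) mulr0 subr0; apply: one => //; exact: a0.
- by rewrite (a0 nbs) mulr0 sub0r normrN distrC; apply: one => //; exact: a0.
- by rewrite (a0 nbs) (a0 nbt) !mulr0 subrr normr0 mulr_ge0// addr_ge0// mulr_ge0.
Qed.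

(** Outside [b] both [a] and its derivative vanish while [p] is bounded wherever [a] can be nonzero,
    so the product is [o(h)] whatever [p] does at the edge. *)
Lemma localized_product_derive (t p' a' : R) : (b t -> is_derive t 1 p p') ->
  (~~ b t -> a' = 0) -> is_derive t 1 a a' ->
  is_derive t 1 (fun s => p s * a s) (p' * a t + p t * a').
Proof.
move=> dp a'0 da; have [bt|nbt] := boolP (b t).
  have d1 := dp bt.
  apply: (is_derive_cast (is_deriveM d1 da)) => //.
  by rewrite /GRing.scale/=; ring.
rewrite (a0 nbt) (a'0 nbt) !mulr0 addr0; apply/is_deriveP => e e0.
have e1 : 0 < e / (`|H| + 1) by rewrite divr_gt0// ltr_pwDr.
move/is_deriveP : da => /(_ _ e1)[d d0 hd]; exists d => // h /hd.
rewrite (a0 nbt) (a'0 nbt) !mulr0 !mul0r !subr0 => hh.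
have [bh|/a0 ->] := boolP (b (t + h)); last by rewrite mulr0 normr0 mulr_ge0// ltW.
rewrite normrM (le_trans (y := (`|H| + 1) * (e / (`|H| + 1) * `|h|)))//.
  by rewrite ler_pM// (le_trans (pH bh))// (le_trans (ler_norm _))// lerDl.
by rewrite mulrA [_ * (e / _)]mulrC divfK// gt_eqF// ltr_pwDr.
Qed.

End localized_product.

(** The factor [h] will be the slope of a parabola, which is unbounded in [x]; all assumptions on it
    are therefore restricted to the box. *)
Lemma lip_test_mul (X c1 c2 L H : R) (Psi Pt Px h ht hx : R -> R -> R) :
  lip_test X c1 c2 L Psi Pt Px -> mf2 h -> mf2 ht -> mf2 hx ->
  (forall x t, box X c1 c2 x t -> [/\ `|h x t| <= H, `|ht x t| <= H & `|hx x t| <= H]) ->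
  (forall x s t, box X c1 c2 x s -> box X c1 c2 x t -> `|h x s - h x t| <= H * `|s - t|) ->
  (forall x y t, box X c1 c2 x t -> box X c1 c2 y t -> `|h x t - h y t| <= H * `|x - y|) ->
  (forall x t, box X c1 c2 x t -> is_derive t 1 (h x) (ht x t)) ->
  (forall x t, box X c1 c2 x t -> is_derive x 1 (fun x => h x t) (hx x t)) ->
  exists L', lip_test X c1 c2 L' (fun x t => h x t * Psi x t)
    (fun x t => ht x t * Psi x t + h x t * Pt x t)
    (fun x t => hx x t * Psi x t + h x t * Px x t).
Proof.
move=> lt mh mht mhx hH hLt hLx dt dx.
have [c10 mP mPt mPx l0 lL lLt lLx ldt ldx] := lt.
have L0 : 0 <= L by have [hh _ _] := lL 0 0; exact: le_trans (normr_ge0 _) hh.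
have KL : `|H| * L <= `|H| * L + `|H| * L by rewrite lerDl mulr_ge0.
exists (`|H| * L + `|H| * L); split=> //.
- exact: measurable_funM.
- by apply: measurable_funD; exact: measurable_funM.
- by apply: measurable_funD; exact: measurable_funM.
- by move=> x t /l0[-> -> ->]; rewrite !mulr0 addr0.
- move=> x t.
  have B (p a : R -> R -> R) : (forall x t, box X c1 c2 x t -> `|p x t| <= H) ->
      (forall x t, ~~ box X c1 c2 x t -> a x t = 0) -> (forall x t, `|a x t| <= L) ->
      `|p x t * a x t| <= `|H| * L.
    by move=> h1 h2 h3; exact: (localized_product_bound (b := box X c1 c2 x) (p := p x) (a := a x) (H := H) (L := L) (h1 x) (h3 x) (h2 x)).
  have H1 y s : box X c1 c2 y s -> `|h y s| <= H by move=> /hH[].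
  have H2 y s : box X c1 c2 y s -> `|ht y s| <= H by move=> /hH[].
  have H3 y s : box X c1 c2 y s -> `|hx y s| <= H by move=> /hH[].
  have Z1 y s : ~~ box X c1 c2 y s -> Psi y s = 0 by move=> /l0[].
  have Z2 y s : ~~ box X c1 c2 y s -> Pt y s = 0 by move=> /l0[].
  have Z3 y s : ~~ box X c1 c2 y s -> Px y s = 0 by move=> /l0[].
  have L1 y s : `|Psi y s| <= L by have [] := lL y s.
  have L2 y s : `|Pt y s| <= L by have [] := lL y s.
  have L3 y s : `|Px y s| <= L by have [] := lL y s.
  split.
  + by apply: (le_trans _ KL); exact: B.
  + by apply: (le_trans (ler_normD _ _)); apply: lerD; exact: B.
  + by apply: (le_trans (ler_normD _ _)); apply: lerD; exact: B.
- move=> x; apply: (localized_product_lip (b := box X c1 c2 x) (p := h x) (a := Psi x)).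
  + by move=> s /hH[].
  + by move=> s; have [] := lL x s.
  + by move=> s /l0[].
  + by move=> s t; exact: hLt.
  + exact: lLt.
- move=> x y t; apply: (localized_product_lip (b := fun x => box X c1 c2 x t) (p := fun x => h x t) (a := fun x => Psi x t)).
  + by move=> s /hH[].
  + by move=> s; have [] := lL s t.
  + by move=> s /l0[].
  + by move=> s z; exact: hLx.
  + by move=> s z; exact: lLx.
- apply: aeS ldt => x hx1; apply: aeS hx1 => t ht1.
  have pH s : box X c1 c2 x s -> `|h x s| <= H by move=> /hH[].
  have z1 s : ~~ box X c1 c2 x s -> Psi x s = 0 by move=> /l0[].
  have z2 : ~~ box X c1 c2 x t -> Pt x t = 0 by move=> /l0[].
  exact: (localized_product_derive pH z1 (@dt x t) z2 ht1).
- apply: aeS ldx => t hx1; apply: aeS hx1 => x ht1.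
  have pH s : box X c1 c2 s t -> `|h s t| <= H by move=> /hH[].
  have z1 s : ~~ box X c1 c2 s t -> Psi s t = 0 by move=> /l0[].
  have z2 : ~~ box X c1 c2 x t -> Px x t = 0 by move=> /l0[].
  exact: (localized_product_derive (b := fun x => box X c1 c2 x t)
    (p := fun x => h x t) (a := fun x => Psi x t) pH z1 (@dx x t) z2 ht1).
Qed.

End lip_test_mul.

(** * Joint measurability and truncation by the positive part *)

Section clip.
Context {R : realType}.
Local Notation mu := (@lebesgue_measure R).

(* A function that is [M]-Lipschitz in [x] is the supremum over rational [q] of
   [U q t - M * `|x - q|], hence jointly measurable. *)
Lemma lip_mf2 (U : R -> R -> R) (M : R) : 0 <= M ->
  (forall x, measurable_fun setT (U x)) ->
  (forall x y t, `|U x t - U y t| <= M * `|x - y|) -> mf2 U.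
Proof.
move=> M0 mU LU.
pose q (m : nat) : R := ratr (odflt 0 (unpickle m) : rat).
pose h (m : nat) (p : R * R) : R := U (q m) p.2 - M * `|p.1 - q m|.
have hU m p : h m p <= U p.1 p.2.
  rewrite /h lerBlDr -lerBlDl (le_trans (ler_norm _))// (le_trans (LU _ _ _))//.
  by rewrite distrC.
have mh m : measurable_fun setT (h m).
  apply: measurable_funB.
    by apply: (measurableT_comp (mU (q m))); exact: measurable_snd.
  apply: measurable_funM => //; apply: measurableT_comp => //.
  by apply: measurable_funB => //; exact: measurable_fst.
have hub (p : R * R) : has_ubound (range (h ^~ p)).
  by exists (U p.1 p.2) => _ [m _ <-]; exact: hU.
have := @measurable_fun_sups _ _ _ setT h 0%N (fun p _ => hub p) mh.
rewrite (_ : (fun x => sups _ _) = (fun p : R * R => U p.1 p.2))//.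
apply/funext => p; rewrite /sups /sdrop /=.
set A := (X in sup X).
have Ane : A !=set0 by exists (h 0%N p), 0%N.
apply/eqP; rewrite eq_le; apply/andP; split.
  by apply: ge_sup => // _ [m _ <-]; exact: hU.
apply/ler_addgt0Pr => e e0.
have e1 : 0 < e / (2 * (M + 1)) by rewrite divr_gt0// mulr_gt0// ltr_pwDr.
have [r] := @rat_in_itvoo R (p.1 - e / (2 * (M + 1))) (p.1 + e / (2 * (M + 1))) (itv_sym_lt _ e1).
rewrite in_itv/= -ltr_distl => hr.
have hm : h (pickle r) p <= sup A.
  apply: ub_le_sup; last by exists (pickle r).
  by exists (U p.1 p.2) => _ [m _ <-]; exact: hU.
apply: (@le_trans _ _ (h (pickle r) p + e)); last by rewrite lerD2r.
rewrite /h /q pickleK/=.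
have h2 := LU p.1 (ratr r) p.2.
have h3 : M * `|p.1 - ratr r| <= e / 2.
  rewrite distrC in hr; rewrite (le_trans (y := (M + 1) * (e / (2 * (M + 1)))))//.
    by apply: ler_pM => //; [rewrite lerDl|exact: ltW].
  by rewrite le_eqVlt; apply/orP; left; apply/eqP; field; rewrite gt_eqF// ltr_pwDr.
have h4 := ler_norm (U p.1 p.2 - U (ratr r) p.2).
lra.
Qed.

Lemma max0_lip (a b : R) : `|Num.max a 0 - Num.max b 0| <= `|a - b|.
Proof.
have [ha|ha] := leP a 0; have [hb|hb] := leP b 0; rewrite ?subrr ?normr0// ?subr0 ?sub0r ?normrN.
- by rewrite distrC !ger0_norm; lra.
- by rewrite !ger0_norm; lra.
Qed.

(** Across an endpoint the positive part of [g] is compared with the value of [g] there, which is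
    nonpositive, so extension by 0 creates no jump. *)
Lemma clip_lip (g : R -> R) (a b L : R) : 0 <= L ->
  (forall s t, a <= s <= b -> a <= t <= b -> `|g s - g t| <= L * `|s - t|) ->
  g a <= 0 -> g b <= 0 ->
  let z s := if a < s < b then Num.max (g s) 0 else 0 in
  forall s t, `|z s - z t| <= L * `|s - t|.
Proof.
move=> L0 Lg ga gb z.
have one s t : a < s < b -> ~~ (a < t < b) -> `|Num.max (g s) 0| <= L * `|s - t|.
  move=> /andP[as_ sb] nt.
  rewrite ger0_norm ?le_max ?lexx ?orbT// ge_max mulr_ge0// andbT.
  move: nt; rewrite negb_and -!leNgt => /orP[ta|bt].
    have h := Lg s a; rewrite !lexx !(ltW as_) !(ltW sb) (ltW (lt_trans as_ sb)) in h.
    have {}h := h isT isT; rewrite (le_trans (y := `|g s - g a|))//.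
      by rewrite (le_trans _ (ler_norm _))// lerBrDl gerDr.
    by rewrite (le_trans h)// ler_wpM2l// !ger0_norm; lra.
  have h := Lg s b; rewrite !lexx !(ltW as_) !(ltW sb) (ltW (lt_trans as_ sb)) in h.
  have {}h := h isT isT; rewrite (le_trans (y := `|g s - g b|))//.
    by rewrite (le_trans _ (ler_norm _))// lerBrDl gerDr.
  by rewrite (le_trans h)// ler_wpM2l// !ler0_norm; lra.
move=> s t; rewrite /z.
have [ss|ns] := boolP (a < s < b); have [st|nt] := boolP (a < t < b).
- rewrite (le_trans (max0_lip _ _))//; apply: Lg.
    by case/andP: ss => ? ?; rewrite !ltW.
  by case/andP: st => ? ?; rewrite !ltW.
- by rewrite subr0; exact: one.
- by rewrite sub0r normrN distrC; exact: one.
- by rewrite subrr normr0 mulr_ge0.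
Qed.

(** Squaring removes the kink of the positive part; this is why the test functions start from the
    squared gap. *)
Lemma is_derive_pos2 (z : R) : is_derive z 1 (fun z => Num.max z 0 ^+ 2 / 2) (Num.max z 0).
Proof.
apply/is_deriveP => e e0; exists (2 * e) => [|h]; first by rewrite mulr_gt0.
move=> he; apply: (@le_trans _ _ (h ^+ 2 / 2)); last first.
  rewrite -[h ^+ 2]ger0_norm ?sqr_ge0// normrX expr2 mulrAC ler_wpM2r//.
  by rewrite ler_pdivrMr// mulrC ltW.
rewrite ger0_norm.
- by have [h1|h1] := leP (z + h) 0; have [h2|h2] := leP z 0; nra.
- by have [h1|h1] := leP (z + h) 0; have [h2|h2] := leP z 0; nra.
Qed.

End clip.

(** * The squared gap as a Lipschitz test function *)

Section barrier.
Context {R : realType}.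
Local Notation mu := (@lebesgue_measure R).
Variables (U v : R -> R -> R) (M : R).
Hypothesis (mv : mf2 v) (mU : mf2 U) (vM : forall x t, `|v x t| <= M).
Hypothesis Ux : {ae mu, forall t, 0 < t -> {ae mu, forall x : R, is_derive x 1 (fun x => U x t) (v x t)}}.
Hypothesis Ut : {ae mu, forall x, {ae mu, forall t : R, 0 < t -> is_derive t 1 (U x) (- (v x t ^+ 2 / 2))}}.

Variables (phi phit w : R -> R -> R) (sg X c1 c2 B L : R).
Hypothesis (mphi : mf2 phi) (mphit : mf2 phit) (mw : mf2 w).
Hypotheses (c1_gt0 : 0 < c1) (L0 : 0 <= L) (X0 : 0 < X) (c12 : c1 < c2).
Hypothesis sgN : `|sg| = 1.

Let G x t := sg * (phi x t - U x t).

(** For [sg = 1] this measures how far [phi] exceeds [U], for [sg = -1] how far it falls below. By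
    [Gbd] the cut at the box is continuous on the lateral sides and at both end times. *)
Definition gap x t := if box X c1 c2 x t then Num.max (G x t) 0 else 0.

Hypothesis GLt : forall x s t, `|x| <= X -> c1 <= s <= c2 -> c1 <= t <= c2 ->
  `|G x s - G x t| <= L * `|s - t|.
Hypothesis GLx : forall x y t, `|x| <= X -> `|y| <= X -> c1 <= t <= c2 ->
  `|G x t - G y t| <= L * `|x - y|.
Hypothesis Gbd : forall x t, `|x| <= X -> c1 <= t <= c2 ->
  [|| `|x| == X, t == c1 | t == c2] -> G x t <= 0.
Hypothesis Bt : forall x t, box X c1 c2 x t -> `|phit x t| <= B.
Hypothesis Bw : forall x t, box X c1 c2 x t -> `|w x t| <= B.
Hypothesis dphit : forall x t, box X c1 c2 x t -> is_derive t 1 (phi x) (phit x t).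
Hypothesis dphix : forall x t, box X c1 c2 x t -> is_derive x 1 (fun x => phi x t) (w x t).

Lemma gap_ge0 x t : 0 <= gap x t.
Proof. by rewrite /gap; case: ifP => // _; rewrite le_max lexx orbT. Qed.

Lemma gap_out x t : ~~ box X c1 c2 x t -> gap x t = 0.
Proof. by rewrite /gap => /negbTE ->. Qed.

Lemma gap_lip_t x s t : `|gap x s - gap x t| <= L * `|s - t|.
Proof.
rewrite /gap /box; have [xX|xX] := ltP `|x| X; last by rewrite subrr normr0 mulr_ge0.
apply: (@clip_lip _ (G x)) => //.
- by move=> a b; apply: GLt; exact: ltW.
- by apply: Gbd; rewrite ?eqxx ?orbT ?lexx ?(ltW c12) ?(ltW xX).
- by apply: Gbd; rewrite ?eqxx ?orbT ?lexx ?(ltW c12) ?(ltW xX).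
Qed.

Lemma gap_lip_x x y t : `|gap x t - gap y t| <= L * `|x - y|.
Proof.
rewrite /gap /box; have [tc|tc] := boolP (c1 < t < c2); last by rewrite !andbF subrr normr0 mulr_ge0.
have tc' : c1 <= t <= c2 by case/andP: tc => *; rewrite !ltW.
rewrite !andbT !ltr_norml.
apply: (@clip_lip _ (fun x => G x t)) => //.
- by move=> a b; rewrite -!ler_norml => ha hb; exact: GLx.
- by apply: Gbd; rewrite ?normrN ?(gtr0_norm X0) ?eqxx.
- by apply: Gbd; rewrite ?(gtr0_norm X0) ?eqxx.
Qed.

Let K := L * (c2 - c1).
Let K0 : 0 <= K. Proof. by rewrite mulr_ge0// subr_ge0 ltW. Qed.

Lemma gap_le x t : gap x t <= K.
Proof.
have [bx|/gap_out ->] := boolP (box X c1 c2 x t); last exact: K0.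
have h := gap_lip_t x t c1.
rewrite (@gap_out x c1) in h; last by rewrite /box ltxx/= andbF.
rewrite subr0 in h; apply: (le_trans (ler_norm _)); apply: (le_trans h).
case/and3P: bx => _ ? ?; rewrite /K ler_wpM2l// ger0_norm; lra.
Qed.

Lemma gap_norm x t : `|gap x t| <= K.
Proof. by rewrite ger0_norm ?gap_ge0// gap_le. Qed.

Lemma measurable_box : measurable_fun setT (fun p : R * R => box X c1 c2 p.1 p.2).
Proof.
apply: measurable_and.
  apply: measurable_fun_ltr => //.
  by apply: measurableT_comp => //; exact: measurable_fst.
apply: measurable_and.
  by apply: measurable_fun_ltr; [exact: measurable_cst|exact: measurable_snd].
by apply: measurable_fun_ltr; [exact: measurable_snd|exact: measurable_cst].
Qed.

Lemma mf2_gap : mf2 gap.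
Proof.
apply: measurable_fun_ifT; [exact: measurable_box| |exact: measurable_cst].
apply: measurable_maxr; last exact: measurable_cst.
apply: measurable_funM; first exact: measurable_cst.
exact: measurable_funB.
Qed.

Let Psi x t := gap x t ^+ 2 / 2.
Let Pt x t := gap x t * (sg * (phit x t + v x t ^+ 2 / 2)).
Let Px x t := gap x t * (sg * (w x t - v x t)).

Let Psi_lip (a b d : R) : `|a| <= K -> `|b| <= K -> `|a - b| <= L * d ->
  `|a ^+ 2 / 2 - b ^+ 2 / 2| <= K * L * d.
Proof.
move=> ha hb hab.
have -> : a ^+ 2 / 2 - b ^+ 2 / 2 = ((a + b) / 2) * (a - b) by field.
rewrite normrM -mulrA ler_pM// normrM [`|2^-1|]ger0_norm// ler_pdivrMr//.
by rewrite (le_trans (ler_normD _ _))// mulr_natr mulr2n lerD.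
Qed.

Lemma gap_lip_test : exists L', lip_test X c1 c2 L' Psi Pt Px.
Proof.
have M0 : 0 <= M by exact: le_trans (normr_ge0 _) (vM 0 0).
have B0 : 0 <= `|B| by [].
exists (K * L + K * (`|B| + M ^+ 2 / 2) + K * (`|B| + M) + K ^+ 2).
have nn1 : 0 <= K * L by rewrite mulr_ge0.
have nn2 : 0 <= K * (`|B| + M ^+ 2 / 2) by rewrite mulr_ge0// addr_ge0// mulr_ge0 ?sqr_ge0.
have nn3 : 0 <= K * (`|B| + M) by rewrite mulr_ge0// addr_ge0.
have nn4 : 0 <= K ^+ 2 by rewrite sqr_ge0.
(* One argument for both variables: where [f] vanishes its square is flat by the Lipschitz bound,
   whatever [g] does; elsewhere the point lies inside the box and the chain rule applies. *)
have deriv_case (f : R -> R) (g : R -> R) (z0 l d : R) (I0 : R -> bool) :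
  (forall s, `|f s - f z0| <= L * `|s - z0|) -> (forall s, 0 <= f s) ->
  0 < d -> (I0 z0 -> forall s, `|s - z0| < d -> f s = Num.max (g s) 0) ->
  (~~ I0 z0 -> f z0 = 0) -> (I0 z0 -> is_derive z0 1 g l) ->
  is_derive z0 1 (fun s => f s ^+ 2 / 2) (f z0 * l).
  move=> Lf f0 d0 fg fz dg.
  have [fz0|fz0] := eqVneq (f z0) 0.
    rewrite fz0 mul0r; apply: (@is_derive_quad _ _ _ (L ^+ 2)) => s.
    have := Lf s; rewrite fz0 subr0 => h.
    rewrite ger0_norm ?mulr_ge0 ?sqr_ge0// (le_trans (y := f s ^+ 2))//.
      by rewrite ler_pdivrMr// mulr_natr mulr2n lerDl sqr_ge0.
    rewrite -exprMn -[f s ^+ 2]ger0_norm ?sqr_ge0// -[(_ * _) ^+ 2]ger0_norm ?sqr_ge0//.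
    rewrite !normrX; apply: lerXn2r; rewrite ?nnegrE//.
    by rewrite normrM (ger0_norm L0).
  have Iz : I0 z0 by apply/negPn/negP => /fz h; rewrite h eqxx in fz0.
  have h0 : f z0 = Num.max (g z0) 0 by apply: fg => //; rewrite subrr normr0.
  rewrite h0.
  apply: (is_derive_near d0 (g := fun s => Num.max (g s) 0 ^+ 2 / 2)).
    by move=> s hs; rewrite fg.
  exact: (is_derive_chain (is_derive_pos2 (g z0)) (dg Iz)).
split=> //.
- apply: measurable_funM => //; apply: measurable_funX; exact: mf2_gap.
- apply: measurable_funM; first exact: mf2_gap.
  apply: measurable_funM => //; apply: measurable_funD => //.
  by apply: measurable_funM => //; exact: measurable_funX.
- apply: measurable_funM; first exact: mf2_gap.
  by apply: measurable_funM => //; exact: measurable_funB.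
- by move=> x t /gap_out h; rewrite /Psi /Pt /Px h expr0n/= !mul0r.
- move=> x t; have hg := gap_norm x t; have v1 := vM x t.
  have v2 : `|v x t ^+ 2 / 2| <= M ^+ 2 / 2.
    rewrite normrM [`|2^-1|]ger0_norm// ler_wpM2r// normrX.
    by apply: lerXn2r; rewrite ?nnegrE.
  split.
  + rewrite /Psi normrM [`|2^-1|]ger0_norm// normrX.
    rewrite (le_trans (y := K ^+ 2))//; last by lra.
    rewrite ler_pdivrMr// (le_trans (y := K ^+ 2))//.
      by apply: lerXn2r; rewrite ?nnegrE.
    by rewrite mulr_natr mulr2n lerDl.
  + rewrite (le_trans (y := K * (`|B| + M ^+ 2 / 2)))//; last by lra.
    have [bx|/gap_out h] := boolP (box X c1 c2 x t); last by rewrite /Pt h mul0r normr0.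
    rewrite /Pt normrM ler_pM// normrM sgN mul1r (le_trans (ler_normD _ _))// lerD//.
    by rewrite (le_trans (Bt bx))// ler_norm.
  + rewrite (le_trans (y := K * (`|B| + M)))//; last by lra.
    have [bx|/gap_out h] := boolP (box X c1 c2 x t); last by rewrite /Px h mul0r normr0.
    rewrite /Px normrM ler_pM// normrM sgN mul1r (le_trans (ler_normB _ _))// lerD//.
    by rewrite (le_trans (Bw bx))// ler_norm.
- move=> x s t; rewrite (le_trans (y := K * L * `|s - t|))//.
    by apply: Psi_lip; rewrite ?gap_norm// gap_lip_t.
  by rewrite ler_wpM2r//; lra.
- move=> x y t; rewrite (le_trans (y := K * L * `|x - y|))//.
    by apply: Psi_lip; rewrite ?gap_norm// gap_lip_x.
  by rewrite ler_wpM2r//; lra.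
- apply: aeS Ut => x hx; apply: aeS hx => t hxt.
  have [bx|nbx] := boolP (box X c1 c2 x t); last first.
    apply: (@deriv_case (gap x) (G x) t _ 1 (box X c1 c2 x)) => //.
    + by move=> s; exact: gap_lip_t.
    + by move=> s; exact: gap_ge0.
    + by rewrite (negbTE nbx).
    + by move=> _; exact: gap_out.
    + by rewrite (negbTE nbx).
  case/and3P: (bx) => x1 t1 t2.
  apply: (@deriv_case (gap x) (G x) t _ (Num.min (t - c1) (c2 - t)) (box X c1 c2 x)).
  + by move=> s; exact: gap_lip_t.
  + by move=> s; exact: gap_ge0.
  + by rewrite lt_min !subr_gt0 t1 t2.
  + move=> _ s; rewrite lt_min !ltr_norml => /andP[/andP[s1 s2] /andP[s3 s4]].
    rewrite /gap /box x1/= ifT//; apply/andP; split; lra.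
  + by rewrite bx.
  + move=> _; have t0 := lt_trans c1_gt0 t1.
    apply: (is_derive_cast (is_deriveZ sg (is_deriveB (dphit bx) (hxt t0)))) => //.
    by rewrite opprK.
- have Ux' : {ae mu, forall t, {ae mu, forall x : R, 0 < t -> is_derive x 1 (fun x => U x t) (v x t)}}.
    apply: aeS Ux => t ht; have [t0|t0] := boolP (0 < t).
      by apply: aeS (ht t0).
    by apply/aeW => x.
  apply: aeS Ux' => t hx; apply: aeS hx => x hxt.
  have [bx|nbx] := boolP (box X c1 c2 x t); last first.
    apply: (@deriv_case (fun x => gap x t) (fun x => G x t) x _ 1 (fun x => box X c1 c2 x t)) => //.
    + by move=> s; exact: gap_lip_x.
    + by move=> s; exact: gap_ge0.
    + by rewrite (negbTE nbx).
    + by move=> _; exact: gap_out.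
    + by rewrite (negbTE nbx).
  case/and3P: (bx) => x1 t1 t2.
  apply: (@deriv_case (fun x => gap x t) (fun x => G x t) x _ (X - `|x|) (fun x => box X c1 c2 x t)).
  + by move=> s; exact: gap_lip_x.
  + by move=> s; exact: gap_ge0.
  + by rewrite subr_gt0.
  + move=> _ s hs; rewrite /gap /box t1 t2/= ifT// andbT.
    have := ler_normD x (s - x); rewrite addrC subrK => h; lra.
  + by rewrite bx.
  + move=> _; have t0 := lt_trans c1_gt0 t1.
    exact: (is_derive_cast (is_deriveZ sg (is_deriveB (dphix bx) (hxt t0)))).
Qed.

End barrier.

(** * Comparison with parabolas *)

Section positivity.
Context {R : realType}.

Lemma I2_gt0 (F : R -> R -> R) (L x0 t0 : R) : bcs2 F -> (forall x t, 0 <= F x t) ->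
  0 <= L -> (forall x s t, `|F x s - F x t| <= L * `|s - t|) ->
  (forall x y t, `|F x t - F y t| <= L * `|x - y|) -> 0 < F x0 t0 -> 0 < I2 F.
Proof.
move=> bF F0 L0 Lt Lx Fp.
set c := F x0 t0 in Fp *.
(* On the square of half-side [d] around [(x0, t0)] the function loses at most
   [2 * L * d <= c / 2]. *)
pose d := c / (4 * (L + 1)).
have d0 : 0 < d by rewrite divr_gt0// mulr_gt0// ltr_pwDr.
have Ld : 2 * (L * d) <= c / 2.
  rewrite /d (_ : c / 2 = 2 * ((L + 1) * (c / (4 * (L + 1))))); last first.
    by field; rewrite gt_eqF// ltr_pwDr.
  rewrite ler_pM2l// ler_wpM2r ?(ltW d0)//; lra.
pose E x t := ((c / 2) * \1_`[x0 - d, x0 + d] x) * \1_`[t0 - d, t0 + d] t : R.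
have dd a : a - d <= a + d by rewrite ltW// itv_sym_lt.
have w2 (a b : R) : a + b - (a - b) = 2 * b by ring.
have w3 (a b : R) : b * a * (2 * b) = a / 2 * (2 * b) * (2 * b) by field.
have w4 (a b z : R) : 2 * b * (a / 2 * z) = b * a * z by field.
have IE x : I (E x) = 2 * d * ((c / 2) * \1_`[x0 - d, x0 + d] x).
  by rewrite /E I_itv// w2 mulrC.
have bE x : bcs (E x) by exact: indic_itv_bcs.
have I2E : I2 E = c / 2 * (2 * d) * (2 * d).
  rewrite /I2 (_ : (fun x => I (E x)) = (fun x => (d * c) * \1_`[x0 - d, x0 + d] x)).
    by rewrite I_itv// w2 w3.
  by apply/funext => x; rewrite IE w4.
apply: (@lt_le_trans _ _ (I2 E)).
  rewrite I2E; do 2 (apply: mulr_gt0; last by rewrite mulr_gt0).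
  by rewrite divr_gt0.
have bIE : bcs (fun x => I (E x)).
  rewrite (_ : (fun x => I (E x)) = (fun x => (d * c) * \1_`[x0 - d, x0 + d] x)).
    exact: indic_itv_bcs.
  by apply/funext => x; rewrite IE w4.
apply: I_le => // [|x]; first exact: bcs2_I.
apply: I_le => // [|t]; first exact: bcs2_x.
rewrite /E !indicE; have [hx|hx] := boolP (x \in _); last by rewrite mulr0 mul0r.
have [ht|ht] := boolP (t \in _); last by rewrite mulr0.
rewrite !mulr1; move: hx ht; rewrite !inE/= !in_itv/= -!ler_distl => hx ht.
have h1 := le_trans (Lx x x0 t) (ler_wpM2l L0 hx).
have h2 := le_trans (Lt x0 t t0) (ler_wpM2l L0 ht).
move: h1 h2; rewrite !ler_norml -/c => /andP[h1 _] /andP[h2 _].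
move: Ld h1 h2; set z := L * d => Ld h1 h2; lra.
Qed.

End positivity.

Section core_inequalities.
Context {R : realType}.
Implicit Types z q k y kap : R.

(** Here [z] is the gap, [y = v - w], [k] the curvature of the parabola and [q] the time derivative
    of the safety margin. The term in [k] consumes at most half of the term in [q], and the quartic
    term is nonpositive. *)
Lemma core_ineq1 z q k y kap : 0 <= z -> - (k * z) <= q -> kap <= q ->
  - (z * q * y ^+ 2 / 2) - z * y ^+ 4 / 12 - k * y ^+ 2 * z ^+ 2 / 4 <= - (kap / 4) * (z * y ^+ 2).
Proof.
move=> z0 kz kq.
have q5 : 0 <= z * y ^+ 2 by rewrite mulr_ge0// sqr_ge0.
have q6 : 0 <= z * y ^+ 4 by rewrite mulr_ge0// exprn_even_ge0.
have -> : k * y ^+ 2 * z ^+ 2 = (k * z) * (z * y ^+ 2) by ring.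
have -> : z * q * y ^+ 2 = q * (z * y ^+ 2) by ring.
have q7 := ler_wpM2r q5 kz; have q8 := ler_wpM2r q5 kq.
move: q6 q7 q8; rewrite mulNr => *; lra.
Qed.

Lemma core_ineq2 z q k y kap : 0 <= z -> k * z <= q -> kap <= q ->
  z * (- q + 1 * y ^+ 2 / 2) + k * z ^+ 2 / 2 <= 2^-1 * (z * y ^+ 2) - (kap / 2) * z.
Proof.
move=> z0 kz kq; have q7 := ler_wpM2r z0 kz; have q8 := ler_wpM2r z0 kq.
have -> : z * (- q + 1 * y ^+ 2 / 2) + k * z ^+ 2 / 2 =
  - (q * z) + z * y ^+ 2 / 2 + k * z * z / 2 by field.
lra.
Qed.

Lemma core_ineq3 z q k y kap : 0 <= z -> k * z <= q -> kap <= q ->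
  z * (- q + -1 * y ^+ 2 / 2) + k * z ^+ 2 / 2 <= - (kap / 2) * z.
Proof.
move=> z0 kz kq; have q7 := ler_wpM2r z0 kz; have q8 := ler_wpM2r z0 kq.
have q5 : 0 <= z * y ^+ 2 by rewrite mulr_ge0// sqr_ge0.
have -> : z * (- q + -1 * y ^+ 2 / 2) + k * z ^+ 2 / 2 =
  - (q * z) - z * y ^+ 2 / 2 + k * z * z / 2 by field.
lra.
Qed.

End core_inequalities.

(** * Comparison of the potential with a parabola on a box *)

Section core.
Context {R : realType}.
Local Notation mu := (@lebesgue_measure R).
Variables (U v : R -> R -> R) (M MU : R).
Hypothesis (mv : mf2 v) (vM : forall x t, `|v x t| <= M).
Hypothesis ULip : forall x t y s, `|U x t - U y s| <= MU * (`|x - y| + `|t - s|).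
Hypothesis Ux : {ae mu, forall t, 0 < t -> {ae mu, forall x : R, is_derive x 1 (fun x => U x t) (v x t)}}.
Hypothesis Ut : {ae mu, forall x, {ae mu, forall t : R, 0 < t -> is_derive t 1 (U x) (- (v x t ^+ 2 / 2))}}.
Hypothesis cons : forall n x t, n.+1%:R^-1 < t -> pair_test n v (fun x t => v x t ^+ 2 / 2) x t = 0.
Hypothesis ent : forall n x t, n.+1%:R^-1 < t ->
  0 <= pair_test n (fun x t => v x t ^+ 2 / 2) (fun x t => v x t ^+ 3 / 3) x t.

Let M0 : 0 <= M. Proof. exact: le_trans (normr_ge0 _) (vM 0 0). Qed.
Let MU0 : 0 <= MU.
Proof. by have := le_trans (normr_ge0 _) (ULip 0 0 1 0); rewrite sub0r normrN normr1 subrr normr0 addr0 mulr1. Qed.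

Lemma lip_cont (f : R -> R) (L : R) : 0 <= L -> (forall s t, `|f s - f t| <= L * `|s - t|) -> continuous f.
Proof.
move=> L0 Lf x; apply/cvgrPdist_le => e e0.
apply/nbhs_ballP; exists (e / (L + 1)); first by rewrite /= divr_gt0// ltr_pwDr.
move=> y; rewrite /ball/= => xy; rewrite (le_trans (Lf _ _))//.
rewrite (le_trans (y := (L + 1) * (e / (L + 1))))//.
  by apply: ler_pM => //; [rewrite lerDl|exact: ltW].
by rewrite mulrC divfK// gt_eqF// ltr_pwDr.
Qed.

Lemma potential_mf2 : mf2 U.
Proof.
apply: (lip_mf2 MU0).
  move=> x; apply: continuous_measurable_fun; apply: (lip_cont MU0) => s t.
  by have := ULip x s x t; rewrite subrr normr0 add0r.
by move=> x y t; have := ULip x t y t; rewrite subrr normr0 addr0.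
Qed.

Variables (k q qd : R -> R) (x0 m sg K kap X c1 c2 : R).
Hypotheses (c1_gt0 : 0 < c1) (X0 : 0 < X) (c12 : c1 < c2) (kap0 : 0 < kap) (K0 : 0 <= K).
Hypothesis sg1 : sg = 1 \/ sg = -1.
Hypotheses (kK : forall t, `|k t| <= K) (kL : forall s t, `|k s - k t| <= K * `|s - t|).
Hypotheses (qL : forall s t, `|q s - q t| <= K * `|s - t|).
Hypotheses (mqd : measurable_fun setT qd).
Hypothesis qdK : forall t, c1 < t < c2 -> kap <= qd t <= K.
Hypothesis dk : forall t, c1 < t < c2 -> is_derive t 1 k (- k t ^+ 2).
Hypothesis dq : forall t, c1 < t < c2 -> is_derive t 1 q (qd t).

(** Under [k' = - k ^ 2] the parabola solves [phi_t + phi_x ^ 2 / 2 = 0]. The margin [q], with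
    [q' >= kap > 0], makes it a strict subsolution for [sg = 1] and a strict supersolution for
    [sg = -1]. *)
Definition bphi x t := m + k t * (x - x0) ^+ 2 / 2 - sg * q t.
Definition bphit x t := - (k t ^+ 2 * (x - x0) ^+ 2 / 2) - sg * qd t.
(** The slope of the parabola solves Burgers' equation, [bwt + bw * bwx = 0], which is what lets it
    serve as the reference state of a relative entropy. *)
Definition bw x t := k t * (x - x0).
Definition bwt x t := - k t ^+ 2 * (x - x0).
Definition bwx (x t : R) := k t.

Let Z := gap U bphi sg X c1 c2.

Hypothesis bd : forall x t, `|x| <= X -> c1 <= t <= c2 ->
  [|| `|x| == X, t == c1 | t == c2] -> sg * (bphi x t - U x t) <= 0.
Hypothesis small : forall x t, box X c1 c2 x t -> `|k t| * Z x t <= qd t.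

Let Y := X + `|x0|.
Let Y0 : 0 <= Y. Proof. by rewrite addr_ge0// ltW. Qed.
Let xY x : `|x| <= X -> `|x - x0| <= Y.
Proof. by move=> h; rewrite (le_trans (ler_normB _ _))// lerD2r. Qed.

Let sgN : `|sg| = 1. Proof. by case: sg1 => ->; rewrite ?normrN normr1. Qed.
Let sg2 : sg * sg = 1. Proof. by case: sg1 => ->; rewrite ?mulrNN mulr1. Qed.

Let mk : measurable_fun setT k.
Proof. apply: continuous_measurable_fun; exact: lip_cont kL. Qed.
Let mq : measurable_fun setT q.
Proof. apply: continuous_measurable_fun; exact: lip_cont qL. Qed.
Let m_t (f : R -> R) : measurable_fun setT f -> mf2 (fun _ t => f t).
Proof. by move=> mf; apply: (measurableT_comp mf); exact: measurable_snd. Qed.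
Let m_x : @mf2 R (fun x _ => x - x0).
Proof. by apply: measurable_funB => //; exact: measurable_fst. Qed.

Let mphi : mf2 bphi.
Proof.
apply: measurable_funB.
  apply: measurable_funD => //; apply: measurable_funM => //.
  by apply: measurable_funM; [exact: m_t|apply: measurable_funX; exact: m_x].
by apply: measurable_funM => //; exact: m_t.
Qed.
Let mphit : mf2 bphit.
Proof.
apply: measurable_funB.
  apply: measurableT_comp => //; apply: measurable_funM => //.
  by apply: measurable_funM; apply: measurable_funX; [exact: (m_t mk)|exact: m_x].
by apply: measurable_funM => //; exact: m_t.
Qed.
Let mw : mf2 bw.
Proof. by apply: measurable_funM; [exact: m_t|exact: m_x]. Qed.
Let mwt : mf2 bwt.
Proof.
apply: measurable_funM; last exact: m_x.
by apply: measurableT_comp => //; apply: measurable_funX; exact: (m_t mk).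
Qed.
Let mwx : mf2 bwx. Proof. exact: m_t. Qed.

Let sqY x : `|x| <= X -> (x - x0) ^+ 2 <= Y ^+ 2.
Proof.
move=> h; rewrite -[leLHS]ger0_norm ?sqr_ge0// normrX.
by apply: lerXn2r; rewrite ?nnegrE// xY.
Qed.

Let L := K * Y ^+ 2 + K * Y + K + MU.
Let p1 : 0 <= K * Y ^+ 2. Proof. by rewrite mulr_ge0// sqr_ge0. Qed.
Let p2 : 0 <= K * Y. Proof. by rewrite mulr_ge0. Qed.
Let L0 : 0 <= L. Proof. by rewrite !addr_ge0. Qed.

Let LE z : L * z = K * Y ^+ 2 * z + K * Y * z + K * z + MU * z.
Proof. by rewrite /L !mulrDl. Qed.

Let GLt x s t : `|x| <= X -> c1 <= s <= c2 -> c1 <= t <= c2 ->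
  `|sg * (bphi x s - U x s) - sg * (bphi x t - U x t)| <= L * `|s - t|.
Proof.
move=> hx _ _; rewrite -mulrBr normrM sgN mul1r /bphi.
have -> : m + k s * (x - x0) ^+ 2 / 2 - sg * q s - U x s - (m + k t * (x - x0) ^+ 2 / 2 - sg * q t - U x t) =
  (k s - k t) * ((x - x0) ^+ 2 / 2) - sg * (q s - q t) - (U x s - U x t) by ring.
have h1 : `|(k s - k t) * ((x - x0) ^+ 2 / 2)| <= (K * Y ^+ 2) * `|s - t|.
  rewrite normrM [leRHS]mulrAC; apply: ler_pM => //.
  have q0 : 0 <= (x - x0) ^+ 2 / 2 by apply: divr_ge0 => //; exact: sqr_ge0.
  by rewrite (ger0_norm q0) ler_pdivrMr// (le_trans (sqY hx))// mulr_natr mulr2n lerDl sqr_ge0.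
have h2 : `|sg * (q s - q t)| <= K * `|s - t| by rewrite normrM sgN mul1r.
have h3 : `|U x s - U x t| <= MU * `|s - t|.
  by have := ULip x s x t; rewrite subrr normr0 add0r.
have h4 : 0 <= K * Y * `|s - t| by rewrite mulr_ge0.
apply: le_trans (ler_normB _ _) _.
apply: le_trans (lerD (ler_normB _ _) (lexx _)) _.
by rewrite LE; move: h1 h2 h3 h4; lra.
Qed.

Let GLx x y t : `|x| <= X -> `|y| <= X -> c1 <= t <= c2 ->
  `|sg * (bphi x t - U x t) - sg * (bphi y t - U y t)| <= L * `|x - y|.
Proof.
move=> hx hy _; rewrite -mulrBr normrM sgN mul1r /bphi.
have -> : m + k t * (x - x0) ^+ 2 / 2 - sg * q t - U x t - (m + k t * (y - x0) ^+ 2 / 2 - sg * q t - U y t) =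
  (k t * (((x - x0) + (y - x0)) / 2)) * (x - y) - (U x t - U y t) by field.
have h1 : `|(k t * (((x - x0) + (y - x0)) / 2)) * (x - y)| <= (K * Y) * `|x - y|.
  rewrite normrM ler_wpM2r// normrM ler_pM// normrM [`|2^-1|]ger0_norm// ler_pdivrMr//.
  by rewrite (le_trans (ler_normD _ _))// mulr_natr mulr2n lerD// xY.
have h3 : `|U x t - U y t| <= MU * `|x - y|.
  by have := ULip x t y t; rewrite subrr normr0 addr0.
have h4 : 0 <= K * Y ^+ 2 * `|x - y| by rewrite mulr_ge0.
have h5 : 0 <= K * `|x - y| by rewrite mulr_ge0.
apply: le_trans (ler_normB _ _) _.
by rewrite LE; move: h1 h3 h4 h5; lra.
Qed.

Let B := K ^+ 2 * Y ^+ 2 + K * Y + K.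
Let p3 : 0 <= K ^+ 2 * Y ^+ 2. Proof. by rewrite mulr_ge0// sqr_ge0. Qed.

Let k2 t : k t ^+ 2 <= K ^+ 2.
Proof.
rewrite -[leLHS]ger0_norm ?sqr_ge0// normrX.
by apply: lerXn2r; rewrite ?nnegrE// kK.
Qed.

Let boxx x t : box X c1 c2 x t -> `|x| <= X. Proof. by case/andP => /ltW. Qed.
Let boxt x t : box X c1 c2 x t -> c1 < t < c2. Proof. by case/andP. Qed.

Let Bt x t : box X c1 c2 x t -> `|bphit x t| <= B.
Proof.
move=> b; rewrite /bphit (le_trans (ler_normB _ _))// normrN [`|sg * _|]normrM sgN mul1r.
have h1 : `|k t ^+ 2 * (x - x0) ^+ 2 / 2| <= K ^+ 2 * Y ^+ 2.
  rewrite normrM [`|2^-1|]ger0_norm// ler_pdivrMr// normrM [`|k t ^+ 2|]ger0_norm ?sqr_ge0// [`|_ ^+ 2|]ger0_norm ?sqr_ge0//.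
  rewrite (le_trans (y := K ^+ 2 * Y ^+ 2))//; last by rewrite mulr_natr mulr2n lerDl.
  by rewrite ler_pM ?sqr_ge0// (sqY (boxx b)).
have /andP[h2 h3] := qdK (boxt b).
rewrite (ger0_norm (le_trans (ltW kap0) h2)).
by rewrite /B; have := p2; lra.
Qed.

Let Bw x t : box X c1 c2 x t -> `|bw x t| <= B.
Proof.
move=> b; rewrite /bw normrM (le_trans (y := K * Y))//.
  by rewrite ler_pM// xY// (boxx b).
by rewrite /B; have := p3; have := K0; lra.
Qed.

Let dY2 (x : R) : is_derive x 1 (fun x => (x - x0) ^+ 2 / 2) (x - x0).
Proof.
apply/is_deriveP => e e0; exists (2 * e) => [|h he]; first by rewrite mulr_gt0.
have -> : (x + h - x0) ^+ 2 / 2 - (x - x0) ^+ 2 / 2 - (x - x0) * h = h ^+ 2 / 2 by field.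
have q0 : 0 <= h ^+ 2 / 2 by apply: divr_ge0 => //; exact: sqr_ge0.
rewrite (ger0_norm q0) -[h ^+ 2]ger0_norm ?sqr_ge0// normrX expr2 mulrAC ler_wpM2r//.
by rewrite ler_pdivrMr// mulrC ltW.
Qed.

Let dphit x t : box X c1 c2 x t -> is_derive t 1 (bphi x) (bphit x t).
Proof.
move=> /boxt ht; have h1 := dk ht; have h2 := dq ht.
apply: (is_derive_cast (is_deriveB (is_deriveD (is_derive_cst m t (1 : R))
  (is_deriveZ ((x - x0) ^+ 2 / 2) h1)) (is_deriveZ sg h2))) => [y|].
  by rewrite /bphi ?fctE /= /GRing.scale/=; ring.
by rewrite /bphit /GRing.scale/=; ring.
Qed.

Let dphix x t : box X c1 c2 x t -> is_derive x 1 (fun x => bphi x t) (bw x t).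
Proof.
move=> _.
apply: (is_derive_cast (is_deriveB (is_deriveD (is_derive_cst m x (1 : R))
  (is_deriveZ (k t) (dY2 x))) (is_derive_cst (sg * q t) x (1 : R)))) => [y|].
  by rewrite /bphi ?fctE /= /GRing.scale/=; ring.
by rewrite /bw /GRing.scale/=; ring.
Qed.

Let H := K ^+ 2 * Y + K * Y + K.
Let p4 : 0 <= K ^+ 2 * Y. Proof. by rewrite mulr_ge0// sqr_ge0. Qed.

Let hH x t : box X c1 c2 x t -> [/\ `|bw x t| <= H, `|bwt x t| <= H & `|bwx x t| <= H].
Proof.
move=> b; have xy := xY (boxx b); have := p4; have := p2; have := K0 => q1 q2 q3; split.
- rewrite /bw normrM (le_trans (y := K * Y))//; first by rewrite ler_pM.
  by rewrite /H; lra.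
- rewrite /bwt normrM normrN (ger0_norm (sqr_ge0 _)) (le_trans (y := K ^+ 2 * Y))//.
    by rewrite ler_pM ?sqr_ge0.
  by rewrite /H; lra.
- by rewrite /bwx (le_trans (kK _))// /H; lra.
Qed.

Let hLt x s t : box X c1 c2 x s -> box X c1 c2 x t -> `|bw x s - bw x t| <= H * `|s - t|.
Proof.
move=> b _; rewrite /bw -mulrBl normrM (le_trans (y := (K * Y) * `|s - t|))//.
  by rewrite mulrAC ler_pM// xY// (boxx b).
by rewrite ler_wpM2r// /H; have := p4; have := K0; lra.
Qed.

Let hLx x y t : box X c1 c2 x t -> box X c1 c2 y t -> `|bw x t - bw y t| <= H * `|x - y|.
Proof.
move=> _ _; rewrite /bw -mulrBr normrM (_ : x - x0 - (y - x0) = x - y); last by ring.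
by rewrite ler_wpM2r// (le_trans (kK t))// /H; have := p4; have := p2; lra.
Qed.

Let dwt x t : box X c1 c2 x t -> is_derive t 1 (bw x) (bwt x t).
Proof.
move=> /boxt ht; have h1 := dk ht.
apply: (is_derive_cast (is_deriveZ (x - x0) h1)) => [y|].
  by rewrite /bw mulrC.
by rewrite /bwt /GRing.scale/=; ring.
Qed.

Let dwx x t : box X c1 c2 x t -> is_derive x 1 (fun x => bw x t) (bwx x t).
Proof.
move=> _; apply: (is_derive_cast (is_derive_affine (k t) (- (k t * x0)) x)) => // y.
by rewrite /bw mulrBr.
Qed.

(** The digit in the names below counts the factors [bw] multiplied onto [P0]; the derivatives are
    kept in the shape produced by repeated use of [lip_test_mul]. *)
Let P0 x t := Z x t ^+ 2 / 2.
Let P0t x t := Z x t * (sg * (bphit x t + v x t ^+ 2 / 2)).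
Let P0x x t := Z x t * (sg * (bw x t - v x t)).
Let P1t x t := bwt x t * P0 x t + bw x t * P0t x t.
Let P1x x t := bwx x t * P0 x t + bw x t * P0x x t.
Let P2t x t := bwt x t * (bw x t * P0 x t) + bw x t * P1t x t.
Let P2x x t := bwx x t * (bw x t * P0 x t) + bw x t * P1x x t.
Let P3t x t := bwt x t * (bw x t * (bw x t * P0 x t)) + bw x t * P2t x t.
Let P3x x t := bwx x t * (bw x t * (bw x t * P0 x t)) + bw x t * P2x x t.

Let c1f (c : R) : @mf2 R (fun _ _ => c). Proof. exact: measurable_cst. Qed.
Let MM := 1 + M + M ^+ 2 + M ^+ 3.
Let mv2 : mf2 (fun x t => v x t ^+ 2 / 2).
Proof. by apply: measurable_funM => //; exact: measurable_funX. Qed.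
Let mv3 : mf2 (fun x t => v x t ^+ 3 / 3).
Proof. by apply: measurable_funM => //; exact: measurable_funX. Qed.
Let vn n : 0 <= M ^+ n. Proof. exact: exprn_ge0. Qed.
Let b0 : forall x t : R, `|0 : R| <= MM.
Proof. by move=> x t; rewrite normr0 /MM !addr_ge0. Qed.
Let b1 : forall x t : R, `|1 : R| <= MM.
Proof. by move=> x t; rewrite normr1 /MM -!addrA lerDl !addr_ge0. Qed.
Let bv x t : `|v x t| <= MM.
Proof. by rewrite (le_trans (vM x t))// /MM; have := vn 2; have := vn 3; lra. Qed.
Let bv2 x t : `|v x t ^+ 2 / 2| <= MM.
Proof.
rewrite normrM normrX [`|2^-1|]ger0_norm//.
have h : `|v x t| ^+ 2 <= M ^+ 2 by apply: lerXn2r; rewrite ?nnegrE.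
by rewrite /MM; have := vn 2; have := vn 3; have := M0; lra.
Qed.
Let bv3 x t : `|v x t ^+ 3 / 3| <= MM.
Proof.
rewrite normrM normrX [`|3^-1|]ger0_norm//.
have h : `|v x t| ^+ 3 <= M ^+ 3 by apply: lerXn2r; rewrite ?nnegrE.
by rewrite /MM; have := vn 2; have := vn 3; have := M0; lra.
Qed.

(** The aim is that [Z] has nonpositive integral; being Lipschitz and nonnegative it then vanishes.
    The identity for [T1] bounds the integral of [Z] by that of [Z * (v - w) ^ 2]. For [sg = -1]
    that term already has the good sign; for [sg = 1] it is eliminated by the entropy inequality.
    The hypothesis [small] absorbs the curvature terms, which are quadratic in [Z]. *)
Lemma comparison_core x t : box X c1 c2 x t -> sg * (bphi x t - U x t) <= 0.
Proof.
have mZ : mf2 Z := mf2_gap potential_mf2 sg X c1 c2 mphi.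
have [L1 lt0] := @gap_lip_test R U v M mv potential_mf2 vM Ux Ut bphi bphit bw sg X c1 c2 B L
  mphi mphit mw c1_gt0 L0 X0 c12 sgN GLt GLx bd Bt Bw dphit dphix.
have [L2 lt1] := lip_test_mul lt0 mw mwt mwx hH hLt hLx dwt dwx.
have [L3 lt2] := lip_test_mul lt1 mw mwt mwx hH hLt hLx dwt dwx.
have [L4 lt3] := lip_test_mul lt2 mw mwt mwx hH hLt hLx dwt dwx.
have e1 := lip_test_eq0 lt0 (c1f 1) b1 (c1f 0) b0 (fun n x t _ => pair_test10 n x t).
have e2 := lip_test_eq0 lt1 (c1f 0) b0 (c1f 1) b1 (fun n x t _ => pair_test01 n x t).
have e3 := lip_test_eq0 lt1 mv bv mv2 bv2 cons.
have e4 := lip_test_eq0 lt2 (c1f 1) b1 (c1f 0) b0 (fun n x t _ => pair_test10 n x t).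
have e5 := lip_test_eq0 lt3 (c1f 0) b0 (c1f 1) b1 (fun n x t _ => pair_test01 n x t).
have P0_ge0 y s : 0 <= P0 y s by rewrite /P0 mulr_ge0// sqr_ge0.
have e6 := lip_test_ge0 lt0 mv2 bv2 mv3 bv3 ent P0_ge0.
have f1 := lip_bcs2e lt0 (c1f 1) b1 (c1f 0) b0.
have f2 := lip_bcs2e lt1 (c1f 0) b0 (c1f 1) b1.
have f3 := lip_bcs2e lt1 mv bv mv2 bv2.
have f4 := lip_bcs2e lt2 (c1f 1) b1 (c1f 0) b0.
have f5 := lip_bcs2e lt3 (c1f 0) b0 (c1f 1) b1.
have f6 := lip_bcs2e lt0 mv2 bv2 mv3 bv3.
have Zge0 y s : 0 <= Z y s by exact: gap_ge0.
have ZLt y s r : `|Z y s - Z y r| <= L * `|s - r|.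
  exact: (@gap_lip_t _ U bphi sg X c1 c2 L L0 c12 GLt bd).
have ZLx y z s : `|Z y s - Z z s| <= L * `|y - z|.
  exact: (@gap_lip_x _ U bphi sg X c1 c2 L L0 X0 GLx bd).
have bZ : bcs2 Z.
  apply: (@box_bcs2 _ X c1 c2 (L * (c2 - c1))).
  - exact: mZ.
  - by move=> y s; exact: (gap_norm L0 c12 GLt bd).
  - by move=> y s; exact: gap_out.
pose vv y s := v y s - bw y s.
(* This is [P0_t + (bw * P0)_x], the transport of [P0] along the characteristics of the parabola,
   after completing the square in [v]. *)
pose T1 y s := Z y s * (- qd s + sg * vv y s ^+ 2 / 2) + k s * Z y s ^+ 2 / 2.
have bT1 : bcs2 T1 /\ I2 T1 = 0.
  have E : T1 = (fun x t => (1 * P0t x t + 0 * P0x x t) + (0 * P1t x t + 1 * P1x x t)).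
    apply/funext => y; apply/funext => s; rewrite /T1 /P1x /P0t /P0x /P0 /bphit /bwx /vv.
    have -> : k s ^+ 2 * (y - x0) ^+ 2 = bw y s ^+ 2 by rewrite /bw exprMn.
    rewrite mul0r addr0 mul0r add0r !mul1r.
    have -> : Z y s * (sg * (- (bw y s ^+ 2 / 2) - sg * qd s + v y s ^+ 2 / 2)) =
      Z y s * (sg * (- (bw y s ^+ 2 / 2) + v y s ^+ 2 / 2) - (sg * sg) * qd s) by ring.
    by rewrite sg2; field.
  by rewrite E; split; [exact: bcs2D f1 f2|rewrite I2_D// e1 e2 addr0].
have I2Z_le0 : I2 Z <= 0.
  have kin y s : box X c1 c2 y s -> `|k s| * Z y s <= qd s /\ kap <= qd s.
    by move=> b; split; [exact: small|case/andP: (qdK (boxt b))].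
  have Zo y s : ~~ box X c1 c2 y s -> Z y s = 0 by exact: gap_out.
  have kZ y s : box X c1 c2 y s -> k s * Z y s <= qd s /\ - (k s * Z y s) <= qd s.
    move=> b; have [h _] := kin y s b.
    have h1 := ler_norm (k s); have h2 := ler_norm (- k s); rewrite normrN in h2.
    split; [|rewrite -mulNr]; apply: le_trans h; by rewrite ler_wpM2r.
  case: sg1 => sgE.
  (* The relative entropy [v ^ 2 / 2 - w * v + w ^ 2 / 2] with its flux
     [v ^ 3 / 3 - w * v ^ 2 / 2 + w ^ 3 / 6], where the powers of [w] have been put on the test
     function. Hence the weights 1/2 and 1/6 of the exact terms. *)
  - pose S y s := (v y s ^+ 2 / 2 * P0t y s + v y s ^+ 3 / 3 * P0x y s)
      - (v y s * P1t y s + v y s ^+ 2 / 2 * P1x y s)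
      + 2^-1 * (1 * P2t y s + 0 * P2x y s) + 6^-1 * (0 * P3t y s + 1 * P3x y s).
    have bS : bcs2 S.
      by apply: bcs2D; [apply: bcs2D; [exact: bcs2B f6 f3|exact: bcs2Z f4]|exact: bcs2Z f5].
    have IS : 0 <= I2 S.
      rewrite /S I2_D; [|apply: bcs2D; [exact: bcs2B f6 f3|exact: bcs2Z f4]|exact: bcs2Z f5].
      rewrite I2_D; [|exact: bcs2B f6 f3|exact: bcs2Z f4].
      rewrite I2_B// (I2_Z _ f4) (I2_Z _ f5) e3 e4 e5 !mulr0 !addr0 subr0; exact: e6.
    have SE y s : S y s = - (Z y s * qd s * vv y s ^+ 2 / 2) - Z y s * vv y s ^+ 4 / 12
        - k s * vv y s ^+ 2 * Z y s ^+ 2 / 4.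
      rewrite /S /P3x /P2t /P2x /P1t /P1x /P0t /P0x /P0 /bphit /bwx /vv sgE /bwt /bw.
      by field.
    have bZv : bcs2 (fun y s => Z y s * vv y s ^+ 2).
      have mZv : mf2 (fun y s => Z y s * vv y s ^+ 2).
        apply: measurable_funM; first by case: bZ.
        by apply: measurable_funX; exact: measurable_funB.
      apply: (box_bcs2 (X := X) (c1 := c1) (c2 := c2) (L := L * (c2 - c1) * (M + B) ^+ 2)) => //.
        move=> y s; have [b|/Zo ->] := boolP (box X c1 c2 y s); last first.
          have q0 : 0 <= L * (c2 - c1) by rewrite mulr_ge0// subr_ge0 ltW.
          by rewrite mul0r normr0; apply: mulr_ge0 => //; exact: sqr_ge0.
        rewrite normrM ler_pM//; first exact: (gap_norm L0 c12 GLt bd).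
        have q0 : 0 <= B := le_trans (normr_ge0 _) (Bw b).
        rewrite normrX; apply: lerXn2r; rewrite ?nnegrE//; first exact: addr_ge0.
        by rewrite (le_trans (ler_normB _ _))// lerD// Bw.
      by move=> y s /Zo ->; rewrite mul0r.
    have h1 : I2 S <= - (kap / 4) * I2 (fun y s => Z y s * vv y s ^+ 2).
      rewrite -(I2_Z (- (kap / 4)) bZv); apply: (I2_le bS (bcs2Z (- (kap / 4)) bZv)).
      move=> y s; rewrite SE; have [b|nb] := boolP (box X c1 c2 y s).
        have [_ q2] := kin y s b; have [_ q4] := kZ y s b.
        exact: core_ineq1.
      by rewrite (Zo _ _ nb) expr0n /= !(mul0r, mulr0, subr0, oppr0).
    have h2 : I2 (fun y s => Z y s * vv y s ^+ 2) <= 0.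
      have := le_trans IS h1; rewrite mulNr oppr_ge0 pmulr_rle0//.
      by rewrite divr_gt0.
    have h3 : I2 T1 <= I2 (fun y s => 2^-1 * (Z y s * vv y s ^+ 2) - (kap / 2) * Z y s).
      apply: (I2_le bT1.1 (bcs2B (bcs2Z 2^-1 bZv) (bcs2Z (kap / 2) bZ))).
      move=> y s; rewrite /T1 sgE; have [b|nb] := boolP (box X c1 c2 y s).
        have [_ q2] := kin y s b; have [q3 _] := kZ y s b.
        exact: core_ineq2.
      by rewrite (Zo _ _ nb) expr0n /= !(mul0r, mulr0, subr0, addr0).
    move: h3; rewrite bT1.2 (I2_B (bcs2Z 2^-1 bZv) (bcs2Z (kap / 2) bZ)).
    rewrite (I2_Z _ bZv) (I2_Z _ bZ) subr_ge0 => h3.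
    rewrite -(pmulr_rle0 _ (_ : 0 < kap / 2)); last by rewrite divr_gt0.
    by rewrite (le_trans h3)// pmulr_rle0.
  - have h3 : I2 T1 <= I2 (fun y s => - (kap / 2) * Z y s).
      apply: (I2_le bT1.1 (bcs2Z (- (kap / 2)) bZ)).
      move=> y s; rewrite /T1 sgE; have [b|nb] := boolP (box X c1 c2 y s).
        have [_ q2] := kin y s b; have [q3 _] := kZ y s b.
        exact: core_ineq3.
      by rewrite (Zo _ _ nb) expr0n /= !(mul0r, mulr0, addr0).
    move: h3; rewrite bT1.2 (I2_Z _ bZ) mulNr oppr_ge0 pmulr_rle0//.
    by rewrite divr_gt0.
move=> b; rewrite leNgt; apply/negP => h.
have Zp : 0 < Z x t by rewrite /Z /gap b lt_max h.
by have := I2_gt0 bZ Zge0 L0 ZLt ZLx Zp; rewrite ltNge I2Z_le0.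
Qed.

End core.

(** * Coefficients frozen outside a time interval *)

Section clamp.
Context {R : realType}.

Definition clamp (a b t : R) := Num.max a (Num.min t b).

Lemma clamp_id (a b t : R) : a <= t <= b -> clamp a b t = t.
Proof. by move=> /andP[h1 h2]; rewrite /clamp (min_idPl h2) (max_idPr h1). Qed.

Lemma clamp_in (a b t : R) : a <= b -> a <= clamp a b t <= b.
Proof. by move=> ab; rewrite /clamp le_max lexx/= ge_max ab/= ge_min lexx orbT. Qed.

Lemma clamp_lip (a b s t : R) : a <= b -> `|clamp a b s - clamp a b t| <= `|s - t|.
Proof.
move=> ab; rewrite /clamp.
have [h1|h1] := leP s b; have [h2|h2] := leP t b.
- have [h3|h3] := leP a s; have [h4|h4] := leP a t; rewrite ?lexx//.
  + by rewrite !ger0_norm; lra.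
  + by rewrite !ler0_norm; lra.
  + by rewrite subrr normr0.
- have [h3|h3] := leP a s; have [h4|h4] := leP a b; try lra.
  + by rewrite !ler0_norm; lra.
  + by rewrite !ler0_norm; lra.
- have [h3|h3] := leP a b; have [h4|h4] := leP a t; try lra.
  + by rewrite !ger0_norm; lra.
  + by rewrite !ger0_norm; lra.
- by rewrite subrr normr0.
Qed.

Lemma is_derive_clamp (f : R -> R) (a b t l : R) : a < t < b -> is_derive t 1 f l ->
  is_derive t 1 (fun t => f (clamp a b t)) l.
Proof.
move=> /andP[h1 h2]; apply: (@is_derive_near _ _ _ _ _ (Num.min (t - a) (b - t))).
  by rewrite lt_min !subr_gt0 h1 h2.
move=> y; rewrite lt_min !ltr_norml => /andP[/andP[y1 y2] /andP[y3 y4]].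
by rewrite clamp_id//; apply/andP; split; lra.
Qed.

Lemma inv_lip (x y c : R) : 0 < c -> c <= x -> c <= y -> `|x^-1 - y^-1| <= c ^- 2 * `|x - y|.
Proof.
move=> c0 cx cy; have x0 := lt_le_trans c0 cx; have y0 := lt_le_trans c0 cy.
have -> : x^-1 - y^-1 = (x^-1 * y^-1) * (y - x) by field; rewrite !gt_eqF.
rewrite normrM distrC ler_wpM2r// ger0_norm ?mulr_ge0 ?invr_ge0 ?(ltW x0) ?(ltW y0)//.
by rewrite -exprVn expr2 ler_pM ?invr_ge0 ?(ltW x0) ?(ltW y0)// lef_pV2 ?posrE.
Qed.

Lemma is_derive_inv_affine (c d t : R) : c * t + d != 0 ->
  is_derive t 1 (fun t => (c * t + d)^-1) (- c * (c * t + d)^-1 ^+ 2).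
Proof.
move=> h.
have dV : is_derive (c * t + d) 1 (fun z : R => z^-1) (- ((c * t + d) ^- 2)).
  move: h; move: (c * t + d) => z z0.
  have := is_deriveV z0 (is_derive_id z (1 : R)).
  by rewrite /GRing.scale/= mulr1.
apply: (is_derive_cast (is_derive_aff dV)) => //.
by rewrite exprVn; ring.
Qed.

End clamp.

(** * Comparison with a parabola on a strip of times *)

Section hopf_lax.
Context {R : realType}.
Local Notation mu := (@lebesgue_measure R).
Variables (U v : R -> R -> R) (M MU : R).
Hypothesis (mv : mf2 v) (vM : forall x t, `|v x t| <= M).
Hypothesis ULip : forall x t y s, `|U x t - U y s| <= MU * (`|x - y| + `|t - s|).
Hypothesis Ux : {ae mu, forall t, 0 < t -> {ae mu, forall x : R, is_derive x 1 (fun x => U x t) (v x t)}}.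
Hypothesis Ut : {ae mu, forall x, {ae mu, forall t : R, 0 < t -> is_derive t 1 (U x) (- (v x t ^+ 2 / 2))}}.
Hypothesis cons : forall n x t, n.+1%:R^-1 < t -> pair_test n v (fun x t => v x t ^+ 2 / 2) x t = 0.
Hypothesis ent : forall n x t, n.+1%:R^-1 < t ->
  0 <= pair_test n (fun x t => v x t ^+ 2 / 2) (fun x t => v x t ^+ 3 / 3) x t.

Let MU0 : 0 <= MU.
Proof. by have := le_trans (normr_ge0 _) (ULip 0 0 1 0); rewrite sub0r normrN normr1 subrr normr0 addr0 mulr1. Qed.

(* The gap is pushed down by steps of [eps] small enough for [comparison_core]
   to apply, until it reaches [0]. *)
Lemma gap_descent (k q qd : R -> R) (x0 m sg K kap X c1 c2 N : R) :
  0 < c1 -> 0 < X -> c1 < c2 -> 0 < kap -> 0 <= K -> sg = 1 \/ sg = -1 ->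
  (forall t, `|k t| <= K) -> (forall s t, `|k s - k t| <= K * `|s - t|) ->
  (forall s t, `|q s - q t| <= K * `|s - t|) -> measurable_fun setT qd ->
  (forall t, c1 < t < c2 -> kap <= qd t <= K) ->
  (forall t, c1 < t < c2 -> is_derive t 1 k (- k t ^+ 2)) ->
  (forall t, c1 < t < c2 -> is_derive t 1 q (qd t)) ->
  (forall x t, `|x| <= X -> c1 <= t <= c2 -> [|| `|x| == X, t == c1 | t == c2] ->
    sg * (m + k t * (x - x0) ^+ 2 / 2 - U x t) - q t <= 0) ->
  (forall x t, box X c1 c2 x t -> sg * (m + k t * (x - x0) ^+ 2 / 2 - U x t) - q t <= N) ->
  forall x t, box X c1 c2 x t -> sg * (m + k t * (x - x0) ^+ 2 / 2 - U x t) - q t <= 0.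
Proof.
move=> c10 X0 c12 kap0 K0 sg1 kK kL qL mqd qdK dk dq bd HN.
(* Since [|k| <= K], a gap of at most [eps] satisfies [|k| * gap <= kap <= qd], the smallness
   required by [comparison_core]. *)
pose eps := kap / (K + 1).
have e0 : 0 < eps by rewrite divr_gt0// ltr_pwDr.
have Ke : K * eps <= kap.
  rewrite (le_trans (y := (K + 1) * eps))//; first by rewrite ler_wpM2r ?(ltW e0)// lerDl.
  by rewrite mulrC divfK// gt_eqF// ltr_pwDr.
have sg2 : sg * sg = 1 by case: sg1 => ->; rewrite ?mulrNN mulr1.
have bE lam x t : sg * (bphi k q x0 (m - sg * lam) sg x t - U x t) =
    sg * (m + k t * (x - x0) ^+ 2 / 2 - U x t) - q t - lam.
  rewrite /bphi.
  have -> : sg * (m - sg * lam + k t * (x - x0) ^+ 2 / 2 - sg * q t - U x t) =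
    sg * (m + k t * (x - x0) ^+ 2 / 2 - U x t) - (sg * sg) * q t - (sg * sg) * lam by ring.
  by rewrite sg2 !mul1r.
(* The constant [m] is shifted by [n * eps] against the sign of the gap. A bound by [(n + 1) * eps]
   then leaves a gap of at most [eps], and the comparison removes it. *)
have step (n : nat) :
  (forall x t, box X c1 c2 x t -> sg * (m + k t * (x - x0) ^+ 2 / 2 - U x t) - q t <= n.+1%:R * eps) ->
  forall x t, box X c1 c2 x t -> sg * (m + k t * (x - x0) ^+ 2 / 2 - U x t) - q t <= n%:R * eps.
  move=> H x t b.
  have lam0 : 0 <= n%:R * eps by rewrite mulr_ge0// ltW.
  have := @comparison_core R U v M MU mv vM ULip Ux Ut cons ent k q qd x0 (m - sg * (n%:R * eps)) sg K kap X c1 c2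
    c10 X0 c12 kap0 K0 sg1 kK kL qL mqd qdK dk dq _ _ x t b.
  rewrite bE => h; rewrite -subr_le0; apply: h.
    by move=> y s hy hs he; rewrite bE; have := bd y s hy hs he; lra.
  move=> y s b'; have /andP[h1 _] := qdK s (proj2 (andP b')).
  apply: le_trans h1; apply: le_trans Ke; apply: ler_pM => //; first exact: gap_ge0.
  rewrite /gap b' ge_max (ltW e0) andbT bE.
  have := H y s b'; rewrite -[n.+1]addn1 natrD mulrDl mul1r; lra.
have [n hn] : exists n : nat, N <= n%:R * eps.
  exists (Num.bound `|N / eps|); have h := archi_boundP (normr_ge0 (N / eps)).
  by rewrite -ler_pdivrMr// (le_trans (ler_norm _))// ltW.
have {}HN x t : box X c1 c2 x t -> sg * (m + k t * (x - x0) ^+ 2 / 2 - U x t) - q t <= n%:R * eps.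
  by move=> b; apply: le_trans hn; exact: HN.
elim: n HN {hn} => [|n IH] HN x t b; first by have := HN x t b; rewrite mul0r.
by apply: IH => // y s; exact: step.
Qed.

(** The curvature may blow up at either end of the strip, and at the end [T] only the crude bound
    [C * (t - s)] is known. The margin [kp / (T - t)], infinite at [T], supplies the missing
    boundary inequality; near [s] the crude bound is itself small. *)
Lemma strip_le (k : R -> R) (x0 m sg s T X0 C : R) : 0 <= s -> s < T -> sg = 1 \/ sg = -1 ->
  (forall t, s < t < T -> is_derive t 1 k (- k t ^+ 2)) ->
  (forall c1 c2, s < c1 -> c1 < c2 -> c2 < T -> exists2 K, 0 <= K & forall a b, c1 <= a <= c2 -> c1 <= b <= c2 ->
     `|k a| <= K /\ `|k a - k b| <= K * `|a - b|) ->
  (forall x t, s < t < T -> sg * (m + k t * (x - x0) ^+ 2 / 2 - U x t) <= C * (t - s)) ->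
  (forall x t, s < t < T -> X0 <= `|x| -> sg * (m + k t * (x - x0) ^+ 2 / 2 - U x t) <= 0) ->
  forall x t, s < t < T -> sg * (m + k t * (x - x0) ^+ 2 / 2 - U x t) <= 0.
Proof.
move=> s0 sT sg1 dk hK HC HX x t /andP[st tT].
rewrite leNgt; apply/negP; set a := (X in 0 < X) => a0.
have C0 : 0 < C.
  have h : a <= C * (t - s) by apply: HC; rewrite st.
  have h2 := lt_le_trans a0 h; move: h2; rewrite pmulr_lgt0// subr_gt0//.
(* With [a] the supposed positive excess at [(x, t)], the margin at time [t] equals [a / 2], so the
   comparison will yield [a <= a / 2]. *)
pose kp := a * (T - t) / 2.
have kp0 : 0 < kp by rewrite divr_gt0// mulr_gt0// subr_gt0.
have Ts : 0 < T - s by rewrite subr_gt0.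
(* The first entry serves both ends: at [s + d] it gives [C * d <= kp / (T - s)], at [T - d] it
   gives [C * (T - s) <= kp / d]. The other two keep [t] inside. *)
pose d := Num.min (kp / (C * (T - s))) (Num.min ((t - s) / 2) ((T - t) / 2)).
have d0 : 0 < d.
  rewrite /d !lt_min; apply/and3P; split.
  - by apply: divr_gt0 => //; exact: mulr_gt0.
  - by apply: divr_gt0 => //; rewrite subr_gt0.
  - by apply: divr_gt0 => //; rewrite subr_gt0.
have d1 : C * d * (T - s) <= kp.
  have : d <= kp / (C * (T - s)) by rewrite /d ge_min lexx.
  by rewrite ler_pdivlMr ?mulr_gt0// mulrA [d * C]mulrC.
have d2 : d <= (t - s) / 2 by rewrite /d !ge_min lexx orbT.
have d3 : d <= (T - t) / 2 by rewrite /d !ge_min lexx !orbT.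
pose c1 := s + d; pose c2 := T - d.
have sc1 : s < c1 by rewrite /c1; lra.
have c2T : c2 < T by rewrite /c2; lra.
have c1t : c1 < t by rewrite /c1; lra.
have tc2 : t < c2 by rewrite /c2; lra.
have c12 : c1 < c2 by exact: lt_trans tc2.
have [K K0 HK] := hK _ _ sc1 c12 c2T.
pose X := Num.max (`|X0| + 1) (`|x| + 1).
have XX0 : 0 < X by rewrite /X lt_max ltr_pwDr.
(* [gap_descent] asks for bounds on curvature and margin at all times; composing with the clamp
   provides them without changing anything on [[c1, c2]]. *)
pose cl := clamp c1 c2.
have clin y : c1 <= cl y <= c2 by apply: clamp_in; exact: ltW.
have cllip y z : `|cl y - cl z| <= `|y - z| by apply: clamp_lip; exact: ltW.
pose r y := (T - cl y)^-1.
have rd y : d <= T - cl y by have /andP[_] := clin y; rewrite /c2; lra.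
have rpos y : 0 < T - cl y by exact: lt_le_trans (rd y).
have rle y : r y <= d^-1 by rewrite /r lef_pV2 ?posrE.
have rge y : (T - s)^-1 <= r y.
  by rewrite /r lef_pV2 ?posrE// lerD2l lerN2; have /andP[h _] := clin y; apply: le_trans h; exact: ltW.
have r0 y : 0 < r y by rewrite /r invr_gt0.
have rlip y z : `|r y - r z| <= d ^- 2 * `|y - z|.
  rewrite (le_trans (inv_lip d0 (rd y) (rd z)))// ler_wpM2l ?invr_ge0 ?exprn_ge0 ?(ltW d0)//.
  have -> : T - cl y - (T - cl z) = cl z - cl y by ring.
  by rewrite distrC.
pose K' := K + kp * d ^- 2.
have D20 : 0 <= d ^- 2 by rewrite invr_ge0 exprn_ge0// ltW.
have KK' : K <= K' by rewrite /K' lerDl mulr_ge0// ltW.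
have KK'' : kp * d ^- 2 <= K' by rewrite /K' lerDr.
have K'0 : 0 <= K' := le_trans K0 KK'.
have mcl : measurable_fun setT r.
  apply: continuous_measurable_fun; exact: (lip_cont D20).
have c1_gt0 : 0 < c1 by exact: le_lt_trans sc1.
pose kap := kp * (T - s)^-1 ^+ 2.
have kap0 : 0 < kap by rewrite mulr_gt0// exprn_gt0// invr_gt0.
have H1 y : `|k (cl y)| <= K'.
  by apply: le_trans KK'; have [] := HK _ _ (clin y) (clin y).
have H2 y z : `|k (cl y) - k (cl z)| <= K' * `|y - z|.
  have [_ h] := HK _ _ (clin y) (clin z).
  by apply: (le_trans h); apply: ler_pM.
have H3 y z : `|kp * r y - kp * r z| <= K' * `|y - z|.
  rewrite -mulrBr normrM (gtr0_norm kp0).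
  apply: (@le_trans _ _ (kp * d ^- 2 * `|y - z|)); last by apply: ler_wpM2r.
  by rewrite -mulrA ler_wpM2l// ltW.
have H4 : measurable_fun setT (fun y => kp * r y ^+ 2).
  by apply: measurable_funM => //; exact: measurable_funX.
have H5 y : c1 < y < c2 -> kap <= kp * r y ^+ 2 <= K'.
  have r0' := ltW (r0 y).
  move=> _; apply/andP; split.
    rewrite ler_pM2l//; apply: lerXn2r (rge y) => //.
    by rewrite nnegrE invr_ge0 ltW.
  apply: le_trans KK''; rewrite ler_pM2l// -exprVn.
  apply: lerXn2r (rle y) => //.
  by rewrite nnegrE invr_ge0 ltW.
have H6 y : c1 < y < c2 -> is_derive y 1 (fun y => k (cl y)) (- k (cl y) ^+ 2).
  move=> hy; have /andP[y1 y2] := hy.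
  rewrite [in X in is_derive _ _ _ X]/cl clamp_id ?(ltW y1) ?(ltW y2)//.
  apply: is_derive_clamp => //.
  by apply: dk; rewrite (lt_trans sc1 y1) (lt_trans y2 c2T).
have H7 y : c1 < y < c2 -> is_derive y 1 (fun y => kp * r y) (kp * r y ^+ 2).
  move=> hy; have /andP[y1 y2] := hy.
  have hn : (-1) * y + T != 0 by rewrite mulN1r addrC gt_eqF// subr_gt0 (lt_trans y2).
  have dr := is_derive_clamp hy (is_derive_inv_affine hn).
  apply: (is_derive_cast (is_deriveZ kp dr)) => [z|].
    have e1 w : T - w = -1 * w + T by rewrite mulN1r addrC.
    by rewrite /r /cl e1.
  rewrite /GRing.scale/= /r /cl clamp_id ?(ltW y1) ?(ltW y2)// mulN1r [- y + T]addrC.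
  by rewrite opprK mul1r.
have H8 y z : `|y| <= X -> c1 <= z <= c2 -> [|| `|y| == X, z == c1 | z == c2] ->
    sg * (m + k (cl z) * (y - x0) ^+ 2 / 2 - U y z) - kp * r z <= 0.
  move=> hy hz; have clz : cl z = z by rewrite /cl clamp_id.
  rewrite clz => he.
  have hz' : s < z < T by case/andP: hz => z1 z2; rewrite (lt_le_trans sc1 z1)/=; exact: le_lt_trans c2T.
  have rz : r z = (T - z)^-1 by rewrite /r clz.
  rewrite subr_le0; case/or3P: he => /eqP he.
  - apply: (@le_trans _ _ 0); last by rewrite mulr_ge0// ltW.
    apply: (HX y z hz'); rewrite he /X le_max (le_trans (ler_norm X0))// lerDl ler01 //.
  - apply: (le_trans (HC y z hz')); rewrite he (_ : c1 - s = d); last by rewrite /c1 addrC addKr.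
    apply: (@le_trans _ _ (kp * (T - s)^-1)); last by rewrite ler_pM2l.
    by rewrite ler_pdivlMr.
  - apply: (le_trans (HC y z hz')); rewrite rz he (_ : T - c2 = d); last by rewrite /c2 opprB addrC subrK.
    rewrite ler_pdivlMr//; apply: le_trans d1; rewrite mulrAC ler_pM2l ?mulr_gt0//.
    by rewrite /c2; lra.
have H9 y z : box X c1 c2 y z ->
    sg * (m + k (cl z) * (y - x0) ^+ 2 / 2 - U y z) - kp * r z <= C * (T - s).
  move=> /andP[_ hz]; have /andP[z1 z2] := hz.
  have clz : cl z = z by rewrite /cl clamp_id// (ltW z1) (ltW z2).
  have hz' : s < z < T by rewrite (lt_trans sc1 z1)/=; exact: lt_trans c2T.
  rewrite clz; apply: (@le_trans _ _ (C * (z - s))).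
    by rewrite lerBlDr (le_trans (HC y z hz'))// lerDl mulr_ge0// ltW.
  by rewrite ler_pM2l// lerD2r ltW//; case/andP: hz'.
have bx : box X c1 c2 x t.
  by rewrite /box c1t tc2 andbT /X lt_max ltrDl ltr01 orbT.
have bnd : sg * (m + k (cl t) * (x - x0) ^+ 2 / 2 - U x t) - kp * r t <= 0 :=
  gap_descent c1_gt0 XX0 c12 kap0 K'0 sg1 H1 H2 H3 H4 H5 H6 H7 H8 H9 bx.
move: bnd; rewrite /cl clamp_id ?(ltW c1t) ?(ltW tc2)// -/a.
have -> : kp * r t = a / 2.
  rewrite /r /cl clamp_id ?(ltW c1t) ?(ltW tc2)// /kp.
  by field; rewrite gt_eqF// subr_gt0.
lra.
Qed.

End hopf_lax.

(** * Hopf-Lax bounds, semiconcavity and Oleinik's estimate *)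

Section semiconcavity.
Context {R : realType}.
Local Notation mu := (@lebesgue_measure R).

Lemma quad_mono (a b z : R) : a <= b -> a * z ^+ 2 / 2 <= b * z ^+ 2 / 2.
Proof. by move=> ab; rewrite ler_pM2r ?invr_gt0// ler_wpM2r ?sqr_ge0. Qed.

Lemma quad_dominates (T A B d : R) : 0 < T -> 0 <= A -> 0 <= B -> 1 + 2 * T * (B + A) <= d ->
  A + B * d <= T^-1 * d ^+ 2 / 2.
Proof.
move=> T0 A0 B0 hd.
have h0 : 0 <= 2 * T * (B + A) by rewrite mulr_ge0 ?addr_ge0// mulr_ge0// ltW.
have d1 : 1 <= d by lra.
have d0 : 0 < d by lra.
apply: (@le_trans _ _ ((B + A) * d)).
  by rewrite mulrDl addrC lerD2l ler_peMr.
rewrite (_ : T^-1 * d ^+ 2 / 2 = (T^-1 * d / 2) * d); last by rewrite expr2; ring.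
rewrite ler_pM2r// ler_pdivlMr// [T^-1 * d]mulrC ler_pdivlMr//; lra.
Qed.

Variables (U v : R -> R -> R) (M MU : R).
Hypothesis (mv : mf2 v) (vM : forall x t, `|v x t| <= M).
Hypothesis ULip : forall x t y s, `|U x t - U y s| <= MU * (`|x - y| + `|t - s|).
Hypothesis Ux : {ae mu, forall t, 0 < t -> {ae mu, forall x : R, is_derive x 1 (fun x => U x t) (v x t)}}.
Hypothesis Ut : {ae mu, forall x, {ae mu, forall t : R, 0 < t -> is_derive t 1 (U x) (- (v x t ^+ 2 / 2))}}.
Hypothesis cons : forall n x t, n.+1%:R^-1 < t -> pair_test n v (fun x t => v x t ^+ 2 / 2) x t = 0.
Hypothesis ent : forall n x t, n.+1%:R^-1 < t ->
  0 <= pair_test n (fun x t => v x t ^+ 2 / 2) (fun x t => v x t ^+ 3 / 3) x t.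

Let MU0 : 0 <= MU.
Proof. by have := le_trans (normr_ge0 _) (ULip 0 0 1 0); rewrite sub0r normrN normr1 subrr normr0 addr0 mulr1. Qed.

Let Uup x t y s : U x t - U y s <= MU * `|x - y| + MU * `|t - s|.
Proof. by rewrite -mulrDr (le_trans (ler_norm _)). Qed.

Let normd (x y : R) : `|x| - `|y| <= `|x - y|.
Proof. by rewrite lerBlDr; have := ler_normD (x - y) y; rewrite subrK. Qed.

(** The barrier is [m - (x - x1) ^ 2 / (2 * (T - t))], a concave parabola that focuses at [(x1, T)]
    and equals [m] on its axis. Varying [m] gives the lower half of the Hopf-Lax formula, [U x1 T >=
    inf_y (U y s + (y - x1) ^ 2 / (2 * (T - s)))]. *)
Lemma backward_bound (s T m x1 : R) : 0 <= s -> s < T ->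
  (forall y, m - (T - s)^-1 * (y - x1) ^+ 2 / 2 <= U y s) -> m <= U x1 T.
Proof.
move=> s0 sT hm.
pose k t := - (T - t)^-1.
pose A := `|m - U x1 s| + MU * T.
have T0 : 0 < T by exact: le_lt_trans sT.
have A0 : 0 <= A by rewrite addr_ge0// mulr_ge0// ltW.
have dk t : s < t < T -> is_derive t 1 k (- k t ^+ 2).
  move=> /andP[st tT].
  have hn : (-1) * t + T != 0 by rewrite mulN1r addrC gt_eqF// subr_gt0.
  have e1 w : T - w = -1 * w + T by rewrite mulN1r addrC.
  apply: (is_derive_cast (is_deriveN (is_derive_inv_affine hn))) => [z|].
    by rewrite /k e1.
  by rewrite /k -e1 sqrrN opprK mul1r.
have hK c1 c2 : s < c1 -> c1 < c2 -> c2 < T -> exists2 K, 0 <= K &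
    forall a b, c1 <= a <= c2 -> c1 <= b <= c2 -> `|k a| <= K /\ `|k a - k b| <= K * `|a - b|.
  move=> sc c12 cT; have d0 : 0 < T - c2 by rewrite subr_gt0.
  have i1 : 0 <= (T - c2)^-1 by rewrite invr_ge0 ltW.
  have i2 : 0 <= (T - c2) ^- 2 by rewrite invr_ge0 exprn_ge0// ltW.
  exists ((T - c2)^-1 + (T - c2) ^- 2); first exact: addr_ge0.
  move=> a b /andP[a1 a2] /andP[b1 b2].
  have ha : T - c2 <= T - a by rewrite lerD2l lerN2.
  have hb : T - c2 <= T - b by rewrite lerD2l lerN2.
  have pa := lt_le_trans d0 ha; split.
    rewrite /k normrN ger0_norm ?invr_ge0 ?(ltW pa)//.
    by apply: (@le_trans _ _ (T - c2)^-1); rewrite ?lerDl// lef_pV2 ?posrE.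
  rewrite /k distrC opprK addrC.
  apply: (le_trans (inv_lip d0 ha hb)).
  have -> : T - a - (T - b) = b - a by ring.
  by rewrite distrC ler_wpM2r// lerDr.
have HC x t : s < t < T -> 1 * (m + k t * (x - x1) ^+ 2 / 2 - U x t) <= MU * (t - s).
  move=> /andP[st tT]; rewrite mul1r.
  have h1 := hm x; have h2 := Uup x s x t.
  rewrite subrr normr0 mulr0 add0r distrC ger0_norm ?subr_ge0 ?(ltW st)// in h2.
  have h3 : k t * (x - x1) ^+ 2 / 2 <= - ((T - s)^-1 * (x - x1) ^+ 2 / 2).
    rewrite -[leRHS]mulNr -[in leRHS]mulNr; apply: quad_mono.
    rewrite /k lerN2 lef_pV2 ?posrE ?subr_gt0//.
    by rewrite lerD2l lerN2 ltW.
  by lra.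
have HX x t : s < t < T -> `|x1| + (1 + 2 * T * (MU + A)) <= `|x| ->
    1 * (m + k t * (x - x1) ^+ 2 / 2 - U x t) <= 0.
  move=> /andP[st tT] hx; rewrite mul1r.
  have hd : 1 + 2 * T * (MU + A) <= `|x - x1|.
    by rewrite (le_trans _ (normd _ _))// lerBrDl.
  have h1 := quad_dominates T0 A0 MU0 hd.
  have h2 := Uup x1 s x t; rewrite distrC in h2.
  have h3 : MU * `|s - t| <= MU * T.
    by rewrite ler_wpM2l// distrC ger0_norm ?subr_ge0 ?(ltW st)//; lra.
  have h4 := ler_norm (m - U x1 s).
  have h5 : k t * (x - x1) ^+ 2 / 2 <= - (T^-1 * `|x - x1| ^+ 2 / 2).
    rewrite -normrX ger0_norm ?sqr_ge0// -[leRHS]mulNr -[in leRHS]mulNr; apply: quad_mono.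
    rewrite /k lerN2 lef_pV2 ?posrE ?subr_gt0//; lra.
  by move: h1; rewrite /A => h1; lra.
have key t : s < t < T -> m <= U x1 t.
  move=> ht; have := strip_le mv vM ULip Ux Ut cons ent s0 sT (or_introl erefl) dk hK HC HX x1 ht.
  by rewrite subrr expr0n mulr0 mul0r addr0 mul1r subr_le0.
apply/ler_addgt0Pr => e e0.
(* The comparison stops short of the focus; the Lipschitz bound in time carries it from [T - d] to
   [T]. *)
pose d := Num.min (e / (MU + 1)) ((T - s) / 2).
have MU1 : 0 < MU + 1 by rewrite ltr_wpDl.
have d0 : 0 < d by rewrite /d lt_min; apply/andP; split; rewrite divr_gt0// subr_gt0.
have d1 : MU * d <= e.
  apply: (@le_trans _ _ ((MU + 1) * d)); first by rewrite ler_wpM2r ?(ltW d0)// lerDl.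
  by rewrite mulrC -ler_pdivlMr// /d ge_min lexx.
have d2 : d <= (T - s) / 2 by rewrite /d ge_min lexx orbT.
have h1 : m <= U x1 (T - d) by apply: key; apply/andP; split; lra.
have h2 := Uup x1 (T - d) x1 T.
have e1 : T - d - T = - d by ring.
rewrite subrr normr0 mulr0 add0r e1 normrN ger0_norm ?(ltW d0)// in h2.
lra.
Qed.

(** The barrier is the parabola issuing from the point [(y, s)], the potential of a centred
    rarefaction wave. The final time [t + 1] of the strip only leaves room after [t]. *)
Lemma forward_bound (s t x y : R) : 0 <= s -> s < t ->
  U x t <= U y s + (t - s)^-1 * (x - y) ^+ 2 / 2.
Proof.
move=> s0 st.
pose k t := (t - s)^-1; pose T := t + 1.
pose A := MU * T.
have T0 : 0 < T by rewrite /T; lra.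
have sT : s < T by rewrite /T; lra.
have A0 : 0 <= A by rewrite mulr_ge0// ltW.
have dk r : s < r < T -> is_derive r 1 k (- k r ^+ 2).
  move=> /andP[sr rT].
  have hn : 1 * r + - s != 0 by rewrite mul1r gt_eqF// subr_gt0.
  apply: (is_derive_cast (is_derive_inv_affine hn)) => [z|]; first by rewrite /k mul1r.
  by rewrite /k mulN1r mul1r.
have hK c1 c2 : s < c1 -> c1 < c2 -> c2 < T -> exists2 K, 0 <= K &
    forall a b, c1 <= a <= c2 -> c1 <= b <= c2 -> `|k a| <= K /\ `|k a - k b| <= K * `|a - b|.
  move=> sc c12 cT; have d0 : 0 < c1 - s by rewrite subr_gt0.
  have i1 : 0 <= (c1 - s)^-1 by rewrite invr_ge0 ltW.
  have i2 : 0 <= (c1 - s) ^- 2 by rewrite invr_ge0 exprn_ge0// ltW.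
  exists ((c1 - s)^-1 + (c1 - s) ^- 2); first exact: addr_ge0.
  move=> a b /andP[a1 a2] /andP[b1 b2].
  have ha : c1 - s <= a - s by rewrite lerD2r.
  have hb : c1 - s <= b - s by rewrite lerD2r.
  have pa := lt_le_trans d0 ha; split.
    rewrite /k ger0_norm ?invr_ge0 ?(ltW pa)//.
    by apply: (@le_trans _ _ (c1 - s)^-1); rewrite ?lerDl// lef_pV2 ?posrE.
  rewrite /k; apply: (le_trans (inv_lip d0 ha hb)).
  have -> : a - s - (b - s) = a - b by ring.
  by rewrite ler_wpM2r// lerDr.
(* Young's inequality [MU * b <= b ^ 2 / (2 * (r - s)) + MU ^ 2 * (r - s) / 2] with [b = |z - y|]
   absorbs the Lipschitz growth in [x] into the parabola; this is the origin of the constant. *)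
have HC z r : s < r < T -> -1 * (U y s + k r * (z - y) ^+ 2 / 2 - U z r) <= (MU + MU ^+ 2 / 2) * (r - s).
  move=> /andP[sr rT]; rewrite mulN1r.
  have tau : 0 < r - s by rewrite subr_gt0.
  have h2 := Uup z r y s; rewrite (ger0_norm (ltW tau)) in h2.
  have h3 : MU * `|z - y| <= k r * (z - y) ^+ 2 / 2 + MU ^+ 2 * (r - s) / 2.
    rewrite -[(z - y) ^+ 2]ger0_norm ?sqr_ge0// normrX /k.
    move: (r - s) tau (`|z - y|) => a a0 b.
    rewrite -subr_ge0 (_ : _ - _ = (b - MU * a) ^+ 2 / (2 * a)).
      by rewrite divr_ge0 ?sqr_ge0// mulr_ge0// ltW.
    by field; rewrite gt_eqF.
  rewrite mulrDl; lra.
have HX z r : s < r < T -> `|y| + (1 + 2 * T * (MU + A)) <= `|z| ->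
    -1 * (U y s + k r * (z - y) ^+ 2 / 2 - U z r) <= 0.
  move=> /andP[sr rT] hz; rewrite mulN1r.
  have hd : 1 + 2 * T * (MU + A) <= `|z - y|.
    by rewrite (le_trans _ (normd _ _))// lerBrDl.
  have h1 := quad_dominates T0 A0 MU0 hd.
  have h2 := Uup z r y s.
  have h3 : MU * `|r - s| <= MU * T.
    by rewrite ler_wpM2l// ger0_norm ?subr_ge0 ?(ltW sr)//; lra.
  have h5 : T^-1 * `|z - y| ^+ 2 / 2 <= k r * (z - y) ^+ 2 / 2.
    rewrite -normrX ger0_norm ?sqr_ge0//; apply: quad_mono.
    rewrite /k lef_pV2 ?posrE ?subr_gt0//; lra.
  by move: h1; rewrite /A => h1; lra.
have ht : s < t < T by rewrite st /T ltrDl ltr01.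
have := strip_le mv vM ULip Ux Ut cons ent s0 sT (or_intror erefl) dk hK HC HX x ht.
by rewrite mulN1r oppr_le0 subr_ge0.
Qed.

(** A nearly optimal [y] at time 0 for the intermediate point [x] is used as competitor at [a] and
    at [b]. The error is exact: [th * (a - y) ^ 2 + (1 - th) * (b - y) ^ 2 = (x - y) ^ 2 + th * (1 -
    th) * (b - a) ^ 2]. *)
Lemma semiconcave (t a b th : R) : 0 < t -> 0 <= th <= 1 ->
  th * U a t + (1 - th) * U b t <= U (th * a + (1 - th) * b) t + th * (1 - th) * (b - a) ^+ 2 / (2 * t).
Proof.
move=> t0 /andP[th0 th1]; set x := th * a + (1 - th) * b.
apply/ler_addgt0Pr => e e0.
have [y hy] : exists y, U y 0 < U x t + e - (t - 0)^-1 * (y - x) ^+ 2 / 2.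
  apply: contrapT => /forallNP hn.
  have : U x t + e <= U x t.
    by apply: (@backward_bound 0 t) => // y; rewrite leNgt; apply/negP; exact: hn.
  lra.
have h1 := ler_wpM2l th0 (forward_bound a y (lexx 0) t0).
have th1' : 0 <= 1 - th by rewrite subr_ge0.
have h2 := ler_wpM2l th1' (forward_bound b y (lexx 0) t0).
rewrite !subr0 in hy h1 h2.
have E : th * (U y 0 + t^-1 * (a - y) ^+ 2 / 2) + (1 - th) * (U y 0 + t^-1 * (b - y) ^+ 2 / 2) =
  U y 0 + t^-1 * (y - x) ^+ 2 / 2 + th * (1 - th) * (b - a) ^+ 2 / (2 * t).
  by rewrite /x; field; rewrite gt_eqF.
lra.
Qed.

(** Semiconcavity at [q], written as a convex combination of [p] and [r] and multiplied by
    [(r - p) / ((q - p) * (r - q))]. *)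
Lemma slope3_le (t p q r : R) : 0 < t -> p < q -> q < r ->
  (U r t - U q t) / (r - q) <= (U q t - U p t) / (q - p) + (r - p) / (2 * t).
Proof.
move=> t0 pq qr.
have rp : 0 < r - p by lra.
have qp0 : 0 < q - p by lra.
have rq0 : 0 < r - q by lra.
have th : 0 <= (r - q) / (r - p) <= 1.
  by rewrite divr_ge0 ?(ltW rp) ?(ltW rq0)//= ler_pdivrMr// mul1r; lra.
have := semiconcave p r t0 th.
have -> : (r - q) / (r - p) * p + (1 - (r - q) / (r - p)) * r = q.
  by field; rewrite gt_eqF.
move=> h.
have {}h := ler_wpM2l (ltW rp) h.
rewrite -subr_ge0.
have -> : (U q t - U p t) / (q - p) + (r - p) / (2 * t) - (U r t - U q t) / (r - q) =
  ((r - p) * (U q t + (r - q) / (r - p) * (1 - (r - q) / (r - p)) * (r - p) ^+ 2 / (2 * t)) -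
   (r - p) * ((r - q) / (r - p) * U p t + (1 - (r - q) / (r - p)) * U r t)) / ((q - p) * (r - q)).
  by field; rewrite !gt_eqF.
by rewrite divr_ge0 ?subr_ge0// mulr_ge0 ?(ltW qp0) ?(ltW rq0).
Qed.

(* Oleinik's one-sided estimate. *)
Lemma slope_le (t a b c d : R) : 0 < t -> a < b -> b <= c -> c < d ->
  (U d t - U c t) / (d - c) <= (U b t - U a t) / (b - a) + (c + d - a - b) / (2 * t).
Proof.
move=> t0 ab; rewrite le_eqVlt => /predU1P[<-|bc] cd.
  have := slope3_le t0 ab cd; congr (_ <= _ + _ / _); ring.
have h1 := slope3_le t0 ab bc; have h2 := slope3_le t0 bc cd.
have -> : (c + d - a - b) / (2 * t) = (c - a) / (2 * t) + (d - b) / (2 * t).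
  by rewrite -mulrDl; congr (_ / _); ring.
lra.
Qed.

End semiconcavity.

(** * The potential of an entropy solution *)

Section entropy_pairs.
Context {R : realType}.
Local Notation mu := (@lebesgue_measure R).

Lemma entropy_pair_square :
  entropy_pair (@burgers_flux R) (fun z => z ^+ 2 / 2) (fun z => z ^+ 3 / 3).
Proof.
split.
- rewrite /convex_function => th x y _ _ /=.
  have -> : conv th x y = th%:num * x + (1 - th%:num) * y by [].
  rewrite convRE /unstable.onem.
  have : 0 <= th%:num by [].
  have : th%:num <= 1 by [].
  move: (th%:num : R) => a a1 a0.
  rewrite -subr_ge0.
  have -> : a * (x ^+ 2 / 2) + (1 - a) * (y ^+ 2 / 2) - (a * x + (1 - a) * y) ^+ 2 / 2 =
    a * (1 - a) * ((x : R) - y) ^+ 2 / 2 by field.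
  by rewrite divr_ge0// mulr_ge0 ?sqr_ge0// mulr_ge0// subr_ge0.
- move=> [x y] _.
  pose K : R := 2 * ((`|x| + 1) + (`|y| + 1)) ^+ 2.
  have -> : within ([set: R] `*` [set: R]) (nbhs (x, y)) = nbhs (x, y).
    apply/seteqP; split=> A; rewrite /within/= => hA.
      by apply: filterS hA => z; apply; split.
    by apply: filterS hA.
  apply: (@klipschitzW _ _ _ K); rewrite /dominated_by/=.
  near=> p.
  have h1 : `|p.1| <= `|x| + 1.
    rewrite -[p.1](subrK x) addrC (le_trans (ler_normD _ _))// lerD2l distrC.
    by near: p; exists (ball x 1, ball y 1) => /=; [split; exact: nbhsx_ballx|move=> q [/= /ltW]].
  have h2 : `|p.2| <= `|y| + 1.
    rewrite -[p.2](subrK y) addrC (le_trans (ler_normD _ _))// lerD2l distrC.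
    by near: p; exists (ball x 1, ball y 1) => /=; [split; exact: nbhsx_ballx|move=> q [_ /= /ltW]].
  change (`|p.1 ^+ 3 / 3 - p.2 ^+ 3 / 3| <= K * `|p.1 - p.2|).
  rewrite (_ : p.1 ^+ 3 / 3 - p.2 ^+ 3 / 3 = (p.1 ^+ 2 + p.1 * p.2 + p.2 ^+ 2) / 3 * (p.1 - p.2)); last by field.
  rewrite normrM ler_wpM2r// normrM [`|_^-1|]ger0_norm ?invr_ge0// ler_pdivrMr//.
  rewrite (le_trans (ler_normD _ _))// (le_trans (lerD (ler_normD _ _) (lexx _)))// !normrM.
  rewrite /K; move: (`|p.1|) (`|p.2|) (normr_ge0 p.1) (normr_ge0 p.2) h1 h2.
  move: (`|x| + 1) (`|y| + 1) => X Y a b a0 b0 aX bY; nra.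
- apply: aeW => z.
  have d2 : is_derive z 1 (fun z : R => z ^+ 2 / 2) z.
    rewrite (_ : (fun _ => _) = (fun z : R => 2^-1 *: (id z) ^+ 2)); last first.
      by apply/funext => w; rewrite mulrC.
    by apply: is_derive_eq; rewrite /GRing.scale/=; field.
  have d3 : is_derive z 1 (fun z : R => z ^+ 3 / 3) (z ^+ 2).
    rewrite (_ : (fun _ => _) = (fun z : R => 3^-1 *: (id z) ^+ 3)); last first.
      by apply/funext => w; rewrite mulrC.
    by apply: is_derive_eq; rewrite /GRing.scale/=; field.
  split; first exact: ex_derive.
    exact: ex_derive.
  by rewrite derive1_burgers_flux !derive1E !derive_val expr2.
Unshelve. all: end_near. Qed.

End entropy_pairs.

(** * The hypotheses on the entropy solution in terms of product kernels *)

Section pairs.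
Context {R : realType}.
Local Notation mu := (@lebesgue_measure R).
Variables (u0 : R -> R) (u : R * R -> R).
Variables (v : R -> R -> R) (M : R).
Hypotheses (mv : mf2 v) (vM : forall x t, `|v x t| <= M).
Hypothesis uv : {ae mu, forall t, 0 <= t -> {ae mu, forall x, u (x, t) = v x t}}.

Let kl n (y : R) k := fun z : R => kern n k.+1 (z - y).

Lemma smooth1_kern_l n (y : R) : smooth1 (fun k z => kern n k.+1 (z - y)).
Proof. by move=> k z; exact: kern_derive_l. Qed.

(** The condition on [t] keeps the kernel at positive times, where the initial datum is not seen.
    The flux part of [pair_test] integrates in the opposite order, hence a use of Fubini. *)
Lemma pair_test_weak_form (eta q : R -> R) n (x t : R) : Linfty_half_plane u ->
  measurable_fun setT eta -> measurable_fun setT q ->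
  (exists C, forall z, `|z| <= M -> `|eta z| <= C /\ `|q z| <= C) ->
  n.+1%:R^-1 < t ->
  weak_form eta q u0 u (tensor (kl n x 0) (kl n t 0)) =
  (pair_test n (fun x t => eta (v x t)) (fun x t => q (v x t)) x t)%:E.
Proof.
move=> hu meta mq hC ht; have [C hC'] := hC.
have sx := smooth1_kern_l n x; have st := smooth1_kern_l n t.
have ct : 0 < t - n.+1%:R^-1 by rewrite subr_gt0.
have [_ ->] := weak_form_tensor u0 hu meta mq mv vM hC uv sx st
  (fun k => @kern_l0 R n k x) (fun k => @kern_l0 R n k t) ct.
have me : mf2 (fun x t => eta (v x t)) by exact: measurableT_comp.
have mj : mf2 (fun x t => q (v x t)) by exact: measurableT_comp.
have eC x' t' : `|eta (v x' t')| <= C by have [] := hC' _ (vM x' t').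
have qC x' t' : `|q (v x' t')| <= C by have [] := hC' _ (vM x' t').
rewrite I2_D; [|exact: bcs2_ekk eC|exact: bcs2_ekk qC].
apply: (congr1 EFin); apply: (f_equal2 +%R); first by [].
rewrite /tensor_test_e I2_swap; last exact: bcs2_ekk qC.
congr I; apply/funext => r; congr I; apply/funext => y.
by rewrite [kern n 1 _ * _]mulrC.
Qed.

Lemma test_function_kern n (x t : R) : test_function (tensor (kl n x 0) (kl n t 0)).
Proof.
exact: (tensor_test (smooth1_kern_l n x) (smooth1_kern_l n t) (@kern_l0 R n 0 x) (@kern_l0 R n 0 t)).
Qed.

Hypothesis hu : entropy_solution (@burgers_flux R) u0 u.

Lemma conservation_pair n (x t : R) : n.+1%:R^-1 < t ->
  pair_test n v (fun x t => v x t ^+ 2 / 2) x t = 0.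
Proof.
move=> ht; have [[hL hw] _] := hu.
have := hw _ (test_function_kern n x t).
rewrite pair_test_weak_form//.
- move=> h; apply: etrans (EFin_inj h).
  apply: (congr1 (fun j => pair_test n v j x t)).
  by apply/funext => y; apply/funext => r; rewrite mulrC.
- by apply: measurable_funM => //; exact: measurable_funX.
exists (M + M ^+ 2) => z zM; have M0 := le_trans (normr_ge0 _) zM; split=> /=.
  by rewrite (le_trans zM)// lerDl sqr_ge0.
rewrite /burgers_flux normrM normrX ger0_norm ?invr_ge0//.
move: (`|z|) (normr_ge0 z) zM => a a0 aM; nra.
Qed.

Lemma entropy_pair_ge0 n (x t : R) : n.+1%:R^-1 < t ->
  0 <= pair_test n (fun x t => v x t ^+ 2 / 2) (fun x t => v x t ^+ 3 / 3) x t.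
Proof.
move=> ht; have [[hL hw] he] := hu.
have := he _ _ entropy_pair_square _ (test_function_kern n x t).
rewrite pair_test_weak_form//.
- by rewrite lee_fin; apply => p _; rewrite /tensor mulr_ge0// kern_ge0.
- by apply: measurable_funM => //; exact: measurable_funX.
- by apply: measurable_funM => //; exact: measurable_funX.
exists (M ^+ 2 + M ^+ 3) => z zM; have M0 := le_trans (normr_ge0 _) zM.
rewrite [`|_ / 2|]normrM [`|_ / 3|]normrM !normrX (@ger0_norm _ 2^-1) ?invr_ge0// (@ger0_norm _ 3^-1) ?invr_ge0//.
have h2 : `|z| ^+ 2 <= M ^+ 2 by rewrite lerXn2r ?nnegrE.
have h3 : `|z| ^+ 3 <= M ^+ 3 by rewrite lerXn2r ?nnegrE.
have p2 : 0 <= `|z| ^+ 2 by rewrite exprn_ge0.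
have p3 : 0 <= `|z| ^+ 3 by rewrite exprn_ge0.
split; lra.
Qed.

End pairs.

(** * Primitives of bounded measurable functions *)

Section primitives.
Context {R : realType}.
Local Notation mu := (@lebesgue_measure R).

Implicit Types (g : R -> R) (x y z : R).

(* [I (fun y => step x y * g y)] is the oriented integral of [g] from 0 to [x]. *)
Definition step (x y : R) : R := (y <= x)%R%:R - (y <= 0)%R%:R.

Definition prim g (x : R) := I (fun y => step x y * g y).

Lemma step_le1 x y : `|step x y| <= 1.
Proof.
by rewrite /step; case: (y <= x); case: (y <= 0); rewrite ?subrr ?subr0 ?sub0r ?normrN ?normr1 ?normr0.
Qed.

Lemma step_out x y : `|x| < `|y| -> step x y = 0.
Proof.
rewrite /step; have [xy|xy] := leP y x; have [y0|y0] := leP y 0; rewrite ?subrr// => h; exfalso; move: h.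
- by rewrite (ger0_norm (ltW y0)) ltNge (le_trans xy)// ler_norm.
- by rewrite (ler0_norm y0) ltNge => /negP; apply; rewrite ler_normr lerN2 (ltW xy) orbT.
Qed.

Lemma measurable_step : measurable_fun setT (fun p : R * R => step p.1 p.2).
Proof.
have -> : (fun p : R * R => step p.1 p.2) =
    (fun p => \1_[set p : R * R | p.2 <= p.1] p - \1_[set p : R * R | p.2 <= 0] p).
  by apply/funext => p; rewrite /step !indicE !mem_setE.
apply: measurable_funB; apply: measurable_indic.
- rewrite -[X in measurable X]setTI.
  exact: (@measurable_fun_ler _ _ _ setT (fun p : R * R => p.2) (fun p => p.1) measurable_snd measurable_fst _ [set true]).
- rewrite -[X in measurable X]setTI.
  exact: (@measurable_fun_ler _ _ _ setT (fun p : R * R => p.2) (fun=> 0) measurable_snd (measurable_cst _) _ [set true]).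
Qed.

Lemma step_bcs x : bcs (step x).
Proof.
split; first exact: (measurableT_comp measurable_step (@measurable_pair1 _ _ _ _ x)).
exists (`|x| + 1); split=> y; first by rewrite (le_trans (step_le1 _ _))// lerDr.
by move=> h; apply: step_out; rewrite (le_lt_trans _ h)// lerDl.
Qed.

Lemma step_bcsM x g (M : R) : measurable_fun setT g -> (forall y, `|g y| <= M) ->
  bcs (fun y => step x y * g y).
Proof. by move=> mg gM; apply: bcsM (step_bcs x) mg _; exists M. Qed.

Lemma step_diff x y z : x <= y -> step y z - step x z = (x < z <= y)%R%:R.
Proof.
move=> xy; rewrite /step opprB addrA subrK.
have [zx|zx] /= := leP z x; last by rewrite subr0.
by rewrite (le_trans zx xy) subrr.
Qed.

Lemma prim_diff g (M x y : R) : measurable_fun setT g -> (forall y, `|g y| <= M) -> x <= y ->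
  prim g y - prim g x = I (fun z => (x < z <= y)%R%:R * g z).
Proof.
move=> mg gM xy; rewrite /prim -I_B; [|exact: step_bcsM gM|exact: step_bcsM gM].
by congr I; apply/funext => z; rewrite -mulrBl step_diff.
Qed.

Lemma prim_lip g (M x y : R) : measurable_fun setT g -> (forall y, `|g y| <= M) ->
  `|prim g x - prim g y| <= M * `|x - y|.
Proof.
move=> mg gM; wlog xy : x y / x <= y.
  move=> H; have [/H//|/ltW/H] := leP x y.
  by rewrite distrC [`|y - x|]distrC.
rewrite distrC (prim_diff mg gM xy) [`|x - y|]distrC [`|y - x|]ger0_norm ?subr_ge0//.
apply: bcs_le_bound => //.
- rewrite (_ : (fun _ => _) = (fun z => step y z * g z - step x z * g z)).
    by apply: bcsB; exact: step_bcsM gM.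
  by apply/funext => z; rewrite -mulrBl step_diff.
- move=> z; rewrite normrM (le_trans _ (gM z))// ler_piMl//.
  by case: (_ < _ <= _); rewrite ?normr1 ?normr0.
- move=> z; case: (boolP (x < z <= y)) => [/andP[h1 h2]|_ _]; last by rewrite mul0r.
  by rewrite (ltW h1) h2.
Qed.

Lemma prim0 g : prim g 0 = 0.
Proof.
by rewrite /prim -[RHS]I_0; congr I; apply/funext => z; rewrite /step subrr mul0r.
Qed.

Lemma prim_le g (M x : R) : measurable_fun setT g -> (forall y, `|g y| <= M) ->
  `|prim g x| <= M * `|x|.
Proof.
by move=> mg gM; have := prim_lip x 0 mg gM; rewrite prim0 !subr0.
Qed.

(** A bounded [g] need not be integrable at [- oo]; on each half-line [x > - n] the primitive
    differs by a constant from the one based at [- n], and countably many null sets are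
    discarded. *)
Lemma prim_is_derive g (M : R) : measurable_fun setT g -> (forall y, `|g y| <= M) ->
  {ae mu, forall x : R, is_derive x 1 (prim g) (g x)}.
Proof.
move=> mg gM.
have H n : {ae mu, forall x : R, - n%:R < x -> is_derive x 1 (prim g) (g x)}.
  have ig (y : R) : mu.-integrable [set` Interval (BRight (- n%:R : R)) (BRight y)] (EFin \o g).
    have h : mu.-integrable `[- n%:R, y] (EFin \o g).
      apply: measurable_bounded_integrable => //; first exact: mu_itv_fin.
        exact: measurable_funTS.
      by exists M; split; [exact: num_real|move=> z zM w _ /=; rewrite (le_trans (gM w))// ltW].
    apply: integrableS h => //.
    by move=> z; rewrite /= !in_itv/= => /andP[/ltW -> ->].
  pose F (x : R) : R := (\int[mu]_(t in [set` Interval (BRight (- n%:R : R)) (BRight x)]) (g t))%R.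
  have : {ae mu, forall x, (BRight (- n%:R) < BRight x)%O -> derivable F x 1 /\ derive1 F x = g x}.
    exact: (FTC1 ig (bounded_locally_integrable mg gM)).
  apply: aeS => x h nx; have {h} [|d e] := h _; first by rewrite bnd_simp.
  move: e; rewrite derive1E => e.
  have dF : is_derive x 1 F (g x) := DeriveDef d e.
  have dG : is_derive x 1 (fun y => prim g (- n%:R) + F y) (g x).
    apply: (is_derive_cast (is_deriveD (is_derive_cst (prim g (- n%:R)) x 1) dF)) => //.
    by rewrite add0r.
  have d0 : 0 < x + n%:R by move: nx; rewrite -subr_gt0 opprK.
  apply: (@is_derive_near _ _ _ _ _ _ d0 _ dG).
  move=> y hy /=.
  have ny : - n%:R <= y.
    by move: hy; rewrite distrC => /(le_lt_trans (ler_norm _)); lra.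
  rewrite -(subrK (prim g (- n%:R)) (prim g y)) addrC (prim_diff mg gM ny).
  congr (_ + _); rewrite /I /F [RHS]Rintegral_mkcond; congr Rintegral.
  apply/funext => z; rewrite patchE mem_setE in_itv/=; case: ifP => _; by rewrite ?mul1r ?mul0r.
apply: aeS (ae_nat H) => x h; apply: (h (Num.trunc `|x|).+1).
by have := truncnS_gt `|x|; have := ler_norm (- x); rewrite normrN; lra.
Qed.

Lemma kern_cont_bcs n g x : continuous g -> bcs (fun y => g y * kern n 1 (y - x)).
Proof.
move=> cg; apply: (@cont_bcs _ _ (x - n.+1%:R^-1) (x + n.+1%:R^-1)).
  by move=> y; apply: cvgM; [exact: cg|exact: kern_cont_l].
by move=> y /kern_l0 ->; rewrite mulr0.
Qed.

Lemma moll_lip n g (M : R) x : 0 <= M -> (forall x y, `|g x - g y| <= M * `|x - y|) ->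
  `|moll n g x - g x| <= M * n.+1%:R^-1.
Proof.
move=> M0 gL; have cg := lip_cont M0 gL.
have bk := @kern_bcs_l R n 0 x.
have -> : g x = I (fun y => g x * kern n 1 (y - x)) by rewrite I_Z// kern_mass mulr1.
have b1 := kern_cont_bcs n x cg; have b2 := bcsZ (g x) bk.
rewrite /moll -I_B//; apply: (le_trans (I_norm (bcsB b1 b2))).
have -> : M * n.+1%:R^-1 = I (fun y => M * n.+1%:R^-1 * kern n 1 (y - x)).
  by rewrite I_Z// kern_mass mulr1.
apply: I_le; [exact: bcs_norm (bcsB b1 b2)|exact: bcsZ|move=> y].
rewrite -mulrBl normrM (ger0_norm (kern_ge0 _ _)).
have [h|h] := leP `|y - x| n.+1%:R^-1.
  apply: ler_wpM2r; first exact: kern_ge0.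
  by apply: (le_trans (gL _ _)); apply: ler_wpM2l.
by rewrite kern_out ?(ltW h)// !mulr0.
Qed.

(* Fubini in place of integration by parts: the kernel [step x y] integrates a
   compactly supported derivative [a] back to [- A]. *)
Lemma step_FTC (A a : R -> R) (b c y : R) : (forall x, is_derive x 1 A (a x)) -> continuous a ->
  (forall x, ~~ (b <= x <= c) -> A x = 0) -> (forall x, ~~ (b <= x <= c) -> a x = 0) ->
  I (fun x => step x y * a x) = - A y.
Proof.
move=> dA ca A0 a0.
pose B := `|b| + `|c| + `|y| + 1.
have b1 : - B < b by rewrite /B; have := ler_norm (- b); rewrite normrN; have := normr_ge0 c; have := normr_ge0 y; lra.
have c1 : c < B by rewrite /B; have := ler_norm c; have := normr_ge0 b; have := normr_ge0 y; lra.
have y1 : - B < y by rewrite /B; have := ler_norm (- y); rewrite normrN; have := normr_ge0 c; have := normr_ge0 b; lra.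
have y2 : y < B by rewrite /B; have := ler_norm y; have := normr_ge0 b; have := normr_ge0 c; lra.
have ABm : A (- B) = 0 by apply: A0; rewrite negb_and -ltNge b1.
have AB : A B = 0 by apply: A0; rewrite negb_and -!ltNge c1 orbT.
have aint (p q : R) : p < q -> Rintegral mu `[p, q] a = A q - A p.
  move=> pq; rewrite /Rintegral (@continuous_FTC2 _ a A p q)//.
  - exact: continuous_subspaceT.
  - split.
    + by move=> x _; exact: ex_derive.
    + by apply: cvg_at_right_filter; exact: is_derive_cont (dA p).
    + by apply: cvg_at_left_filter; exact: is_derive_cont (dA q).
  - by move=> x _; rewrite derive1E; exact: derive_val.
have ba := cont_bcs ca a0.
have [y0|y0] := leP y 0.
  have -> : (fun x => step x y * a x) = (fun x => - (a \_ `[- B, y[) x).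
    apply/funext => x; rewrite patchE mem_setE in_itv/= /step y0.
    have [xy|yx] := ltP x y; rewrite ?andbT ?andbF/=; last by rewrite subrr mul0r oppr0.
    rewrite sub0r mulN1r; case: ifPn => //; rewrite -ltNge => xB.
    by rewrite a0 ?oppr0// negb_and -ltNge (lt_trans xB b1).
  have ia : mu.-integrable `[- B, y[ (EFin \o a) by exact: integrableS (bcs_integrable ba).
  rewrite I_N.
    by rewrite /I -Rintegral_mkcond Rintegral_itv_bndo_bndc// aint// ABm subr0.
  rewrite (_ : a \_ _ = (fun x => if x \in `[- B, y[ then a x else 0)).
    by apply: bcs_cond => //; exact: measurable_itv.
  by apply/funext => x; rewrite patchE mem_setE.
have -> : (fun x => step x y * a x) = a \_ `[y, B].
  apply/funext => x; rewrite patchE mem_setE in_itv/= /step (lt_geF y0) subr0.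
  have [xy|yx] /= := leP y x; last by rewrite mul0r.
  rewrite mul1r; case: ifPn => //; rewrite -ltNge => xB.
  by rewrite a0// negb_and -!ltNge (lt_trans c1 xB) orbT.
by rewrite /I -Rintegral_mkcond aint// AB sub0r.
Qed.
End primitives.

(** * The conservation law integrated over rectangles *)

Section rectangle.
Context {R : realType}.
Local Notation mu := (@lebesgue_measure R).

(** Since [prim g] is merely Lipschitz, the two integrals are exchanged and the inner one is
    evaluated by [step_FTC]. *)
Lemma prim_ibp (g : R -> R) (M : R) (A a : R -> R) (b c : R) :
  measurable_fun setT g -> (forall y, `|g y| <= M) ->
  (forall x : R, is_derive x 1 A (a x)) -> continuous a ->
  (forall x, ~~ (b <= x <= c) -> A x = 0) -> (forall x, ~~ (b <= x <= c) -> a x = 0) ->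
  I (fun x => prim g x * a x) = - I (fun y => g y * A y).
Proof.
move=> mg gM dA ca A0 a0; have ba := cont_bcs ca a0.
have M0 : 0 <= M := le_trans (normr_ge0 _) (gM 0).
pose H x y := step x y * g y * a x.
have bH : bcs2 H.
  split.
    apply: measurable_funM; first apply: measurable_funM.
    - exact: measurable_step.
    - exact: (measurableT_comp mg measurable_snd).
    - exact: (measurableT_comp ba.1 measurable_fst).
  have [C [C0 h1 h2]] := bounded_supportP ba.2.
  exists (M * C + C); split=> x y.
    rewrite /H !normrM (@le_trans _ _ (M * C))// ?lerDl ?(ltW C0)//.
    apply: ler_pM => //; rewrite -[M]mul1r; apply: ler_pM => //; exact: step_le1.
  have CC : C <= M * C + C by rewrite lerDr mulr_ge0// ltW.
  move=> h; rewrite /H; have [xC|Cx] := leP `|x| C; last by rewrite h2 ?mulr0.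
  case: h => h; first by have := le_lt_trans CC h; rewrite ltNge xC.
  by rewrite step_out ?mul0r// (le_lt_trans xC)// (le_lt_trans CC h).
have -> : I (fun x => prim g x * a x) = I2 H.
  rewrite /I2; congr I; apply/funext => x; rewrite mulrC /prim -I_Z; last exact: step_bcsM gM.
  by congr I; apply/funext => y; rewrite /H mulrC.
rewrite I2_swap// -I_N; last first.
  rewrite (_ : (fun _ => _) = (fun y => A y * g y)); last by apply/funext => y; rewrite mulrC.
  apply: bcsM => //; last by exists M.
  by apply: cont_bcs A0 => y; exact: is_derive_cont (dA y).
congr I; apply/funext => y.
rewrite -mulrN -(step_FTC y dA ca A0 a0) -I_Z.
  by congr I; apply/funext => x; rewrite /H; ring.
rewrite (_ : (fun _ => _) = (fun x => a x * step x y)); last by apply/funext => x; rewrite mulrC.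
apply: bcsM => //; last by exists 1 => x; exact: step_le1.
exact: (measurableT_comp measurable_step (@measurable_pair2 _ _ _ _ y)).
Qed.

(** For [k = 0] a smoothed oriented indicator of the interval from [a] to [b]; for [k = 1] its
    derivative, a smoothed Dirac mass at [a] minus one at [b]. *)
Definition bump n (a b x : R) k : R := kern n k (x - a) - kern n k (x - b).

Lemma bump_smooth n (a b : R) : smooth1 (fun k x => bump n a b x k).
Proof. by move=> k x; apply: is_deriveB; exact: kern_derive_l. Qed.

Lemma bump_out n (a b x : R) k :
  ~~ (Num.min a b - n.+1%:R^-1 <= x <= Num.max a b + n.+1%:R^-1) -> bump n a b x k = 0.
Proof.
have ka : Num.min a b <= a by rewrite ge_min lexx.
have kb : Num.min a b <= b by rewrite ge_min lexx orbT.
have la : a <= Num.max a b by rewrite le_max lexx.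
have lb : b <= Num.max a b by rewrite le_max lexx orbT.
have E1 (y m N : R) : m <= y -> x < m - N -> x - y <= - N /\ x < y - N by move=> *; split; lra.
have E2 (y m N : R) : y <= m -> m + N < x -> N <= x - y /\ y + N < x by move=> *; split; lra.
rewrite /bump negb_and -!ltNge => /orP[h|h].
  have [a1 a2] := E1 _ _ _ ka h; have [b1 b2] := E1 _ _ _ kb h.
  case: k => [|k]; first by rewrite !kern0 ?subrr.
  by rewrite !kern_l0 ?subrr// negb_and -!ltNge ?a2 ?b2.
have [a1 a2] := E2 _ _ _ la h; have [b1 b2] := E2 _ _ _ lb h.
case: k => [|k]; first by rewrite !kern1 ?subrr.
by rewrite !kern_l0 ?subrr// negb_and -!ltNge ?a2 ?b2 orbT.
Qed.

Lemma bump_cont n (a b : R) k : continuous (fun x => bump n a b x k).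
Proof. by move=> x; exact: is_derive_cont (bump_smooth n a b k x). Qed.

Lemma bump_bcs n (a b : R) k : bcs (fun x => bump n a b x k).
Proof. exact: (cont_bcs (@bump_cont n a b k) (fun x => @bump_out n a b x k)). Qed.

Lemma bump2_bcs2 n (a b c d : R) i k : bcs2 (fun x t => bump n a b x i * bump n c d t k).
Proof.
split.
  apply: measurable_funM; first exact: (measurableT_comp (bump_bcs n a b i).1 measurable_fst).
  exact: (measurableT_comp (bump_bcs n c d k).1 measurable_snd).
have [C [C0 h1 h2]] := bounded_supportP (bump_bcs n a b i).2.
have [D [D0 k1 k2]] := bounded_supportP (bump_bcs n c d k).2.
exists (C * D + C + D); split=> x t.
  rewrite normrM (@le_trans _ _ (C * D))//; first exact: ler_pM.
  by rewrite -addrA lerDl addr_ge0// ltW.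
have CD : 0 < C * D by rewrite mulr_gt0.
by case=> h; [rewrite h2 ?mul0r//|rewrite k2 ?mulr0//]; lra.
Qed.

Lemma bump2M_bcs2 n (g : R -> R -> R) (M a b c d : R) i k : mf2 g -> (forall x t, `|g x t| <= M) ->
  bcs2 (fun x t => g x t * (bump n a b x i * bump n c d t k)).
Proof.
move=> mg gM; rewrite (_ : (fun _ _ => _) = (fun x t => bump n a b x i * bump n c d t k * g x t)); last first.
  by apply/funext => x; apply/funext => t; rewrite mulrC.
by apply: bcs2M => //; [exact: bump2_bcs2|exists M].
Qed.

Lemma I_bump1 n (a b : R) (f : R -> R) (C : R) : measurable_fun setT f -> (forall y, `|f y| <= C) ->
  I (fun x => f x * bump n a b x 1) = moll n f a - moll n f b.
Proof.
move=> mf fC; rewrite /moll -I_B; [|exact: moll_bcs fC|exact: moll_bcs fC].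
by congr I; apply/funext => x; rewrite /bump mulrBr.
Qed.

Lemma dist4 (p q r s w e : R) : `|p - q| <= e / 4 -> `|q - r| <= e / 4 -> `|s - r| <= e / 4 ->
  `|w - s| <= e / 4 -> `|w - p| <= e.
Proof.
rewrite !ler_norml => /andP[? ?] /andP[? ?] /andP[? ?] /andP[? ?].
by apply/andP; split; lra.
Qed.

Definition moll2 n (P : R -> R -> R) (x t : R) := moll n (fun r => moll n (fun y => P y r) x) t.

Section one_function.
Variables (g : R -> R -> R) (M : R).
Hypotheses (mg : mf2 g) (gM : forall x t, `|g x t| <= M).

Let M0 : 0 <= M. Proof. exact: le_trans (normr_ge0 _) (gM 0 0). Qed.

Definition prim_x (x t : R) := prim (fun y => g y t) x.

Let mgt t : measurable_fun setT (fun y => g y t). Proof. exact: (mf2_x t (mf2_swap mg)). Qed.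

Lemma prim_x_lip x y t : `|prim_x x t - prim_x y t| <= M * `|x - y|.
Proof. exact: prim_lip. Qed.

Lemma measurable_prim_x x : measurable_fun setT (prim_x x).
Proof.
apply: measurable_I; last by move=> t; exact: step_bcsM (gM^~ t).
apply: measurable_funM.
  exact: (measurableT_comp (step_bcs x).1 measurable_snd).
exact: mf2_swap.
Qed.

Lemma prim_x_mf2 : mf2 prim_x.
Proof. exact: (lip_mf2 M0 measurable_prim_x prim_x_lip). Qed.

Let molx n x r := moll n (fun y => prim_x y r) x.

Let molxP n x r : `|molx n x r - prim_x x r| <= M * n.+1%:R^-1.
Proof. by apply: moll_lip => // y z; exact: prim_x_lip. Qed.

Let mmolx n x : measurable_fun setT (molx n x).
Proof.
apply: measurable_I.
  apply: measurable_funM; first exact: mf2_swap prim_x_mf2.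
  exact: (measurableT_comp (@kern_bcs_l R n 0 x).1 measurable_snd).
by move=> r; apply: kern_cont_bcs; apply: (lip_cont M0) => y z; exact: prim_x_lip.
Qed.

Let px_le x r : `|prim_x x r| <= M * `|x|.
Proof. exact: prim_le. Qed.

Let molx_le n x r : `|molx n x r| <= M * `|x| + M * n.+1%:R^-1.
Proof.
rewrite -[molx n x r](subrK (prim_x x r)) addrC.
by rewrite (le_trans (ler_normD _ _))// lerD.
Qed.

(** Integration by parts in [x] replaces [g] by its primitive and the smoothed indicator by two
    smoothed Dirac masses; with the two in [t], the four corners of the rectangle appear. *)
Lemma I2_bump n (a b c d : R) :
  I2 (fun x t => g x t * (bump n a b x 0 * bump n c d t 1)) =
  - (moll2 n prim_x a c - moll2 n prim_x b c - moll2 n prim_x a d + moll2 n prim_x b d).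
Proof.
rewrite I2_swap; last exact: bump2M_bcs2 gM.
have b1 : bcs (fun t => molx n a t * bump n c d t 1).
  rewrite (_ : (fun _ => _) = (fun t => bump n c d t 1 * molx n a t)); last by apply/funext => t; rewrite mulrC.
  by apply: bcsM; [exact: bump_bcs|exact: mmolx|exists (M * `|a| + M * n.+1%:R^-1)].
have b2 : bcs (fun t => molx n b t * bump n c d t 1).
  rewrite (_ : (fun _ => _) = (fun t => bump n c d t 1 * molx n b t)); last by apply/funext => t; rewrite mulrC.
  by apply: bcsM; [exact: bump_bcs|exact: mmolx|exists (M * `|b| + M * n.+1%:R^-1)].
transitivity (- (I (fun t => molx n a t * bump n c d t 1) - I (fun t => molx n b t * bump n c d t 1))).
  rewrite -I_B// -I_N; last exact: bcsB.
  congr I; apply/funext => t.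
  have h := prim_ibp (mgt t) (gM^~ t) (bump_smooth n a b 0) (@bump_cont n a b 1)
    (fun x => @bump_out n a b x 0) (fun x => @bump_out n a b x 1).
  have bt : bcs (fun x => g x t * bump n a b x 0).
    rewrite (_ : (fun _ => _) = (fun x => bump n a b x 0 * g x t)); last by apply/funext => x; rewrite mulrC.
    by apply: bcsM; [exact: bump_bcs|exact: mgt|exists M].
  rewrite (_ : (fun x => g x t * _) = (fun x => bump n c d t 1 * (g x t * bump n a b x 0))); last first.
    by apply/funext => x; ring.
  rewrite I_Z// -[I _]opprK -h -mulrBl mulrC mulNr; congr (- (_ * _)).
  have cp : continuous (prim_x^~ t) by apply: (lip_cont M0) => y z; exact: prim_x_lip.
  rewrite /molx /moll -I_B; [|exact: kern_cont_bcs|exact: kern_cont_bcs].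
  by congr I; apply/funext => x; rewrite /bump mulrBr.
rewrite (I_bump1 n c d (mmolx n a) (molx_le n a)) (I_bump1 n c d (mmolx n b) (molx_le n b)).
have G (p q r s : R) : - (p - q - (r - s)) = - (p - r - q + s) by ring.
exact: G.
Qed.

(** The exceptional set of times must not depend on [x]. It is collected over rational positions
    only, and the Lipschitz bound in [x], uniform in time, transfers the convergence to the
    others. *)
Lemma moll2_cvg : {ae mu, forall t, forall x, moll2 n prim_x x t @[n --> \oo] --> prim_x x t}.
Proof.
pose q (m : nat) : R := ratr (odflt 0 (unpickle m) : rat).
have H m : {ae mu, forall t, moll n (prim_x (q m)) t @[n --> \oo] --> prim_x (q m) t}.
  exact: (moll_cvg (measurable_prim_x (q m)) (px_le (q m))).
apply: aeS (ae_nat H) => t Ht x; apply/cvgrPdist_le => e e0.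
have M1 : 0 < M + 1 by rewrite ltr_wpDl.
have d0 : 0 < e / (4 * (M + 1)) by rewrite divr_gt0// mulr_gt0.
have [m hm] : exists m, M * `|x - q m| <= e / 4.
  have : x - e / (4 * (M + 1)) < x + e / (4 * (M + 1)) by lra.
  move=> /rat_in_itvoo[r]; rewrite in_itv/= => /andP[r1 r2].
  exists (pickle r); rewrite /q pickleK/=.
  apply: (@le_trans _ _ ((M + 1) * (e / (4 * (M + 1))))).
    apply: ler_pM => //; first by rewrite lerDl.
    by rewrite ler_norml; apply/andP; split; lra.
  by rewrite le_eqVlt; apply/orP; left; apply/eqP; field; rewrite gt_eqF.
have E n (f h : R -> R) (C : R) : measurable_fun setT f -> measurable_fun setT h -> (exists D, forall y, `|f y| <= D) ->
    (exists D, forall y, `|h y| <= D) -> (forall y, `|f y - h y| <= C) -> `|moll n f t - moll n h t| <= C.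
  move=> mf mh [D1 fD] [D2 hD] fh.
  rewrite /moll -I_B; [|exact: moll_bcs fD|exact: moll_bcs hD].
  rewrite (_ : (fun _ => _) = (fun y => (f y - h y) * kern n 1 (y - t))); last first.
    by apply/funext => y; rewrite mulrBl.
  by apply: moll_bound => //; exact: measurable_funB.
have e4 : 0 < e / 4 by rewrite divr_gt0.
have /cvgrPdist_le/(_ _ e4) hq := Ht m.
have hN : \forall n \near \oo, M * n.+1%:R^-1 <= e / 4.
  have /cvgrPdist_le/(_ _ d0) := @cvg_harmonic R; apply: filterS => n.
  rewrite sub0r normrN ger0_norm ?invr_ge0// => h.
  apply: (@le_trans _ _ ((M + 1) * (e / (4 * (M + 1))))).
    by apply: ler_pM => //; rewrite ?lerDl ?invr_ge0.
  by rewrite le_eqVlt; apply/orP; left; apply/eqP; field; rewrite gt_eqF.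
near=> n.
have nN : M * n.+1%:R^-1 <= e / 4 by near: n.
have h1 : `|moll2 n prim_x x t - moll n (prim_x x) t| <= e / 4.
  apply: E.
  - exact: mmolx.
  - exact: measurable_prim_x.
  - by exists (M * `|x| + M * n.+1%:R^-1); exact: molx_le.
  - by exists (M * `|x|); exact: px_le.
  - by move=> y; exact: (le_trans (molxP n x y)).
have h2 : `|moll n (prim_x x) t - moll n (prim_x (q m)) t| <= e / 4.
  apply: E.
  - exact: measurable_prim_x.
  - exact: measurable_prim_x.
  - by exists (M * `|x|); exact: px_le.
  - by exists (M * `|q m|); exact: px_le.
  - by move=> y; apply: (le_trans (prim_x_lip x (q m) y)).
have h3 : `|prim_x (q m) t - moll n (prim_x (q m)) t| <= e / 4 by near: n.
have h4 : `|prim_x x t - prim_x (q m) t| <= e / 4 by apply: (le_trans (prim_x_lip x (q m) t)).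
exact: dist4 h1 h2 h3 h4.
Unshelve. all: end_near. Qed.

End one_function.

Variables (v j : R -> R -> R) (M J : R).
Hypotheses (mv : mf2 v) (vM : forall x t, `|v x t| <= M).
Hypotheses (mj : mf2 j) (jJ : forall x t, `|j x t| <= J).
Hypothesis weak : forall n (a b c d : R), n.+1%:R^-1 < c -> n.+1%:R^-1 < d ->
  I2 (fun x t => v x t * (bump n a b x 0 * bump n c d t 1)) +
  I2 (fun t x => j x t * (bump n c d t 0 * bump n a b x 1)) = 0.

Definition jt t x := j x t.

(** Its mixed second difference over the corners of a rectangle is a mass balance: the change of the
    integral of [v] over [[a, b]] from time [c] to [d], plus the net outflow of [j] through the two
    sides. *)
Definition PS x t := prim_x v x t + prim_x jt t x.

(** The mollified primitive of [v] converges at good times for every position, that of [j] at good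
    positions for every time; corners with both coordinates good suit both. *)
Lemma rectangle : exists X T : set R, [/\
  {ae mu, forall x, X x}, {ae mu, forall t, T t} &
  forall a b c d, X a -> X b -> T c -> T d -> 0 < c -> 0 < d ->
    PS a c - PS b c - PS a d + PS b d = 0].
Proof.
exists [set x | forall t, moll2 n (prim_x jt) t x @[n --> \oo] --> prim_x jt t x].
exists [set t | forall x, moll2 n (prim_x v) x t @[n --> \oo] --> prim_x v x t].
split.
- exact: (moll2_cvg (mf2_swap mj) (fun t x => jJ x t)).
- exact: (moll2_cvg mv vM).
move=> a b c d /= Xa Xb Tc Td c0 d0.
pose w n (P : R -> R -> R) a b c d := moll2 n P a c - moll2 n P b c - moll2 n P a d + moll2 n P b d.
have H1 : w n (prim_x v) a b c d @[n --> \oo] -->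
    prim_x v a c - prim_x v b c - prim_x v a d + prim_x v b d.
  apply: cvgD; [apply: cvgB; [apply: cvgB|]|]; [exact: Tc|exact: Tc|exact: Td|exact: Td].
have H2 : w n (prim_x jt) c d a b @[n --> \oo] -->
    prim_x jt c a - prim_x jt d a - prim_x jt c b + prim_x jt d b.
  apply: cvgD; [apply: cvgB; [apply: cvgB|]|]; [exact: Xa|exact: Xa|exact: Xb|exact: Xb].
have H : w n (prim_x v) a b c d + w n (prim_x jt) c d a b @[n --> \oo] -->
    prim_x v a c - prim_x v b c - prim_x v a d + prim_x v b d +
    (prim_x jt c a - prim_x jt d a - prim_x jt c b + prim_x jt d b).
  exact: cvgD H1 H2.
have H0 : w n (prim_x v) a b c d + w n (prim_x jt) c d a b @[n --> \oo] --> (0 : R).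
  apply: (@cvg_trans _ ((fun=> 0 : R) n @[n --> \oo])); last exact: cvg_cst.
  apply: near_eq_cvg.
  have m0 : 0 < Num.min c d by rewrite lt_min c0.
  have /cvgrPdist_lt/(_ _ m0) := @cvg_harmonic R; apply: filterS => n.
  rewrite sub0r normrN ger0_norm ?invr_ge0// lt_min => /andP[nc nd].
  have := weak a b nc nd.
  rewrite (I2_bump mv vM) (I2_bump (mf2_swap mj) (fun t x => jJ x t)).
  by rewrite -opprD => /eqP; rewrite oppr_eq0 => /eqP.
have G (p q r s p' q' r' s' : R) : p - q - r + s + (p' - r' - q' + s') = 0 ->
  (p + p') - (q + q') - (r + r') + (s + s') = 0 by lra.
apply: G; exact: (cvg_unique (@norm_hausdorff _ _) H H0).
Qed.

End rectangle.

(** * Construction of the potential *)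

Section potential.
Context {R : realType}.
Local Notation mu := (@lebesgue_measure R).

Lemma ae_point (P : R -> Prop) (a b : R) : {ae mu, forall x, P x} -> a < b ->
  exists2 x, a < x < b & P x.
Proof.
move=> [N [mN N0 PN]] ab; apply: contrapT => h.
have : (mu `]a, b[ <= mu N)%E.
  apply: le_measure; rewrite ?inE//.
  move=> x /=; rewrite in_itv/= => xab; apply: contrapT => Nx; apply: h; exists x => //; apply: contrapT => nP; exact/Nx/PN.
by rewrite N0 lebesgue_measure_itv/= lte_fin ab -EFinB lee_fin leNgt subr_gt0 ab.
Qed.

Lemma ae_near (P : R -> Prop) (a d : R) : {ae mu, forall x, P x} -> 0 < d ->
  exists2 x, a < x < a + d & P x.
Proof. by move=> aP d0; have ad : a < a + d; [rewrite ltrDl|exact: ae_point aP ad]. Qed.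

Variables (v j : R -> R -> R) (M J : R).
Hypotheses (mv : mf2 v) (vM : forall x t, `|v x t| <= M).
Hypotheses (mj : mf2 j) (jJ : forall x t, `|j x t| <= J).
Hypothesis weak : forall n (a b c d : R), n.+1%:R^-1 < c -> n.+1%:R^-1 < d ->
  I2 (fun x t => v x t * (bump n a b x 0 * bump n c d t 1)) +
  I2 (fun t x => j x t * (bump n c d t 0 * bump n a b x 1)) = 0.

Let M0 : 0 <= M. Proof. exact: le_trans (normr_ge0 _) (vM 0 0). Qed.
Let J0 : 0 <= J. Proof. exact: le_trans (normr_ge0 _) (jJ 0 0). Qed.

(* [U] is the potential, normalised so that it agrees with the primitive of [v]
   in x at good times, and extended to all times by McShane's formula. *)
Lemma potential_exists : exists (U : R -> R -> R) (K : R), [/\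
  forall x t y s, `|U x t - U y s| <= K * (`|x - y| + `|t - s|),
  {ae mu, forall t, 0 < t -> {ae mu, forall x : R, is_derive x 1 (fun x => U x t) (v x t)}} &
  {ae mu, forall x, {ae mu, forall t : R, 0 < t -> is_derive t 1 (U x) (- j x t)}}].
Proof.
have [X [T [aX aT H]]] := rectangle mv vM mj jJ weak.
have [x0 _ Xx0] := ae_near 0 aX ltr01.
have [t0 /andP[t00 _] Tt0] := ae_near 0 aT ltr01.
pose D := prim_x v; pose S x t := prim_x (jt j) t x.
have DL x y t : `|D x t - D y t| <= M * `|x - y| by exact: prim_x_lip.
have SL x t s : `|S x t - S x s| <= J * `|t - s| by exact: (prim_x_lip (mf2_swap mj) (fun t x => jJ x t)).
(* Integration of [v dx - j dt] from [(x0, t0)], along the line at [x0] up to time [t], then in [x].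
   By the rectangle identity the other path gives the same value at good points. *)
pose L x t := D x t - D x0 t - (S x0 t - S x0 t0).
pose K x := D x t0 + S x t0 - D x0 t0.
pose G t := T t /\ 0 < t.
have G0 : G t0 by [].
have LX x t : X x -> G t -> L x t = K x - S x t.
  move=> Xx [Tt tgt0]; have := H _ _ _ _ Xx Xx0 Tt Tt0 tgt0 t00.
  rewrite /PS -/(D x t) -/(D x0 t) -/(D x t0) -/(D x0 t0) -/(S x t) -/(S x0 t) -/(S x t0) -/(S x0 t0) /L /K.
  move: (D x t) (D x0 t) (D x t0) (D x0 t0) (S x t) (S x0 t) (S x t0) (S x0 t0) => *; lra.
have LLx x y t : `|L x t - L y t| <= M * `|x - y|.
  rewrite (_ : L x t - L y t = D x t - D y t)//.
  by rewrite /L; move: (D x t) (D x0 t) (S x0 t) (S x0 t0) (D y t) => *; ring.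
(* At a good position this is the Lipschitz bound of [S]; an arbitrary [x] is approximated by good
   positions. *)
have LLt x t s : G t -> G s -> `|L x t - L x s| <= J * `|t - s|.
  move=> Gt Gs; apply/ler_addgt0Pr => e e0.
  have d0 : 0 < e / (2 * (M + 1)) by rewrite divr_gt0// mulr_gt0// ltr_wpDl.
  have [y /andP[xy yx] Xy] := ae_near x aX d0.
  have hy : M * `|x - y| <= e / 2.
    apply: (@le_trans _ _ ((M + 1) * (e / (2 * (M + 1))))).
      apply: ler_pM => //; first by rewrite lerDl.
      by rewrite distrC ger0_norm; lra.
    by rewrite le_eqVlt; apply/orP; left; apply/eqP; field; rewrite gt_eqF// ltr_wpDl.
  have h1 := le_trans (LLx x y t) hy; have h2 := le_trans (LLx x y s) hy.
  have h3 : `|L y t - L y s| <= J * `|t - s|.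
    rewrite !LX// (_ : K y - S y t - (K y - S y s) = S y s - S y t) 1?distrC//.
    by move: (K y) (S y t) (S y s) => *; ring.
  move: h1 h2 h3; move: (J * _) (L x t) (L x s) (L y t) (L y s) => B a b c d.
  rewrite !ler_norml => /andP[? ?] /andP[? ?] /andP[? ?]; apply/andP; split; lra.
pose A x t := [set L x r + J * `|t - r| | r in G].
pose U x t := inf (A x t).
have tri (a b c : R) : J * `|a - b| <= J * `|a - c| + J * `|c - b|.
  by rewrite -mulrDr; apply: ler_wpM2l => //; exact: ler_distD.
have nrm (B z : R) : `|z| <= B -> z <= B /\ - B <= z by rewrite ler_norml => /andP[].
have hlb x t r : G r -> L x t0 - J * `|t - t0| <= L x r + J * `|t - r|.
  move=> Gr; have [_ h1] := nrm _ _ (LLt x r t0 Gr G0); have h2 := tri r t0 t.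
  by rewrite [`|r - t|]distrC in h2; lra.
have Ule x t r : G r -> U x t <= L x r + J * `|t - r|.
  move=> Gr; apply: ge_inf; last by exists r.
  by exists (L x t0 - J * `|t - t0|) => _ [r' Gr' <-]; exact: hlb.
have Uge x t m : (forall r, G r -> m <= L x r + J * `|t - r|) -> m <= U x t.
  move=> hm; apply: lb_le_inf; first by exists (L x t0 + J * `|t - t0|), t0.
  by move=> _ [r Gr <-]; exact: hm.
have UL x t : G t -> U x t = L x t.
  move=> Gt; apply/eqP; rewrite eq_le; apply/andP; split.
    by have := Ule x t t Gt; rewrite subrr normr0 mulr0 addr0.
  apply: Uge => r Gr; have [h1 _] := nrm _ _ (LLt x t r Gt Gr); lra.
have Uup x t y s : U x t - U y s <= M * `|x - y| + J * `|t - s|.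
  rewrite lerBlDr -lerBlDl; apply: Uge => r Gr.
  have h1 := Ule x t r Gr; have [h2 _] := nrm _ _ (LLx x y r); have h3 := tri t r s; lra.
exists U, (M + J); split.
- have UL' x t y s : `|U x t - U y s| <= M * `|x - y| + J * `|t - s|.
    rewrite ler_norml lerNl opprB; apply/andP; split; last exact: Uup.
    by have := Uup y s x t; rewrite [`|y - x|]distrC [`|s - t|]distrC.
  move=> x t y s; apply: (le_trans (UL' x t y s)); rewrite mulrDr !mulrDl.
  have h1 : 0 <= J * `|x - y| by rewrite mulr_ge0.
  have h2 : 0 <= M * `|t - s| by rewrite mulr_ge0.
  lra.
- apply: aeS aT => t Tt tgt0.
  have := prim_is_derive (mf2_x t (mf2_swap mv)) (vM^~ t).
  apply: aeS => x dx.
  apply: (is_derive_cast (is_deriveD dx (is_derive_cst (- D x0 t - (S x0 t - S x0 t0)) x 1))).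
    by move=> y; rewrite UL//= /L addrA.
  by rewrite addr0.
- apply: aeS aX => x Xx.
  (* True at good times by construction of the extension, and at all positive times because good
     times are dense and both sides are continuous in [t]. *)
  have US t : 0 < t -> U x t = K x - S x t.
    move=> tgt0; apply/eqP; rewrite -subr_eq0 -normr_eq0 eq_le normr_ge0 andbT.
    apply/ler_addgt0Pr => e e0; rewrite add0r.
    have d0 : 0 < e / (2 * (J + 1)) by rewrite divr_gt0// mulr_gt0// ltr_wpDl.
    have [s /andP[ts st] Ts] := ae_near t aT d0.
    have Gs : G s by split=> //; exact: lt_trans ts.
    have hs : J * `|t - s| <= e / 2.
      apply: (@le_trans _ _ ((J + 1) * (e / (2 * (J + 1))))).
        apply: ler_pM => //; first by rewrite lerDl.
        by rewrite distrC ger0_norm; lra.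
      by rewrite le_eqVlt; apply/orP; left; apply/eqP; field; rewrite gt_eqF// ltr_wpDl.
    have h1 := Uup x t x s; have h2 := Uup x s x t.
    rewrite subrr normr0 mulr0 add0r in h1 h2; rewrite [`|s - t|]distrC in h2.
    have [h3 h4] := nrm _ _ (SL x t s).
    have h5 := LX x s Xx Gs; have h6 := UL x s Gs.
    move: h1 h2 h3 h4 h5 h6 hs; move: (J * _) (U x t) (U x s) (L x s) (S x t) (S x s) (K x) => *.
    rewrite ler_norml; apply/andP; split; lra.
  have := prim_is_derive (mf2_x x mj) (jJ x).
  apply: aeS => t dt tgt0.
  have dS : is_derive t 1 (fun t => K x + - S x t) (- j x t).
    apply: (is_derive_cast (is_deriveD (is_derive_cst (K x) t 1) (is_deriveN dt))) => //.
    by rewrite add0r.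
  apply: (@is_derive_near _ _ _ _ _ _ tgt0 _ dS) => s hs.
  by apply: US; move: hs; rewrite ltr_distl subrr => /andP[].
Qed.

End potential.

Section entropy_potential.
Context {R : realType}.
Local Notation mu := (@lebesgue_measure R).
Variables (u0 : R -> R) (u : R * R -> R).
Hypothesis hu : entropy_solution (@burgers_flux R) u0 u.

Lemma weak_bump (v : R -> R -> R) (M : R) n (a b c d : R) :
  mf2 v -> (forall x t, `|v x t| <= M) ->
  {ae mu, forall t, 0 <= t -> {ae mu, forall x, u (x, t) = v x t}} ->
  n.+1%:R^-1 < c -> n.+1%:R^-1 < d ->
  I2 (fun x t => v x t * (bump n a b x 0 * bump n c d t 1)) +
  I2 (fun t x => v x t ^+ 2 / 2 * (bump n c d t 0 * bump n a b x 1)) = 0.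
Proof.
move=> mv vM uv hc hd; have [[hL hw] _] := hu.
have m0 : 0 < Num.min c d - n.+1%:R^-1 by rewrite subr_gt0 lt_min hc.
have mb : measurable_fun setT (@burgers_flux R).
  by apply: measurable_funM => //; exact: measurable_funX.
have sx := bump_smooth n a b; have st := bump_smooth n c d.
have bb : exists C : R, forall z, `|z| <= M -> `|id z| <= C /\ `|burgers_flux z| <= C.
  exists (M + M ^+ 2) => z zM; have M0 := le_trans (normr_ge0 _) zM; split=> /=.
    by rewrite (le_trans zM)// lerDl sqr_ge0.
  rewrite /burgers_flux normrM normrX ger0_norm ?invr_ge0//.
  move: (`|z|) (normr_ge0 z) zM => r r0 rM; nra.
have [_ E] := weak_form_tensor u0 hL (@measurable_id _ _ setT) mb mv vM bb uv sx st
  (fun k x => @bump_out _ n a b x k) (fun k x => @bump_out _ n c d x k) m0.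
have := hw _ (tensor_test sx st (fun x => @bump_out _ n a b x 0) (fun x => @bump_out _ n c d x 0)).
move=> h; have {}E := EFin_inj (etrans (esym E) h).
have mb2 : mf2 (fun x t => burgers_flux (v x t)) by exact: measurableT_comp.
have [C hC] := bb.
have bC x t : `|burgers_flux (v x t)| <= C by have [] := hC _ (vM x t).
move: E; rewrite I2_D; [|exact: bump2M_bcs2 vM|exact: bump2M_bcs2 bC].
move=> E; apply: etrans E; apply: (f_equal2 +%R); first by [].
rewrite [RHS]I2_swap; last exact: bump2M_bcs2 bC.
apply: (congr1 I); apply/funext => t; apply: (congr1 I); apply/funext => x.
by rewrite /burgers_flux [2^-1 * _]mulrC [bump n a b x 1 * _]mulrC.
Qed.

Lemma entropy_potential : exists (v U : R -> R -> R) (M K : R),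
  [/\ mf2 v, forall x t, `|v x t| <= M &
    {ae mu, forall t, 0 <= t -> {ae mu, forall x, u (x, t) = v x t}}] /\
  [/\ forall x t y s, `|U x t - U y s| <= K * (`|x - y| + `|t - s|),
  {ae mu, forall t, 0 < t -> {ae mu, forall x : R, is_derive x 1 (fun x => U x t) (v x t)}},
  {ae mu, forall x, {ae mu, forall t : R, 0 < t -> is_derive t 1 (U x) (- (v x t ^+ 2 / 2))}},
  forall n x t, n.+1%:R^-1 < t -> pair_test n v (fun x t => v x t ^+ 2 / 2) x t = 0 &
  forall n x t, n.+1%:R^-1 < t ->
    0 <= pair_test n (fun x t => v x t ^+ 2 / 2) (fun x t => v x t ^+ 3 / 3) x t].
Proof.
have [[hL _] _] := hu.
have [M [v [M0 mv vM uv]]] := bounded_representative hL.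
have mj : mf2 (fun x t => v x t ^+ 2 / 2).
  by apply: measurable_funM => //; exact: measurable_funX.
have jJ x t : `|v x t ^+ 2 / 2| <= M ^+ 2 / 2.
  rewrite normrM normrX (@ger0_norm _ 2^-1) ?invr_ge0// ler_wpM2r ?invr_ge0//.
  by rewrite lerXn2r// nnegrE// ltW.
have [U [K [h1 h2 h3]]] := potential_exists mv vM mj jJ (fun n a b c d => weak_bump a b mv vM uv).
exists v, U, M, K; split; split=> //.
- by move=> n x t ht; exact: (conservation_pair mv vM uv hu x ht).
- by move=> n x t ht; exact: (entropy_pair_ge0 mv vM uv hu x ht).
Qed.

End entropy_potential.

(** * Absolutely continuous and Lipschitz functions *)

Section absolute_continuity.
Context {R : realType}.
Local Notation mu := (@lebesgue_measure R).

(** Induction along an interval: the supremum of the times where [A] holds satisfies [A] by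
    closedness from the left, and the forward step prevents it from lying before [b]. *)
Lemma creep (A : R -> Prop) (a b : R) : a <= b -> A a ->
  (forall c, a <= c <= b -> (forall e, 0 < e -> exists t, [/\ A t, a <= t <= c & c - e < t]) -> A c) ->
  (forall c, a <= c < b -> A c -> exists t, [/\ A t, c < t & t <= b]) -> A b.
Proof.
move=> ab Aa Acl Afw.
pose B := [set t | a <= t <= b /\ A t].
have Ba : B a by split=> //; rewrite lexx.
have ubB : has_ubound B by exists b => t [/andP[]].
have hsB : has_sup B by split=> //; exists a.
set c := sup B.
have ac : a <= c by exact: ub_le_sup.
have cb : c <= b by apply: ge_sup; [exists a|move=> t [/andP[]]].
have Ac : A c.
  apply: Acl; first by rewrite ac.
  move=> e e0; have [t [/andP[at1 tb] At] ct] := sup_adherent e0 hsB.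
  by exists t; split=> //; rewrite at1/=; apply: ub_le_sup => //; split=> //; rewrite at1.
move: cb; rewrite le_eqVlt => /predU1P[<-//|cb].
have [|t [At ct tb]] := Afw c _ Ac; first by rewrite ac.
have : t <= c by apply: ub_le_sup => //; split=> //; rewrite tb andbT (le_trans ac)// ltW.
by rewrite leNgt ct.
Qed.

Section ac_le.
Variables (f : R -> R) (a : R) (O : set R).

(* [fam t L V]: a finite chain of intervals inside [O], of total length [L],
   lying between [a] and [t], over which [f] varies by [V]. *)
Inductive fam : R -> R -> R -> Prop :=
| fam_nil : fam a 0 0
| fam_skip t L V t' : fam t L V -> t <= t' -> fam t' L V
| fam_add t L V t' : fam t L V -> t <= t' -> `[t, t'] `<=` O ->
    fam t' (L + (t' - t)) (V + `|f t' - f t|).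

Lemma fam_ge t L V : fam t L V -> a <= t.
Proof. by elim=> // {}t {}L {}V t' _ at1 tt' => [|_]; exact: le_trans tt'. Qed.

Lemma fam_length t L V : open O -> fam t L V -> (L%:E <= mu (O `&` `[a, t]))%E.
Proof.
move=> oO; have mO := open_measurable oO.
have mOt (c d : R) : measurable (O `&` `[c, d]) by apply: measurableI => //; exact: measurable_itv.
elim=> [//|{}t {}L {}V t' _ IH tt'|{}t {}L {}V t' F IH tt' ttO].
  apply: (le_trans IH); apply: le_measure; [rewrite inE; exact: mOt|rewrite inE; exact: mOt|].
  by apply: setIS; apply: subset_itvl; rewrite bnd_simp.
have -> : O `&` `[a, t'] = (O `&` `[a, t]) `|` `]t, t'].
  apply/seteqP; split=> z /=; rewrite !in_itv/=.
    by move=> [Oz /andP[az zt']]; have [zt|tz] := leP z t; [left; rewrite az|right].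
  case=> [[Oz /andP[az zt]]|/andP[tz zt']]; first by rewrite az (le_trans zt tt').
  split; first by apply: ttO; rewrite /= in_itv/= (ltW tz).
  by rewrite zt' (le_trans (fam_ge F) (ltW tz)).
have dis : (O `&` `[a, t]) `&` `]t, t'] = set0.
  apply/seteqP; split=> z //= -[[_]]; rewrite !in_itv/= => /andP[_ zt] /andP[tz _].
  by move: tz; rewrite ltNge zt.
have h : ((t' - t)%:E <= mu `]t, t'])%E.
  rewrite lebesgue_measure_itv/= lte_fin; case: ltP => //= t't.
  by rewrite lee_fin subr_le0.
by rewrite (measureU mu (mOt _ _) (measurable_itv _) dis) EFinD; exact: leeD IH h.
Qed.

(** Unrolls a chain into the indexed disjoint intervals to which [absolutely_continuous] applies. *)
Lemma famP t L V : fam t L V -> exists (n : nat) (l r : nat -> R),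
  [/\ forall i, (i < n)%N -> [/\ a <= l i, l i <= r i & r i <= t],
      forall i k, (i < k < n)%N -> r i <= l k,
      \sum_(i < n) (r i - l i) = L & \sum_(i < n) `|f (r i) - f (l i)| = V].
Proof.
elim=> [|{}t {}L {}V t' _ [n [l [r [h1 h2 h3 h4]]]] tt'|{}t {}L {}V t' F [n [l [r [h1 h2 h3 h4]]]] tt' _].
- by exists 0%N, (fun=> 0), (fun=> 0); split; rewrite ?big_ord0// => i k; rewrite ltn0 andbF.
- by exists n, l, r; split=> // i /h1[? ? h]; split=> //; exact: le_trans tt'.
exists n.+1, (fun i => if i == n then t else l i), (fun i => if i == n then t' else r i).
have E (G : R -> R -> R) : \sum_(i < n.+1) G (if val i == n then t' else r i) (if val i == n then t else l i) =
    \sum_(i < n) G (r i) (l i) + G t' t.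
  rewrite big_ord_recr/= eqxx; congr (_ + _); apply: eq_bigr => i _ /=.
  by rewrite (ltn_eqF (ltn_ord i)).
split.
- move=> i; rewrite ltnS leq_eqVlt => /predU1P[->|i_n].
    by rewrite eqxx; split=> //; exact: fam_ge F.
  by rewrite (ltn_eqF i_n); have [? ? h] := h1 _ i_n; split=> //; exact: le_trans tt'.
- move=> i k /andP[ik]; rewrite ltnS leq_eqVlt => /predU1P[kn|k_n].
    by subst k; rewrite eqxx (ltn_eqF ik); have [] := h1 _ ik.
  by rewrite (ltn_eqF k_n) (ltn_eqF (ltn_trans ik k_n)); apply: h2; rewrite ik.
- by rewrite (E (fun r l => r - l)) h3.
- by rewrite (E (fun r l => `|f r - f l|)) h4.
Qed.

End ac_le.

Lemma ac_continuous (f : R -> R) (a b : R) : absolutely_continuous `[a, b] f ->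
  forall e, 0 < e -> exists2 d, 0 < d & forall x y, a <= x -> x <= y -> y <= b -> y - x < d -> `|f y - f x| < e.
Proof.
move=> acf e e0; have [d d0 Hd] := acf e e0; exists d => // x y ax xy yb xyd.
have := Hd 1%N (fun=> x) (fun=> y); rewrite !big_ord1; apply=> //.
  by move=> _; split=> //; rewrite /= in_itv/= ?ax ?yb ?andbT//; [exact: le_trans yb|exact: le_trans xy].
by apply/trivIsetP => i k _ _; rewrite (ord1 i) (ord1 k) eqxx.
Qed.

(* A Dini derivative is enough: at almost every point, arbitrarily short steps
   to the right with slope at most [C + e]. *)
Lemma ac_le (f : R -> R) (a b C : R) : a <= b -> absolutely_continuous `[a, b] f ->
  {ae mu, forall t, a < t < b -> forall e d, 0 < e -> 0 < d ->
     exists2 h, 0 < h < d & f (t + h) - f t <= (C + e) * h} ->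
  f b - f a <= C * (b - a).
Proof.
move=> ab acf [N [mN N0 NP]]; apply/ler_addgt0Pr => e' e'0.
pose e := e' / (b - a + 2).
have ba1 : 0 < b - a + 2 by rewrite ltr_wpDl// subr_ge0.
have e0 : 0 < e by rewrite divr_gt0.
have [d0 d00 Hd] := acf e e0.
have C1 : 0 < `|C| + 1 by rewrite ltr_wpDl.
pose d := Num.min d0 (e / (`|C| + 1)).
have d_gt0 : 0 < d by rewrite lt_min d00 divr_gt0.
(* The endpoints, where nothing is assumed on the derivative, are treated as bad points. *)
pose N' := N `|` [set a; b].
have mN' : measurable N' by apply: measurableU => //; exact: measurableU.
have N'0 : mu N' = 0.
  have mab : measurable [set a; b] by exact: measurableU.
  have ab0 : mu [set a; b] = 0 by apply: countable_lebesgue_measure0; exact/finite_set_countable/finite_set2.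
  by rewrite /N' measureU0.
have N'y : (mu N' < +oo)%E by rewrite N'0.
have [W [oW NW muW]] := lebesgue_regularity_outer mN' N'y d_gt0.
have mW := open_measurable oW.
have {}muW : (mu W < d%:E)%E.
  have -> : W = (W `\` N') `|` N' by rewrite setUC setDUK.
  apply: le_lt_trans muW; rewrite -[leRHS]adde0 -N'0.
  by apply: measureU2 => //; exact: measurableD.
(* The supremum of [S t] is a budget for crossing the bad set: the variation of [f] on intervals
   inside [W], plus [|C|] times their length to offset the term [C * (t - a)] when [C] is negative.
   Absolute continuity and the smallness of [W] keep it below [2 * e]. *)
pose S t := [set x | exists L V, fam f a W t L V /\ x = V + `|C| * L].
have Sle t x : t <= b -> S t x -> x <= e * 2.
  move=> tb [L [V [F ->]]].
  have [n [l [r [h1 h2 h3 h4]]]] := famP F.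
  have Ld' : L < d.
    rewrite -lte_fin; apply: le_lt_trans muW; apply: (le_trans (fam_length oW F)).
    by apply: le_measure; rewrite ?inE//; apply: measurableI => //; exact: measurable_itv.
  have [Ld CL] : L < d0 /\ `|C| * L <= e.
    move: Ld'; rewrite /d lt_min => /andP[-> h]; split=> //.
    apply: (@le_trans _ _ (`|C| * (e / (`|C| + 1)))); first by rewrite ler_wpM2l// ltW.
    by rewrite mulrA ler_pdivrMr// mulrC ler_pM2l// lerDl.
  have Ve : V < e.
    rewrite -h4; apply: Hd.
    - move=> i; have [k1 k2 k3] := h1 _ (ltn_ord i); split=> //=; rewrite in_itv/=.
        by rewrite k1 (le_trans k2)// (le_trans k3).
      by rewrite (le_trans k3)// andbT (le_trans k1).
    - apply/trivIsetP => i k _ _ ik; apply/seteqP; split=> z //= -[].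
      rewrite !in_itv/= => /andP[i1 i2] /andP[k1 k2].
      have : (i < k)%N || (k < i)%N by rewrite -neq_ltn.
      case/orP => h; [have := h2 i k|have := h2 k i]; rewrite h ltn_ord/= => /(_ isT); lra.
    - by rewrite h3.
  by rewrite mulr_natr mulr2n; apply: lerD => //; exact: ltW.
have S0 : S a 0 by exists 0, 0; split; [exact: fam_nil|rewrite mulr0 addr0].
have Smon t t' : t <= t' -> S t `<=` S t'.
  by move=> tt' x [L [V [F ->]]]; exists L, V; split=> //; exact: fam_skip F tt'.
pose Vs t := sup (S t).
have hsS t : a <= t -> t <= b -> has_sup (S t).
  by move=> at0 tb; split; [exists 0; exact: Smon at0 _ S0|exists (e * 2) => x; exact: Sle].
have Vsmon t t' : a <= t -> t <= t' -> t' <= b -> Vs t <= Vs t'.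
  move=> at0 tt' t'b; apply: ge_sup; first by exists 0; exact: Smon at0 _ S0.
  move=> x /(Smon _ _ tt') Sx; apply: ub_le_sup => //.
  by have [] := hsS t' (le_trans at0 tt') t'b.
(* At a point of [W] a short interval inside [W] is charged to the budget [Vs]; at any other point
   the Dini hypothesis provides a step with slope at most [C + e]. *)
have key : f b - f a <= (C + e) * (b - a) + Vs b.
  apply: (@creep (fun t => f t - f a <= (C + e) * (t - a) + Vs t) a b ab).
  - rewrite !subrr mulr0 add0r; apply: ub_le_sup => //; by have [] := hsS a (lexx a) ab.
  - move=> c /andP[ac cb] H; apply/ler_addgt0Pr => r r0.
    have r2 : 0 < r / 2 by rewrite divr_gt0.
    have [p p0 Hp] := ac_continuous acf r2.
    have Ce : 0 < `|C + e| + 1 by rewrite ltr_wpDl.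
    have q0 : 0 < Num.min p (r / 2 / (`|C + e| + 1)) by rewrite lt_min p0 divr_gt0.
    have [t [h1 /andP[at0 tc] h2]] := H _ q0.
    have h3 : c - t < Num.min p (r / 2 / (`|C + e| + 1)) by lra.
    move: h3; rewrite lt_min => /andP[h3 h4].
    have := Hp t c at0 tc cb h3; rewrite ltr_norml => /andP[_ h5].
    have h6 := Vsmon _ _ at0 tc cb.
    have h7 : - (C + e) * (c - t) <= r / 2.
      apply: (@le_trans _ _ ((`|C + e| + 1) * (c - t))).
        rewrite ler_wpM2r ?subr_ge0//; have := ler_norm (- (C + e)); rewrite normrN; lra.
      by rewrite mulrC -ler_pdivlMr// ltW.
    have E : (C + e) * (c - a) = (C + e) * (t - a) - (- (C + e) * (c - t)) by ring.
    rewrite E; lra.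
  move=> c /andP[ac cb] H; have cb' := ltW cb.
  have [pW|pW] := pselect (W c).
    have /nbhs_ballP[r /= r0 rW] := open_nbhs_nbhs (conj oW pW).
    pose t := Num.min b (c + r / 2).
    have r2 : 0 < r / 2 by rewrite divr_gt0.
    have ct : c < t by rewrite /t lt_min cb ltrDl.
    have tr : t < c + r by rewrite /t gt_min ltrD2l ltr_pdivrMr// mulr_natr mulr2n ltrDl r0 orbT.
    have tb : t <= b by rewrite /t ge_min lexx.
    exists t; split=> //.
    have h1 : Vs c <= Vs t - (`|f t - f c| + `|C| * (t - c)).
      apply: ge_sup; first by exists 0; exact: Smon ac _ S0.
      move=> x [L [V [F ->]]]; rewrite lerBrDr; apply: ub_le_sup.
        by have [] := hsS t (le_trans ac (ltW ct)) tb.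
      exists (L + (t - c)), (V + `|f t - f c|); split; last by ring.
      apply: fam_add F (ltW ct) _ => z; rewrite /= in_itv/= => /andP[z1 z2]; apply: rW.
      by rewrite /ball/= ltr_distlC; apply/andP; split; lra.
    have t12 : 0 <= t - c by rewrite subr_ge0 ltW.
    have k1 : (- `|C|) * (t - c) <= C * (t - c) by rewrite ler_wpM2r// lerNl -normrN ler_norm.
    have k2 : 0 <= e * (t - c) by rewrite mulr_ge0// ltW.
    have k3 := ler_norm (f t - f c).
    have E : (C + e) * (t - a) = (C + e) * (c - a) + C * (t - c) + e * (t - c) by ring.
    rewrite E; lra.
  have [pN pa pb] : [/\ ~ N c, c <> a & c <> b].
    by split=> h; apply: pW; apply: NW; [left|right; left|right; right].
  have cab : a < c < b by rewrite cb andbT lt_neqAle ac andbT; apply/eqP => /esym.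
  have [h /andP[h0 hb] hh] : exists2 h, 0 < h < b - c & f (c + h) - f c <= (C + e) * h.
    have bc : 0 < b - c by rewrite subr_gt0.
    by apply: contrapT => h; apply: pN; apply: NP => /= /(_ cab _ _ e0 bc).
  have ch : c <= c + h by rewrite lerDl ltW.
  have hb' : c + h <= b by lra.
  exists (c + h); split=> //; last by rewrite ltrDl.
  have h6 := Vsmon _ _ ac ch hb'.
  have E : (C + e) * (c + h - a) = (C + e) * (c - a) + (C + e) * h by ring.
  rewrite E; lra.
apply: (le_trans key).
have Vse : Vs b <= e * 2.
  by apply: ge_sup; [exists 0; exact: Smon ab _ S0|move=> x; exact: Sle].
have -> : e' = e * (b - a) + e * 2 by rewrite /e; field; rewrite gt_eqF.
rewrite mulrDl; lra.
Qed.

End absolute_continuity.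

(** * Increments bounded through derivatives *)

Section derivative_bounds.
Context {R : realType}.
Local Notation mu := (@lebesgue_measure R).

Lemma lip_ac (f : R -> R) (K a b : R) : 0 <= K ->
  (forall x y, a <= x <= b -> a <= y <= b -> `|f x - f y| <= K * `|x - y|) ->
  absolutely_continuous `[a, b] f.
Proof.
move=> K0 fK e e0; have K1 : 0 < K + 1 by rewrite ltr_wpDl.
exists (e / (K + 1)); first exact: divr_gt0.
move=> n l r h _ hs.
apply: (@le_lt_trans _ _ (K * \sum_(i < n) (r i - l i))).
  rewrite mulr_sumr; apply: ler_sum => i _; have [] := h i.
  rewrite /= !in_itv/= => hl hr lr; apply: (le_trans (fK _ _ hr hl)).
  by rewrite ger0_norm ?subr_ge0.
have S0 : 0 <= \sum_(i < n) (r i - l i).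
  by apply: sumr_ge0 => i _; have [_ _] := h i; rewrite subr_ge0.
apply: (@le_lt_trans _ _ ((K + 1) * \sum_(i < n) (r i - l i))); first by rewrite ler_wpM2r// lerDl.
by rewrite mulrC -ltr_pdivlMr.
Qed.

Lemma is_derive_upper (f : R -> R) (t l C : R) : is_derive t 1 f l -> l <= C ->
  forall e d, 0 < e -> 0 < d -> exists2 h, 0 < h < d & f (t + h) - f t <= (C + e) * h.
Proof.
move=> /is_deriveP H lC e d e0 d0; have [d' d'0 Hd] := H e e0.
pose m := Num.min d d'.
have m0 : 0 < m by rewrite lt_min d0.
have m2 : 0 < m / 2 by rewrite divr_gt0.
have mm : m / 2 < m by rewrite ltr_pdivrMr// mulr_natr mulr2n ltrDl.
have [md md'] : m / 2 < d /\ m / 2 < d' by move: mm; rewrite {2}/m lt_min => /andP[].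
exists (m / 2); first by rewrite m2.
have := Hd (m / 2); rewrite (gtr0_norm m2) => /(_ md'); rewrite ler_norml => /andP[_ h1].
have lh : l * (m / 2) <= C * (m / 2) by rewrite ler_wpM2r// ltW.
move: (m / 2) h1 lh => h h1 lh; rewrite mulrDl; lra.
Qed.

Lemma ac_le_derive (f : R -> R) (a b C : R) : a <= b -> absolutely_continuous `[a, b] f ->
  {ae mu, forall t : R, a < t < b -> exists2 l, is_derive t 1 f l & l <= C} ->
  f b - f a <= C * (b - a).
Proof.
move=> ab acf H; apply: ac_le => //; apply: aeS H => t h tab; have [l dl lC] := h tab.
exact: is_derive_upper dl lC.
Qed.

Lemma acN (I : set R) (f : R -> R) : absolutely_continuous I f -> absolutely_continuous I (fun t => - f t).
Proof.
move=> acf e e0; have [d d0 Hd] := acf e e0; exists d => // n l r h tr hs.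
rewrite (eq_bigr (fun i => `|f (r i) - f (l i)|)); first exact: Hd.
by move=> i _; rewrite -opprD normrN.
Qed.

Lemma ac_sub (I J : set R) (f : R -> R) : J `<=` I -> absolutely_continuous I f -> absolutely_continuous J f.
Proof.
move=> JI acf e e0; have [d d0 Hd] := acf e e0; exists d => // n l r h.
by apply: Hd => i; have [/JI ? /JI ? ?] := h i.
Qed.

Lemma ac_ge_derive (f : R -> R) (a b C : R) : a <= b -> absolutely_continuous `[a, b] f ->
  {ae mu, forall t : R, a < t < b -> exists2 l, is_derive t 1 f l & C <= l} ->
  C * (b - a) <= f b - f a.
Proof.
move=> ab acf H.
have H' : {ae mu, forall t : R, a < t < b -> exists2 l, is_derive t 1 (fun t => - f t) l & l <= - C}.
  apply: aeS H => t h tab; have [l dl Cl] := h tab.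
  by exists (- l); [exact: is_deriveN|rewrite lerN2].
have := ac_le_derive ab (acN acf) H'; rewrite mulNr; lra.
Qed.

End derivative_bounds.

(** * Differentiability of Lipschitz functions almost everywhere *)

Section lipschitz_derivable.
Context {R : realType}.
Local Notation mu := (@lebesgue_measure R).

Lemma limn_sup_often (u : R^nat) (K e : R) n : (forall k, `|u k| <= K) -> 0 < e ->
  [/\ `|limn_sup u| <= K, exists2 k, (n <= k)%N & u k <= limn_sup u + e &
      exists2 k, (n <= k)%N & limn_sup u - e <= u k].
Proof.
move=> uK e0.
have bu : bounded_fun u by exists K; split; [exact: num_real|move=> z Kz k _; exact: le_trans (uK k) (ltW Kz)].
rewrite limn_supE//; set L := inf _.
have uK1 k : u k <= K by have := uK k; rewrite ler_norml => /andP[].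
have uK2 k : - K <= u k by have := uK k; rewrite ler_norml => /andP[].
have hs m : has_sup (sdrop u m).
  by split; [exists (u m), m => //=|exists K => _ [k _ <-]].
have us m k : (m <= k)%N -> u k <= sups u m.
  by move=> mk; apply: ub_le_sup; [case: (hs m)|exists k].
have sK m : sups u m <= K.
  by apply: ge_sup; [case: (hs m)|move=> _ [k _ <-]].
have sK2 m : - K <= sups u m by exact: le_trans (uK2 m) (us m m (leqnn m)).
have hi : has_inf (range (sups u)).
  by split; [exists (sups u 0%N), 0%N|exists (- K) => _ [m _ <-]].
have Ls m : L <= sups u m by apply: ge_inf; [case: hi|exists m].
split.
- rewrite ler_norml; apply/andP; split; last exact: le_trans (Ls 0%N) (sK _).
  by apply: lb_le_inf; [case: hi|move=> _ [m _ <-]].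
- have [_ [m _ <-] hm] := inf_adherent e0 hi.
  exists (maxn n m); first exact: leq_maxl.
  by apply: ltW; apply: le_lt_trans hm; apply: us; exact: leq_maxr.
- have [_ [k /= nk <-] hk] := sup_adherent e0 (hs n).
  exists k => //; apply: ltW; apply: le_lt_trans hk.
  by rewrite lerD2r; exact: Ls.
Qed.

(* The primitive of a limit superior of difference quotients of [f] differs
   from [f] by a function with a vanishing Dini derivative. *)
Lemma lip_ae_is_derive (f : R -> R) (K : R) : 0 <= K ->
  (forall x y, `|f x - f y| <= K * `|x - y|) ->
  {ae mu, forall x : R, exists l, is_derive x 1 f l}.
Proof.
move=> K0 fK.
(* A countable sequence of steps keeps the limit superior measurable. *)
pose q (m : nat) (x : R) := m.+1%:R * (f (x + m.+1%:R^-1) - f x).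
have mN m : 0 < m.+1%:R^-1 :> R by rewrite invr_gt0.
have qK m x : `|q m x| <= K.
  rewrite /q normrM ger0_norm// mulrC -ler_pdivlMr//.
  by apply: (le_trans (fK _ _)); rewrite addrC addKr ger0_norm// ltW.
have qK1 m x : q m x <= K by have := qK m x; rewrite ler_norml => /andP[].
have qK2 m x : - K <= q m x by have := qK m x; rewrite ler_norml => /andP[].
have cf := lip_cont K0 fK.
have mf := continuous_measurable_fun cf.
pose g (x : R) : R := limn_sup (q ^~ x).
have mg : measurable_fun setT g.
  apply: measurable_fun_limn_sup.
  - by move=> x _; exists K => _ [m _ <-].
  - by move=> x _; exists (- K) => _ [m _ <-].
  - move=> m; apply: measurable_funM => //; apply: measurable_funB => //.
    by apply: measurableT_comp => //; exact: measurable_funD.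
have gK x : `|g x| <= K by have [] := @limn_sup_often (q ^~ x) K 1 0%N (qK ^~ x) ltr01.
pose F x := f x - prim g x.
have FL x y : `|F x - F y| <= (K + K) * `|x - y|.
  rewrite (_ : F x - F y = (f x - f y) - (prim g x - prim g y)); last by rewrite /F; ring.
  by rewrite mulrDl (le_trans (ler_normB _ _))// lerD//; exact: prim_lip gK.
have FN x y : `|- F x - - F y| <= (K + K) * `|x - y|.
  by rewrite -opprD normrN.
have KK : 0 <= K + K by rewrite addr_ge0.
(* Arbitrarily far in the sequence some quotient is at most the limit superior plus [e / 2], which
   serves [F], and some quotient is at least the limit superior minus [e / 2], which serves
   [- F]. *)
have dini (x : R) : is_derive x 1 (prim g) (g x) -> forall e d, 0 < e -> 0 < d ->
    (exists2 h, 0 < h < d & F (x + h) - F x <= (0 + e) * h) /\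
    (exists2 h, 0 < h < d & - F (x + h) - - F x <= (0 + e) * h).
  move=> /is_deriveP dx e d e0 d0; have e2 : 0 < e / 2 by rewrite divr_gt0.
  have [d' d'0 Hd'] := dx _ e2.
  have dd : 0 < Num.min d d' by rewrite lt_min d0.
  have [N _ hN] : \forall n \near \oo, n.+1%:R^-1 < Num.min d d'.
    have /cvgrPdist_lt/(_ _ dd) := @cvg_harmonic R; apply: filterS => n.
    by rewrite sub0r normrN ger0_norm ?invr_ge0.
  have [_ [k Nk k1] [k' Nk' k2]] := @limn_sup_often (q ^~ x) K _ N (qK ^~ x) e2.
  split.
    have := hN k Nk; rewrite /= lt_min => /andP[h1 h2].
    exists k.+1%:R^-1; first by rewrite mN h1.
    have := Hd' k.+1%:R^-1; rewrite (gtr0_norm (mN k)) => /(_ h2).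
    rewrite ler_norml => /andP[h3 _].
    move: k1; rewrite /q -ler_pdivlMl// => k1.
    rewrite /F add0r; move: k1 h3; rewrite -/(g x).
    move: (k.+1%:R^-1) (f (x + _)) (prim g (x + _)) (f x) (prim g x) (g x) => i A B A' B' G *.
    rewrite (_ : e * i = i * (G + e / 2) - G * i + e / 2 * i); last by field.
    lra.
  have := hN k' Nk'; rewrite /= lt_min => /andP[h1 h2].
  exists k'.+1%:R^-1; first by rewrite mN h1.
  have := Hd' k'.+1%:R^-1; rewrite (gtr0_norm (mN k')) => /(_ h2).
  rewrite ler_norml => /andP[_ h3].
  move: k2; rewrite /q -ler_pdivrMl// => k2.
  rewrite /F add0r; move: k2 h3; rewrite -/(g x).
  move: (k'.+1%:R^-1) (f (x + _)) (prim g (x + _)) (f x) (prim g x) (g x) => i A B A' B' G *.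
  rewrite (_ : e * i = - (i * (G - e / 2)) + G * i + e / 2 * i); last by field.
  lra.
have dp := prim_is_derive mg gK.
have Fconst x y : x <= y -> F x = F y.
  move=> xy; apply/eqP; rewrite eq_le; apply/andP; split.
    have : - F y - - F x <= 0 * (y - x).
      apply: (@ac_le _ (fun z => - F z)) => //; first by apply: (lip_ac KK) => ? ? _ _; exact: FN.
      by apply: aeS dp => z dz _ e d e0 d0; have [] := dini z dz e d e0 d0.
    lra.
  have : F y - F x <= 0 * (y - x).
    apply: ac_le => //; first by apply: (lip_ac KK) => ? ? _ _; exact: FL.
    by apply: aeS dp => z dz _ e d e0 d0; have [] := dini z dz e d e0 d0.
  lra.
apply: aeS dp => x dx; exists (g x).
apply: (is_derive_cast (is_deriveD dx (is_derive_cst (F 0) x 1))); last by rewrite addr0.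
move=> y /=; have -> : F 0 = F y by have [/Fconst|/ltW/Fconst] := leP 0 y.
by rewrite /F -[RHS]/(prim g y + (f y - prim g y)) addrC subrK.
Qed.

End lipschitz_derivable.

(** * Envelopes of the speed *)

Section envelopes.
Context {R : realType}.
Local Notation mu := (@lebesgue_measure R).
Implicit Types (g : R -> R) (i : interval R) (a : R * R -> R).

Lemma ae_mrestrP i (P : R -> Prop) :
  {ae mrestr mu (measurable_itv i), forall x, P x} <-> {ae mu, forall x, x \in i -> P x}.
Proof.
have mi : measurable [set` i] := measurable_itv i.
split=> -[N [mN N0 PN]].
  exists (N `&` [set` i]); split=> //; first exact: measurableI.
  move=> x /= /not_implyP[xi nP]; split; [exact: PN|exact: xi].
exists (N `|` ~` [set` i]); split.
- by apply: measurableU => //; exact: measurableC.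
- rewrite /mrestr setIUl setICl setU0; apply/eqP; rewrite -measure_le0 -N0.
  by apply: le_measure; rewrite ?inE//; exact: measurableI.
- move=> x /= nP; have [xi|xi] := pselect (x \in i); last by right.
  by left; apply: PN => /= /(_ xi).
Qed.

Lemma ess_sup_onP i g (y : \bar R) :
  (ess_sup_on i g <= y)%E <-> {ae mu, forall x, x \in i -> ((g x)%:E <= y)%E}.
Proof.
rewrite -(ae_mrestrP i (fun x => ((g x)%:E <= y)%E)) /ess_sup_on.
by split=> [/ess_supP|h]; [|apply/ess_supP].
Qed.

Lemma ess_inf_onP i g (y : \bar R) :
  (y <= ess_inf_on i g)%E <-> {ae mu, forall x, x \in i -> (y <= (g x)%:E)%E}.
Proof.
rewrite -(ae_mrestrP i (fun x => (y <= (g x)%:E)%E)) /ess_inf_on.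
by split=> [/ess_infP|h]; [|apply/ess_infP].
Qed.

Let sub_itv (x d e z : R) : d <= e -> z \in `]x - d, x + d[ -> z \in `]x - e, x + e[.
Proof. by move=> de; rewrite !in_itv/= => /andP[? ?]; apply/andP; split; lra. Qed.

Lemma upper_envelopeE a x t : upper_envelope a x t =
  ereal_inf [set ess_sup_on `](x - d), (x + d)[ (fun y => a (y, t)) | d in [set d | 0 < d]].
Proof.
apply/cvg_lim => //.
have := @nondecreasing_at_right_cvge R
  (fun d => ess_sup_on `](x - d), (x + d)[ (fun y => a (y, t))) 0 (BInfty _ false).
have -> : [set` Interval (BRight (0 : R)) +oo%O] = [set d : R | 0 < d].
  by apply/seteqP; split=> d /=; rewrite in_itv/= andbT.
apply=> // d e _ _ de; apply/ess_sup_onP.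
have /ess_sup_onP := lexx (ess_sup_on `](x - e), (x + e)[ (fun y => a (y, t))).
by apply: aeS => z h /(sub_itv de) /h.
Qed.

Lemma lower_envelopeE a x t : lower_envelope a x t =
  ereal_sup [set ess_inf_on `](x - d), (x + d)[ (fun y => a (y, t)) | d in [set d | 0 < d]].
Proof.
apply/cvg_lim => //.
have := @nonincreasing_at_right_cvge R
  (fun d => ess_inf_on `](x - d), (x + d)[ (fun y => a (y, t))) 0 (BInfty _ false).
have -> : [set` Interval (BRight (0 : R)) +oo%O] = [set d : R | 0 < d].
  by apply/seteqP; split=> d /=; rewrite in_itv/= andbT.
apply=> // d e _ _ de; apply/ess_inf_onP.
have /ess_inf_onP := lexx (ess_inf_on `](x - e), (x + e)[ (fun y => a (y, t))).
by apply: aeS => z h /(sub_itv de) /h.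
Qed.

Lemma upper_envelope_le a (x t d y : R) : 0 < d ->
  {ae mu, forall z, x - d < z < x + d -> a (z, t) <= y} -> (upper_envelope a x t <= y%:E)%E.
Proof.
move=> d0 h; rewrite upper_envelopeE; apply: ge_ereal_inf.
exists (ess_sup_on `](x - d), (x + d)[ (fun y => a (y, t))); first by exists d.
by apply/ess_sup_onP; apply: aeS h => z; rewrite in_itv/= lee_fin.
Qed.

Lemma lower_envelope_ge a (x t d y : R) : 0 < d ->
  {ae mu, forall z, x - d < z < x + d -> y <= a (z, t)} -> (y%:E <= lower_envelope a x t)%E.
Proof.
move=> d0 h; rewrite lower_envelopeE; apply: le_ereal_sup_tmp.
exists (ess_inf_on `](x - d), (x + d)[ (fun y => a (y, t))); first by exists d.
by apply/ess_inf_onP; apply: aeS h => z; rewrite in_itv/= lee_fin.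
Qed.

Lemma upper_envelope_ge a (x t p : R) :
  (forall d y : R, 0 < d -> {ae mu, forall z, x - d < z < x + d -> a (z, t) <= y} -> p <= y) ->
  (p%:E <= upper_envelope a x t)%E.
Proof.
move=> H; rewrite upper_envelopeE; apply: le_ereal_inf_tmp => _ [d d0 <-].
have /ess_sup_onP := lexx (ess_sup_on `](x - d), (x + d)[ (fun y => a (y, t))).
case: (ess_sup_on _ _) => [y h|_|h]; last 2 first.
- by rewrite leey.
(* An essential supremum equal to [-oo] would bound [a] by every real number, in particular by
   [p - 1]. *)
- exfalso; suff : p <= p - 1 by lra.
  by apply: (H d) => //; apply: aeS h => z; rewrite in_itv/= => h /h; rewrite leeNy_eq.
by rewrite lee_fin; apply: (H d) => //; apply: aeS h => z; rewrite in_itv/= lee_fin.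
Qed.

Lemma lower_envelope_le a (x t p : R) :
  (forall d y : R, 0 < d -> {ae mu, forall z, x - d < z < x + d -> y <= a (z, t)} -> y <= p) ->
  (lower_envelope a x t <= p%:E)%E.
Proof.
move=> H; rewrite lower_envelopeE; apply: ge_ereal_sup => _ [d d0 <-].
have /ess_inf_onP := lexx (ess_inf_on `](x - d), (x + d)[ (fun y => a (y, t))).
case: (ess_inf_on _ _) => [y h|h|_]; last 2 first.
- exfalso; suff : p + 1 <= p by lra.
  by apply: (H d) => //; apply: aeS h => z; rewrite in_itv/= => h /h; rewrite leye_eq.
- by rewrite leNye.
by rewrite lee_fin; apply: (H d) => //; apply: aeS h => z; rewrite in_itv/= lee_fin.
Qed.

End envelopes.

(** * One-sided slopes and envelopes at a fixed time *)

Section slice.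
Context {R : realType}.
Local Notation mu := (@lebesgue_measure R).
Variables (W g : R -> R) (t K : R).
Hypothesis t0 : 0 < t.
Hypothesis K0 : 0 <= K.
Hypothesis WK : forall x y, `|W x - W y| <= K * `|x - y|.
Hypothesis dW : {ae mu, forall x : R, is_derive x 1 W (g x)}.
Hypothesis slope : forall a b c d, a < b -> b <= c -> c < d ->
  (W d - W c) / (d - c) <= (W b - W a) / (b - a) + (c + d - a - b) / (2 * t).

Let Q m n := (W n - W m) / (n - m).

Let small (d e : R) : 0 < d -> 0 < e -> exists2 h, 0 < h < d & h / (2 * t) <= e.
Proof.
move=> d0 e0; exists (Num.min (d / 2) (e * t)).
  rewrite lt_min divr_gt0//= mulr_gt0//= gt_min ltr_pdivrMr//.
  by rewrite mulr_natr mulr2n ltrDl d0.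
rewrite ler_pdivrMr ?mulr_gt0//; apply: (@le_trans _ _ (e * t)); first by rewrite ge_min lexx orbT.
by rewrite ler_pM2l// ler_peMl ?ler1n// ltW.
Qed.

(** Oleinik's estimate between [[m, n]] and an interval [[z, z + h]] shrunk to a point of
    differentiability; [slope_le_derive] is its mirror image. *)
Lemma derive_le_slope : {ae mu, forall z, forall m n, m < n -> n <= z ->
  g z <= (W n - W m) / (n - m) + (2 * z - m - n) / (2 * t)}.
Proof.
apply: aeS dW => z /is_deriveP dz m n mn nz; apply/ler_addgt0Pr => e e0.
have e2 : 0 < e / 2 by rewrite divr_gt0.
have [d d0 Hd] := dz _ e2; have [h /andP[h0 hd] ht] := small d0 e2.
have := Hd h; rewrite (gtr0_norm h0) => /(_ hd); rewrite ler_norml => /andP[h1 _].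
have zh : z < z + h by rewrite ltrDl.
have h2 := slope mn nz zh; rewrite -/(Q m n) in h2 *.
have h3 : g z <= (W (z + h) - W z) / (z + h - z) + e / 2.
  rewrite [z + h]addrC addrK -lerBlDr ler_pdivlMr// mulrBl [h + z]addrC; lra.
have h4 : (z + (z + h) - m - n) / (2 * t) = (2 * z - m - n) / (2 * t) + h / (2 * t).
  by rewrite -mulrDl; congr (_ / _); ring.
lra.
Qed.

Lemma slope_le_derive : {ae mu, forall w, forall m n, w <= m -> m < n ->
  (W n - W m) / (n - m) <= g w + (m + n - 2 * w) / (2 * t)}.
Proof.
apply: aeS dW => w /is_deriveP dw m n wm mn; apply/ler_addgt0Pr => e e0.
have e2 : 0 < e / 2 by rewrite divr_gt0.
have [d d0 Hd] := dw _ e2; have [h /andP[h0 hd] ht] := small d0 e2.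
have := Hd (- h); rewrite normrN (gtr0_norm h0) => /(_ hd); rewrite ler_norml => /andP[h1 _].
have wh : w - h < w by rewrite ltrBlDr ltrDl.
have h2 := slope wh wm mn; rewrite -/(Q m n) in h2 *.
have h3 : (W w - W (w - h)) / (w - (w - h)) <= g w + e / 2.
  by rewrite subKr ler_pdivrMr// mulrDl; lra.
have h4 : (m + n - (w - h) - w) / (2 * t) = (m + n - 2 * w) / (2 * t) + h / (2 * t).
  by rewrite -mulrDl; congr (_ / _); ring.
lra.
Qed.

Let acW (m n : R) : absolutely_continuous `[m, n] W.
Proof. by apply: (lip_ac K0) => x y _ _; exact: WK. Qed.

Lemma slope_le_ae (m n y : R) : m < n -> {ae mu, forall z, m < z < n -> g z <= y} ->
  (W n - W m) / (n - m) <= y.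
Proof.
move=> mn H; rewrite ler_pdivrMr ?subr_gt0//; apply: ac_le_derive => //; first exact: ltW.
by apply: aeS (aeI dW H) => z [dz hz] /hz ?; exists (g z).
Qed.

Lemma ae_le_slope (m n y : R) : m < n -> {ae mu, forall z, m < z < n -> y <= g z} ->
  y <= (W n - W m) / (n - m).
Proof.
move=> mn H; rewrite ler_pdivlMr ?subr_gt0//; apply: ac_ge_derive => //; first exact: ltW.
by apply: aeS (aeI dW H) => z [dz hz] /hz ?; exists (g z).
Qed.

Variables (a : R * R -> R) (c : R).
Hypothesis ag : {ae mu, forall z, a (z, t) = 2^-1 * (g z + c)}.

(** The slope over the middle third [[m, n]] of [[y, x]] links the two sides: it bounds [g] from
    above near [x] and from below near [y], since radii below a third do not reach it. Taking the
    mean of [g] and [c] turns [(x - y) / t] into [(x - y) / (2 * t)]. *)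
Lemma envelope_gap (x y p q : R) : y < x ->
  (p%:E <= upper_envelope a x t)%E -> (lower_envelope a y t <= q%:E)%E ->
  p <= q + (x - y) / (2 * t).
Proof.
move=> yx hp hq; apply/ler_addgt0Pr => e e0.
pose m := y + (x - y) / 3; pose n := y + 2 * (x - y) / 3.
have xy0 : 0 < x - y by rewrite subr_gt0.
have mn : m < n by rewrite /m /n; lra.
have xy3 : 0 < (x - y) / 3 by rewrite divr_gt0.
have e2 : 0 < e / 2 by rewrite divr_gt0.
have [d /andP[d0 dxy] dt] := small xy3 e2.
have hp' : p <= 2^-1 * (Q m n + (2 * (x + d) - m - n) / (2 * t) + c).
  rewrite -lee_fin; apply: (le_trans hp); apply: (upper_envelope_le d0).
  apply: aeS (aeI ag derive_le_slope) => z [-> hz] /andP[z1 z2].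
  rewrite ler_pM2l ?invr_gt0// lerD2r.
  have nz : n <= z by rewrite /n; lra.
  apply: (le_trans (hz _ _ mn nz)); rewrite lerD2l ler_pM2r ?invr_gt0 ?mulr_gt0//; lra.
have hq' : 2^-1 * (Q m n - (m + n - 2 * (y - d)) / (2 * t) + c) <= q.
  rewrite -lee_fin; apply: le_trans hq; apply: (lower_envelope_ge d0).
  apply: aeS (aeI ag slope_le_derive) => z [-> hz] /andP[z1 z2].
  rewrite ler_pM2l ?invr_gt0// lerD2r lerBlDr.
  have zm : z <= m by rewrite /m; lra.
  apply: (le_trans (hz _ _ zm mn)); rewrite lerD2l ler_pM2r ?invr_gt0 ?mulr_gt0//; lra.
have E : (2 * (x + d) - m - n) / (2 * t) + (m + n - 2 * (y - d)) / (2 * t) =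
    2 * ((x - y) / (2 * t)) + 4 * (d / (2 * t)).
  by rewrite -mulrDl !mulrA -mulrDl; congr (_ / _); ring.
move: hp' hq' E dt; move: (_ / (2 * t)) (_ / (2 * t)) (_ / (2 * t)) (_ / (2 * t)) (Q m n) => *.
lra.
Qed.

(** Oleinik's estimate lets [g] jump downwards only, so the essential supremum is visible to the
    left. Any essential bound [y] of [a] near [x] bounds the slope over [[x - 2 * d, x - d]] by
    [2 * y - c], once [d] is small. *)
Lemma upper_envelope_slopes (x p : R) :
  (forall d, 0 < d -> 2 * p - c <= (W (x - d) - W (x - 2 * d)) / d + 4 * d / t) ->
  (p%:E <= upper_envelope a x t)%E.
Proof.
move=> H; apply: upper_envelope_ge => r y r0 hy.
suff : 2 * p - c <= 2 * y - c by lra.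
apply/ler_addgt0Pr => e e0.
have r3 : 0 < r / 3 by rewrite divr_gt0.
have e8 : 0 < e / 8 by rewrite divr_gt0.
have [d /andP[d0 dr] dt] := small r3 e8.
apply: (le_trans (H d d0)).
have mn : x - 2 * d < x - d by lra.
have h1 : (W (x - d) - W (x - 2 * d)) / (x - d - (x - 2 * d)) <= 2 * y - c.
  apply: slope_le_ae => //; apply: aeS (aeI ag hy) => z [az hz] /andP[z1 z2].
  have := hz; rewrite az; have -> : x - r < z < x + r by apply/andP; split; lra.
  move=> /(_ isT); lra.
rewrite (_ : x - d - (x - 2 * d) = d) in h1; last by ring.
have -> : 4 * d / t = 8 * (d / (2 * t)) by field; rewrite gt_eqF.
lra.
Qed.

Lemma lower_envelope_slopes (x p : R) :
  (forall d, 0 < d -> (W (x + 2 * d) - W (x + d)) / d - 4 * d / t <= 2 * p - c) ->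
  (lower_envelope a x t <= p%:E)%E.
Proof.
move=> H; apply: lower_envelope_le => r y r0 hy.
suff : 2 * y - c <= 2 * p - c by lra.
apply/ler_addgt0Pr => e e0.
have r3 : 0 < r / 3 by rewrite divr_gt0.
have e8 : 0 < e / 8 by rewrite divr_gt0.
have [d /andP[d0 dr] dt] := small r3 e8.
have Hd := H d d0.
have mn : x + d < x + 2 * d by lra.
have h1 : 2 * y - c <= (W (x + 2 * d) - W (x + d)) / (x + 2 * d - (x + d)).
  apply: ae_le_slope => //; apply: aeS (aeI ag hy) => z [az hz] /andP[z1 z2].
  have := hz; rewrite az; have -> : x - r < z < x + r by apply/andP; split; lra.
  move=> /(_ isT); lra.
rewrite (_ : x + 2 * d - (x + d) = d) in h1; last by ring.
have E : 4 * d / t = 8 * (d / (2 * t)) by field; rewrite gt_eqF.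
rewrite E in Hd; lra.
Qed.

Variable M : R.
Hypothesis gM : forall x, `|g x| <= M.

Lemma upper_envelope_bound (x p : R) : (p%:E <= upper_envelope a x t)%E -> p <= M + `|c|.
Proof.
move=> hp; rewrite -lee_fin; apply: (le_trans hp).
apply: (upper_envelope_le ltr01); apply: aeS ag => z -> _.
have := gM z; rewrite ler_norml => /andP[_ h]; have := ler_norm c.
have M0 := le_trans (normr_ge0 _) (gM 0); have c0 := normr_ge0 c; lra.
Qed.

Lemma lower_envelope_bound (x p : R) : (lower_envelope a x t <= p%:E)%E -> - (M + `|c|) <= p.
Proof.
move=> hp; rewrite -lee_fin; apply: le_trans hp.
apply: (lower_envelope_ge ltr01); apply: aeS ag => z -> _.
have := gM z; rewrite ler_norml => /andP[h _]; have := ler_norm (- c); rewrite normrN.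
have M0 := le_trans (normr_ge0 _) (gM 0); have c0 := normr_ge0 c; lra.
Qed.

End slice.

(** * Uniqueness and existence of Filippov solutions *)

Section uniqueness.
Context {R : realType}.
Local Notation mu := (@lebesgue_measure R).

Lemma acB (I : set R) (f g : R -> R) : absolutely_continuous I f -> absolutely_continuous I g ->
  absolutely_continuous I (fun t => f t - g t).
Proof.
move=> acf acg e e0; have e2 : 0 < e / 2 by rewrite divr_gt0.
have [d d0 Hd] := acf _ e2; have [d' d'0 Hd'] := acg _ e2.
exists (Num.min d d'); first by rewrite lt_min d0.
move=> n l r h tr; rewrite lt_min => /andP[h1 h2].
have k1 := Hd _ _ _ h tr h1; have k2 := Hd' _ _ _ h tr h2.
apply: (@le_lt_trans _ _ (\sum_(i < n) (`|f (r i) - f (l i)| + `|g (r i) - g (l i)|))).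
  apply: ler_sum => i _.
  rewrite (_ : _ - _ - _ = (f (r i) - f (l i)) - (g (r i) - g (l i))); last by ring.
  exact: ler_normB.
by rewrite big_split/=; lra.
Qed.

Variables (a : R * R -> R) (B s x : R).
Hypotheses (B0 : 0 <= B) (s0 : 0 <= s).
Hypothesis gap : {ae mu, forall t, 0 < t -> forall x y p q, y < x ->
  (p%:E <= upper_envelope a x t)%E -> (lower_envelope a y t <= q%:E)%E -> p <= q + (x - y) / (2 * t)}.
Hypothesis ub : {ae mu, forall t, 0 < t -> forall x p, (p%:E <= upper_envelope a x t)%E -> p <= B}.
Hypothesis lb : {ae mu, forall t, 0 < t -> forall x p, (lower_envelope a x t <= p%:E)%E -> - B <= p}.

(** An order relation is enough: exchanging the two curves gives equality. *)
Lemma filippov_le (g1 g2 : R -> R) (T : R) : filippov_solution a x s g1 -> filippov_solution a x s g2 ->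
  s <= T -> g1 T <= g2 T.
Proof.
move=> [ac1 i1 d1] [ac2 i2 d2] sT.
pose d t := g1 t - g2 t.
have acd : absolutely_continuous `[s, T] d by apply: acB; [exact: ac1|exact: ac2].
have dd : {ae mu, forall t : R, s < t -> exists2 l, is_derive t 1 d l &
    l <= 2 * B /\ (0 < d t -> l <= d t / (2 * t))}.
  apply: aeS (aeI (aeI d1 d2) (aeI gap (aeI ub lb))) => t [[h1 h2] [hg [hu hl]]] st.
  have t0 : 0 < t := le_lt_trans s0 st.
  have [e1 l1 u1] := h1 st; have [e2 l2 u2] := h2 st.
  exists (derive1 g1 t - derive1 g2 t).
    by rewrite !derive1E; exact: is_deriveB (DeriveDef e1 erefl) (DeriveDef e2 erefl).
  split; first by have := hu t0 _ _ u1; have := hl t0 _ _ l2; lra.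
  by rewrite /d subr_gt0 => /(hg t0) /(_ u1 l2); lra.
have sub t1 t2 : s <= t1 -> t2 <= T -> absolutely_continuous `[t1, t2] d.
  move=> st t2T; apply: ac_sub acd => z; rewrite /= !in_itv/= => /andP[h1 h2].
  by rewrite (le_trans st h1) (le_trans h2 t2T).
have inc t1 t2 : s <= t1 -> t1 <= t2 -> t2 <= T -> d t2 - d t1 <= 2 * B * (t2 - t1).
  move=> st t12 t2T; apply: ac_le_derive => //; first exact: sub.
  apply: aeS dd => t h /andP[t1t _]; have [|l dl [lB _]] := h _; first exact: le_lt_trans t1t.
  by exists l.
suff : d T <= 0 by rewrite /d subr_le0.
(* Its supremum [t0] is the last time at which the difference is nonpositive; after [t0] the
   one-sided estimate holds at almost every time. *)
pose Z := [set t | s <= t <= T /\ d t <= 0].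
have Zs : Z s by rewrite /Z/= lexx sT /d i1 i2 subrr.
have hsZ : has_sup Z by split; [exists s|exists T => t [/andP[]]].
pose t0 := sup Z.
have st0 : s <= t0 by apply: ub_le_sup => //; case: hsZ.
have t0T : t0 <= T by apply: ge_sup; [exists s|move=> t [/andP[]]].
have dt0 : d t0 <= 0.
  apply/ler_addgt0Pr => e e0.
  have B1 : 0 < 2 * B + 1 by rewrite ltr_wpDl// mulr_ge0.
  have [t [/andP[st tT] dt] tt0] := sup_adherent (divr_gt0 e0 B1) hsZ.
  have tt0' : t <= t0 by apply: ub_le_sup => //; [case: hsZ|split=> //; rewrite st].
  have h := inc _ _ st tt0' t0T.
  have : 2 * B * (t0 - t) <= (2 * B + 1) * (e / (2 * B + 1)).
    apply: ler_pM; rewrite ?mulr_ge0 ?subr_ge0 ?lerDl//.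
    by rewrite -/t0 in tt0; lra.
  by rewrite [_ * (e / _)]mulrC divfK ?gt_eqF//; lra.
have pos t : t0 < t -> t <= T -> 0 < d t.
  move=> t0t tT; rewrite ltNge; apply/negP => dt.
  have : t <= t0 by apply: ub_le_sup; [case: hsZ|split=> //; rewrite (le_trans st0 (ltW t0t))].
  by rewrite leNgt t0t.
(* Inserting the bound of rank [n] into [d / (2 * r)] leaves the factor
   [(r - t0) / (2 * r) <= 1 / 2], because [0 <= t0]; this covers [t0 = 0]. *)
have key n t : t0 <= t -> t <= T -> d t <= 2 * B / 2 ^+ n * (t - t0).
  elim: n t => [|n IH] t t0t tT.
    by rewrite expr0 divr1; have := inc _ _ st0 t0t tT; lra.
  apply: (@le_trans _ _ (d t - d t0)); first by rewrite lerBrDr gerDl.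
  apply: ac_le_derive => //; first exact: sub.
  apply: aeS dd => r h /andP[t0r rt]; have [|l dl [_ lr]] := h _; first exact: le_lt_trans t0r.
  have rT : r <= T := le_trans (ltW rt) tT.
  exists l => //; apply: (le_trans (lr (pos _ t0r rT))).
  have r0 : 0 < r by exact: le_lt_trans (le_trans s0 st0) t0r.
  rewrite ler_pdivrMr ?mulr_gt0//; apply: (le_trans (IH _ (ltW t0r) rT)).
  rewrite exprS invfM.
  have Cn : 0 <= 2 * B / 2 ^+ n by rewrite divr_ge0 ?exprn_ge0// mulr_ge0.
  have -> : 2 * B * (2^-1 * (2 ^+ n)^-1) * (2 * r) = 2 * B / 2 ^+ n * r.
    by field; rewrite expf_neq0.
  by rewrite ler_wpM2l// gerDl oppr_le0 (le_trans s0).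
apply/ler_addgt0Pr => e e0; rewrite add0r.
have A0 : 0 <= 2 * B * (T - t0) by rewrite !mulr_ge0// subr_ge0.
have [n hn] : exists n, 2 * B * (T - t0) / e < 2 ^+ n.
  exists (Num.trunc (2 * B * (T - t0) / e)).+1.
  apply: (lt_trans (truncnS_gt _)); rewrite -natrX ltr_nat; exact: ltn_expl.
apply: (le_trans (key n T t0T (lexx _))).
by rewrite mulrAC ler_pdivrMr ?exprn_gt0// [e * _]mulrC -ler_pdivrMr// ltW.
Qed.

End uniqueness.

(** * Euler approximations and their limit *)

Section euler.
Context {R : realType}.
Variables (U : R -> R -> R) (K : R).
Hypothesis K0 : 0 <= K.
Hypothesis UK : forall x t y s, `|U x t - U y s| <= K * (`|x - y| + `|t - s|).
Hypothesis slope : forall t a b c d : R, 0 < t -> a < b -> b <= c -> c < d ->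
  (U d t - U c t) / (d - c) <= (U b t - U a t) / (b - a) + (c + d - a - b) / (2 * t).
Variables (c s x0 : R).
Hypothesis s0 : 0 <= s.

Let h (n : nat) : R := n.+1%:R^-1.
Let h0 n : 0 < h n. Proof. by rewrite invr_gt0. Qed.

(** A difference quotient of [U] replaces [v], which has no meaning at the individual points of a
    curve. The width of the quotient is also the time step. *)
Definition euler_speed n (y r : R) := ((U (y + h n) r - U y r) / h n + c) / 2.

Fixpoint euler n k : R :=
  if k is k'.+1 then euler n k' + h n * euler_speed n (euler n k') (s + k'%:R * h n) else x0.

Let B := (K + `|c|) / 2.
Let B0 : 0 <= B. Proof. by rewrite divr_ge0// addr_ge0. Qed.

Let speedB n y r : - B <= euler_speed n y r <= B.
Proof.
have h1 : `|(U (y + h n) r - U y r) / h n| <= K.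
  rewrite normrM [`|(h n)^-1|]ger0_norm ?invr_ge0 ?(ltW (h0 n))// ler_pdivrMr//.
  apply: (le_trans (UK _ _ _ _)); rewrite subrr normr0 addr0 addrC addKr ger0_norm//.
  exact: ltW.
have c1 := ler_norm c; have c2 := ler_norm (- c); rewrite normrN in c2.
move: h1; rewrite ler_norml => /andP[? ?]; rewrite /B /euler_speed.
by apply/andP; split; lra.
Qed.

Lemma euler_incr n l m lo hi :
  (forall k, (l <= k < l + m)%N -> lo <= euler_speed n (euler n k) (s + k%:R * h n) <= hi) ->
  lo * (m%:R * h n) <= euler n (l + m) - euler n l <= hi * (m%:R * h n).
Proof.
elim: m => [|m IH] H; first by rewrite addn0 !mul0r !mulr0 subrr lexx.
have /andP[h1 h2] : lo * (m%:R * h n) <= euler n (l + m) - euler n l <= hi * (m%:R * h n).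
  by apply: IH => k /andP[lk km]; apply: H; rewrite lk addnS ltnS ltnW.
have /andP[h3 h4] := H (l + m)%N (introT andP (conj (leq_addr _ _) (eq_ind_r (fun z => (l + m < z)%N) (ltnSn _) (addnS l m)))).
rewrite addnS /= -natr1.
have h5 : lo * h n <= h n * euler_speed n (euler n (l + m)) (s + (l + m)%:R * h n).
  by rewrite mulrC ler_pM2l.
have h6 : h n * euler_speed n (euler n (l + m)) (s + (l + m)%:R * h n) <= hi * h n.
  by rewrite [hi * _]mulrC ler_pM2l.
have G (z N w : R) : z * (N * w) + z * w = z * ((N + 1) * w) by ring.
rewrite -!G.
by apply/andP; split; lra.
Qed.

Lemma euler_lip n k l : `|euler n k - euler n l| <= B * `|k%:R * h n - l%:R * h n|.
Proof.
wlog lk : k l / (l <= k)%N.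
  move=> H; case/orP: (leq_total l k) => [/H//|/H].
  by rewrite distrC [`|l%:R * _ - _|]distrC.
have := @euler_incr n l (k - l) (- B) B (fun _ _ => speedB _ _ _).
rewrite subnKC// => /andP[h1 h2].
rewrite -mulrBl -natrB// [`|_ * h n|]ger0_norm ?mulr_ge0 ?(ltW (h0 n))//.
by rewrite ler_norml -mulNr h1 h2.
Qed.

(** The approximations are step functions in time, Lipschitz up to an error of one step, which
    disappears in the limit. [Num.max s t] freezes them before [s], so the limit is Lipschitz on the
    whole line. *)
Let idx n (t : R) := Num.trunc ((Num.max s t - s) / h n).

Let idxP n t : (idx n t)%:R * h n <= Num.max s t - s < (idx n t)%:R * h n + h n.
Proof.
have : 0 <= (Num.max s t - s) / h n.
  by rewrite divr_ge0 ?(ltW (h0 n))// subr_ge0 le_max lexx.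
move=> /truncn_itv/andP[h1 h2]; rewrite -ler_pdivlMr// h1/=.
by move: h2; rewrite -natr1 ltr_pdivrMr// mulrDl mul1r.
Qed.

Let ga n t := euler n (idx n t).

Let ga_lip n t t' : `|ga n t - ga n t'| <= B * (`|t - t'| + h n).
Proof.
apply: (le_trans (euler_lip n _ _)); apply: ler_wpM2l => //.
have /andP[h1 h2] := idxP n t; have /andP[h3 h4] := idxP n t'.
have hm : `|Num.max s t - Num.max s t'| <= `|t - t'|.
  have g1 := ler_norm (t - t'); have g2 := ler_norm (t' - t); rewrite distrC in g2.
  by rewrite ler_norml; case: (leP s t) => ?; case: (leP s t') => ?; apply/andP; split; lra.
move: hm; rewrite !ler_norml => /andP[g1 g2]; apply/andP; split; lra.
Qed.

Let ga_s n : ga n s = x0.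
Proof.
rewrite /ga /idx (_ : Num.max s s = s) ?subrr ?mul0r; last by rewrite maxxx.
by rewrite (_ : Num.trunc 0 = 0%N)//; apply: truncn_def; rewrite lexx ltr01.
Qed.

(** At time [r] the interval [[y, y + h n]] lies between [[p - 2 * d, p - d]] and
    [[p + d, p + 2 * d]], and Oleinik's estimate orders the three slopes. The term [e] pays for
    replacing [r] by the fixed time [t]; [t / 2 <= r] controls [1 / (2 * r)]. *)
Lemma speed_bounds n (t y r d e p : R) : 0 < t -> 0 < d -> h n <= d / 4 ->
  `|y - p| <= d / 4 -> t / 2 <= r -> K * `|r - t| <= e * d ->
  ((U (p + 2 * d) t - U (p + d) t) / d - 4 * d / t + c) / 2 - e <= euler_speed n y r <=
  ((U (p - d) t - U (p - 2 * d) t) / d + 4 * d / t + c) / 2 + e.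
Proof.
move=> t0 d0 hd; rewrite ler_norml => /andP[y1 y2] tr rt.
have t2 : 0 < t / 2 by rewrite divr_gt0.
have r0 : 0 < r := lt_le_trans t2 tr.
have hn := h0 n.
have UU (a b : R) : (U a r - U b r) / d <= (U a t - U b t) / d + 2 * e /\
    (U a t - U b t) / d - 2 * e <= (U a r - U b r) / d.
  have := UK a r a t; have := UK b r b t.
  rewrite !subrr !normr0 !add0r => /le_trans/(_ rt); rewrite ler_norml => /andP[b1 b2].
  move=> /le_trans/(_ rt); rewrite ler_norml => /andP[a1 a2].
  split.
    rewrite ler_pdivrMr// mulrDl divfK ?gt_eqF//; lra.
  rewrite ler_pdivlMr// mulrBl divfK ?gt_eqF//; lra.
have corr w : w <= 4 * d -> w / (2 * r) <= 4 * d / t.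
  move=> wd; rewrite ler_pdivrMr ?mulr_gt0//.
  apply: (le_trans wd); rewrite -[leLHS]mulr1 -[leRHS]mulrA; apply: ler_wpM2l.
    by rewrite mulr_ge0// ltW.
  by rewrite mulrC ler_pdivlMr// mul1r; lra.
have e1 : y + h n - y = h n by ring.
apply/andP; split.
  have o1 : y < y + h n by rewrite ltrDl.
  have o2 : y + h n <= p + d by lra.
  have o3 : p + d < p + 2 * d by lra.
  have := slope r0 o1 o2 o3; rewrite e1.
  rewrite (_ : p + 2 * d - (p + d) = d); last by ring.
  have [_ g1] := UU (p + 2 * d) (p + d).
  have : (p + d + (p + 2 * d) - y - (y + h n)) / (2 * r) <= 4 * d / t by apply: corr; lra.
  rewrite /euler_speed; move: (_ / (2 * r)) (4 * d / t) (_ / h n) ((_ - _) / d) ((_ - _) / d) g1 => *.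
  lra.
have o1 : p - 2 * d < p - d by lra.
have o2 : p - d <= y by lra.
have o3 : y < y + h n by rewrite ltrDl.
have := slope r0 o1 o2 o3; rewrite e1.
rewrite (_ : p - d - (p - 2 * d) = d); last by ring.
have [g1 _] := UU (p - d) (p - 2 * d).
have : (y + (y + h n) - (p - 2 * d) - (p - d)) / (2 * r) <= 4 * d / t by apply: corr; lra.
rewrite /euler_speed; move: (_ / (2 * r)) (4 * d / t) (_ / h n) ((_ - _) / d) ((_ - _) / d) g1 => *.
lra.
Qed.

(** The values at each time stay in a segment, so an ultrafilter finer than that of large indices
    makes them converge at all times at once. Only a common index for three times is retained,
    enough for one increment and its reference point. *)
Lemma euler_limit : exists g : R -> R, forall t0 t1 t2 e : R, 0 < e ->
  exists n, [/\ h n < e, `|ga n t0 - g t0| < e, `|ga n t1 - g t1| < e & `|ga n t2 - g t2| < e].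
Proof.
have [F [uF sF]] := ultraFilterLemma (@eventually_filter).
have gF t : exists p : R, ga n t @[n --> F] --> p.
  have mS : fmap (ga^~ t) F `[x0 - B * (`|t - s| + 1), x0 + B * (`|t - s| + 1)]%classic.
    rewrite /fmap/=; apply: filterS filterT => n _ /=; rewrite in_itv/= -ler_distl -(ga_s n).
    apply: (le_trans (ga_lip _ _ _)); rewrite ler_wpM2l// lerD2l.
    by rewrite /h invf_le1// ler1n.
  have [p [_ cp]] := @segment_compact R _ _ (fmap (ga^~ t) F) _ mS.
  exists p => A Ap; have [//|nA] := in_ultra_setVsetC (ga^~ t @^-1` A) uF.
  by have [z [/= nAz Az]] := cp (~` A) A nA Ap.
pose g t := sval (cid (gF t)); exists g => t0 t1 t2 e e0.
have hg t : \forall n \near F, `|ga n t - g t| < e.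
  have /cvgrPdist_lt/(_ _ e0) := svalP (cid (gF t)).
  by apply: filterS => n; rewrite distrC.
have hh : \forall n \near F, h n < e.
  apply: sF; have /cvgrPdist_lt/(_ _ e0) := @cvg_harmonic R.
  by apply: filterS => n; rewrite sub0r normrN ger0_norm ?invr_ge0.
have [n [? [? [? ?]]]] := @filter_ex _ _ _ _ (filterI hh (filterI (hg t0) (filterI (hg t1) (hg t2)))).
by exists n.
Qed.

Lemma idx_mono n t1 t2 : t1 <= t2 -> (idx n t1 <= idx n t2)%N.
Proof.
move=> t12; apply: le_truncn; rewrite ler_pM2r ?invr_gt0// lerD2r.
by rewrite ge_max !le_max lexx t12 orbT.
Qed.

(** Every node between [t1] and [t2] is within [2 * eta] of [t] in time, and its value within
    [eta + 3 * B * eta] of [p], so that [speed_bounds] applies with the same slopes throughout.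
    Rounding [t1] and [t2] to nodes costs one step [h n]. *)
Lemma euler_local n (t t1 t2 d e p eta : R)
    (lo := ((U (p + 2 * d) t - U (p + d) t) / d - 4 * d / t + c) / 2 - e)
    (hi := ((U (p - d) t - U (p - 2 * d) t) / d + 4 * d / t + c) / 2 + e) : 0 < t -> 0 < d ->
  eta <= t / 4 -> K * (2 * eta) <= e * d -> eta + B * (3 * eta) <= d / 4 ->
  h n <= eta -> `|ga n t - p| <= eta -> s <= t -> s <= t1 -> t1 <= t2 -> t - eta <= t1 -> t2 <= t + eta ->
  lo * (t2 - t1) - `|lo| * h n <= ga n t2 - ga n t1 <= hi * (t2 - t1) + `|hi| * h n.
Proof.
move=> t0 d0 et Ke Be hn gp st st1 t12 et1 et2.
have mx z : s <= z -> Num.max s z = z by move=> sz; apply/max_idPr.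
have /andP[i1 i2] := idxP n t1; have /andP[i3 i4] := idxP n t2; have /andP[i5 i6] := idxP n t.
rewrite (mx _ st1) in i1 i2; rewrite (mx _ (le_trans st1 t12)) in i3 i4; rewrite (mx _ st) in i5 i6.
have hn0 := h0 n.
have i12 := idx_mono n t12.
have eta0 : 0 <= eta by lra.
have H k : (idx n t1 <= k < idx n t1 + (idx n t2 - idx n t1))%N ->
    lo <= euler_speed n (euler n k) (s + k%:R * h n) <= hi.
  rewrite subnKC// => /andP[k1 k2].
  have k1' : (idx n t1)%:R * h n <= k%:R * h n by rewrite ler_pM2r// ler_nat.
  have k2' : k%:R * h n + h n <= (idx n t2)%:R * h n.
    have -> : k%:R * h n + h n = k.+1%:R * h n by rewrite -(natr1 k) mulrDl mul1r.
    by rewrite ler_pM2r// ler_nat.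
  have B3 : 0 <= B * (3 * eta) by apply: mulr_ge0 => //; apply: mulr_ge0.
  have hd : h n <= d / 4 by lra.
  have rt : `|s + k%:R * h n - t| <= 2 * eta by rewrite ler_norml; apply/andP; split; lra.
  apply: speed_bounds => //.
  - have hk : `|k%:R * h n - (idx n t)%:R * h n| <= 3 * eta by rewrite ler_norml; apply/andP; split; lra.
    have h1 := le_trans (euler_lip n k (idx n t)) (ler_wpM2l B0 hk).
    rewrite -[euler n k](subrK (ga n t)) -addrA; apply: (le_trans (ler_normD _ _)).
    by apply: le_trans Be; rewrite [leLHS]addrC; exact: lerD gp h1.
  - by move: rt; rewrite ler_norml => /andP[? ?]; lra.
  - exact: le_trans (ler_wpM2l K0 rt) Ke.
clearbody lo hi.
have := euler_incr H; rewrite subnKC// natrB// mulrBl -/(ga n t2) -/(ga n t1).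
have m1 : `|(idx n t2)%:R * h n - (idx n t1)%:R * h n - (t2 - t1)| <= h n.
  by rewrite ler_norml; apply/andP; split; lra.
move: m1; move: (_%:R * h n - _) => m m1 /andP[b1 b2].
have err z : `|z * m - z * (t2 - t1)| <= `|z| * h n.
  by rewrite -mulrBr normrM ler_wpM2l.
have := err lo; have := err hi; rewrite !ler_norml => /andP[_ e1] /andP[e2 _].
by apply/andP; split; lra.
Qed.

Lemma euler_solution : exists g : R -> R, [/\ g s = x0,
  forall t t', `|g t - g t'| <= B * `|t - t'| &
  forall t d e : R, s < t -> 0 < d -> 0 < e -> exists2 eta, 0 < eta &
    forall t1 t2, s <= t1 -> t1 <= t2 -> t - eta <= t1 -> t2 <= t + eta ->
    (((U (g t + 2 * d) t - U (g t + d) t) / d - 4 * d / t + c) / 2 - e) * (t2 - t1) <= g t2 - g t1 <=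
    (((U (g t - d) t - U (g t - 2 * d) t) / d + 4 * d / t + c) / 2 + e) * (t2 - t1)].
Proof.
have [g gP] := euler_limit; exists g.
have glip t t' : `|g t - g t'| <= B * `|t - t'|.
  apply/ler_addgt0Pr => r r0.
  have B2 : 0 < B + 2 by rewrite ltr_wpDl.
  have [n [n1 n2 n3 _]] := gP t t' t' _ (divr_gt0 r0 B2).
  have n4 := ga_lip n t t'.
  have n5 : B * h n + h n + h n <= r.
    rewrite (_ : _ + h n = (B + 2) * h n); last by ring.
    by rewrite mulrC -ler_pdivlMr// ltW.
  have n6 : `|ga n t - g t| + `|ga n t' - g t'| <= r - B * h n.
    have : 2 * (r / (B + 2)) = r - B * (r / (B + 2)) by field; rewrite gt_eqF.
    have : B * h n <= B * (r / (B + 2)) by rewrite ler_wpM2l// ltW.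
    lra.
  have -> : g t - g t' = - (ga n t - g t) + (ga n t - ga n t') + (ga n t' - g t') by ring.
  apply: (le_trans (ler_normD _ _)); apply: (le_trans (lerD (ler_normD _ _) (lexx _))).
  rewrite normrN; lra.
split=> //.
- apply/eqP; rewrite -subr_eq0 -normr_eq0 eq_le normr_ge0 andbT.
  apply/ler_addgt0Pr => r r0; rewrite add0r.
  have [n [_ n2 _ _]] := gP s s s r r0.
  by move: n2; rewrite ga_s distrC => /ltW.
move=> t d e st d0 e0.
have t0 : 0 < t := le_lt_trans s0 st.
(* The three entries are the three smallness conditions of [euler_local]: positivity of the times,
   change of time in [U], and distance to the reference point. *)
pose eta := Num.min (t / 4) (Num.min (e * d / (2 * (K + 1))) (d / (4 * (1 + 3 * B)))).
have K1 : 0 < K + 1 by rewrite ltr_wpDl.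
have B3 : 0 < 1 + 3 * B by rewrite ltr_pwDl// mulr_ge0.
have eta0 : 0 < eta by rewrite !lt_min !divr_gt0 ?mulr_gt0.
have et : eta <= t / 4 by rewrite /eta ge_min lexx.
have Ke : K * (2 * eta) <= e * d.
  have h1 : eta <= e * d / (2 * (K + 1)) by rewrite /eta !ge_min lexx orbT.
  rewrite ler_pdivlMr ?mulr_gt0// in h1; apply: le_trans h1.
  rewrite (_ : eta * (2 * (K + 1)) = K * (2 * eta) + 2 * eta); last by ring.
  by rewrite lerDl mulr_ge0// ltW.
have Be : eta + B * (3 * eta) <= d / 4.
  have h1 : eta <= d / (4 * (1 + 3 * B)) by rewrite /eta !ge_min lexx !orbT.
  by rewrite ler_pdivlMr ?mulr_gt0// in h1; rewrite ler_pdivlMr//; lra.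
clearbody eta; exists eta => // t1 t2 st1 t12 et1 et2.
set lo := _ - e; set hi := _ + e.
have key r : 0 < r -> lo * (t2 - t1) <= g t2 - g t1 + r /\ g t2 - g t1 <= hi * (t2 - t1) + r.
  move=> r0; have L0 : 0 < `|lo| + `|hi| + 2 by rewrite ltr_wpDl// addr_ge0.
  have [q q0 <-] : exists2 q, 0 < q & (`|lo| + `|hi| + 2) * q = r.
    by exists (r / (`|lo| + `|hi| + 2)); [exact: divr_gt0|rewrite mulrC divfK// gt_eqF].
  have m0 : 0 < Num.min eta q by rewrite lt_min eta0.
  have [n []] := gP t t1 t2 _ m0; rewrite !lt_min.
  move=> /andP[n1 n2] /andP[n3 _] /andP[_ n4] /andP[_ n5].
  have /andP[b1 b2] := euler_local t0 d0 et Ke Be (ltW n1) (ltW n3) (ltW st) st1 t12 et1 et2.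
  rewrite -/lo -/hi in b1 b2; clearbody lo hi.
  have l1 : `|lo| * h n <= `|lo| * q by rewrite ler_wpM2l// ltW.
  have l2 : `|hi| * h n <= `|hi| * q by rewrite ler_wpM2l// ltW.
  have l4 : 0 <= `|lo| * q by rewrite mulr_ge0// ltW.
  have l5 : 0 <= `|hi| * q by rewrite mulr_ge0// ltW.
  move: n4 n5; rewrite !ltr_norml => /andP[n4 n4'] /andP[n5 n5'].
  rewrite !mulrDl; move: b1 b2 l1 l2 l4 l5 n4 n4' n5 n5'.
  move: (`|lo| * h n) (`|hi| * h n) (`|lo| * q) (`|hi| * q) (lo * _) (hi * _) (ga n t1) (ga n t2) (g t1) (g t2).
  by clear=> *; split; lra.
by apply/andP; split; apply/ler_addgt0Pr => r /key[].
Qed.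

End euler.

(** * Derivative of the limit curve and well-posedness *)

Section well_posedness.
Context {R : realType}.
Local Notation mu := (@lebesgue_measure R).

Lemma derive_bound (g : R -> R) (t l lo hi eta : R) : is_derive t 1 g l -> 0 < eta ->
  (forall h, 0 <= h <= eta -> lo * h <= g (t + h) - g t <= hi * h) -> lo <= l <= hi.
Proof.
move=> /is_deriveP dg eta0 H.
suff key e : 0 < e -> lo <= l + e /\ l <= hi + e.
  by apply/andP; split; apply/ler_addgt0Pr => e /key[].
move=> e0; have [d d0 Hd] := dg e e0.
pose m := Num.min eta d.
have m0 : 0 < m by rewrite lt_min eta0.
have m2 : 0 < m / 2 by rewrite divr_gt0.
have mm : m / 2 < m by rewrite ltr_pdivrMr// mulr_natr mulr2n ltrDl.
have [m_eta md] : m / 2 < eta /\ m / 2 < d by move: mm; rewrite {2}/m lt_min => /andP[].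
have := Hd (m / 2); rewrite (gtr0_norm m2) => /(_ md); rewrite ler_norml => /andP[h1 h2].
have := H (m / 2); rewrite (ltW m2) (ltW m_eta) => /(_ isT)/andP[h3 h4].
by split; rewrite -(ler_pM2r m2) mulrDl; lra.
Qed.

End well_posedness.

Theorem theorem1p5 (R : realType) (u0 : R -> R) (u : R * R -> R)
    (hu0 : u0 \in Lfun (@lebesgue_measure R) +oo%E)
    (hu : entropy_solution burgers_flux u0 u) (x s c : R) (hs : 0 <= s) :
  filippov_well_posed (fun p => chord_speed burgers_flux (u p) c) x s.
Proof.
set a := (fun p => _); pose s0 : 0 <= s := hs.
have [v [U [M [K [[mv vM uv] [ULip Ux Ut cons ent]]]]]] := entropy_potential hu.
have slope (t a b c d : R) := @slope_le _ _ _ _ _ mv vM ULip Ux Ut cons ent t a b c d.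
have K0 : 0 <= K.
  by have := le_trans (normr_ge0 _) (ULip 0 0 1 0); rewrite sub0r normrN normr1 subrr normr0 addr0 mulr1.
have M0 : 0 <= M := le_trans (normr_ge0 _) (vM 0 0).
have WK t y z : `|U y t - U z t| <= K * `|y - z|.
  by have := ULip y t z t; rewrite subrr normr0 addr0.
have good : {ae @lebesgue_measure R, forall t, 0 < t -> {ae @lebesgue_measure R, forall y : R, is_derive y 1 (U^~ t) (v y t)} /\
    {ae @lebesgue_measure R, forall z, a (z, t) = 2^-1 * (v z t + c)}}.
  apply: aeS (aeI Ux uv) => t [h1 h2] t0; split; first exact: h1.
  by apply: aeS (h2 (ltW t0)) => z uz; rewrite /a chord_speed_burgersE uz.
have uniq g1 g2 T : filippov_solution a x s g1 -> filippov_solution a x s g2 -> s <= T -> g1 T <= g2 T.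
  apply: (@filippov_le _ a (M + `|c|)) => //; first exact: addr_ge0.
  - apply: aeS good => t h t0 y z p q; have [dW ag] := h t0.
    exact: (envelope_gap t0 dW (fun a b c d => slope t a b c d t0) ag).
  - apply: aeS good => t h t0 y p; have [dW ag] := h t0.
    exact: (upper_envelope_bound ag (vM ^~ t)).
  - apply: aeS good => t h t0 y p; have [dW ag] := h t0.
    exact: (lower_envelope_bound ag (vM ^~ t)).
have [g [gs gL gloc]] := euler_solution K0 ULip slope c x s0.
have B0 : 0 <= (K + `|c|) / 2 by rewrite divr_ge0// addr_ge0.
have gsol : filippov_solution a x s g.
  split=> //; first by move=> T sT; apply: (lip_ac B0) => y z _ _; exact: gL.
  apply: aeS (aeI good (lip_ae_is_derive B0 gL)) => t [h1 [l dl]] st.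
  have t0 : 0 < t := le_lt_trans s0 st.
  have [dW ag] := h1 t0.
  have -> : derive1 g t = l by rewrite derive1E; exact: derive_val.
  (* At fixed [d] the neighbourhood of [t] shrinks with [e]; since [l] is the derivative at [t]
     itself, [e] can be sent to 0 and disappears from the bounds. *)
  have key d : 0 < d ->
      ((U (g t + 2 * d) t - U (g t + d) t) / d - 4 * d / t + c) / 2 <= l <=
      ((U (g t - d) t - U (g t - 2 * d) t) / d + 4 * d / t + c) / 2.
    move=> d0; set lo := _ / 2; set hi := (_ + c) / 2.
    suff H e : 0 < e -> lo - e <= l <= hi + e.
      by apply/andP; split; apply/ler_addgt0Pr => e /H/andP[]; rewrite lerBlDr.
    move=> e0; have [eta eta0 H] := gloc t d e st d0 e0.
    apply: (derive_bound dl eta0) => h /andP[h0 he].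
    have := H t (t + h); rewrite [t + h]addrC addrK; apply.
    - exact: ltW.
    - by rewrite lerDr.
    - by rewrite gerBl ltW.
    - by rewrite addrC lerD2l.
  split; first exact: ex_derive.
  - apply: (lower_envelope_slopes t0 K0 (WK t) dW ag) => d /key/andP[h _]; lra.
  - apply: (upper_envelope_slopes t0 K0 (WK t) dW ag) => d /key/andP[_ h]; lra.
exists g => // g' g'sol T; rewrite in_itv/= andbT => sT.
by apply/eqP; rewrite eq_le !uniq.
Qed.
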